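(* Let $\Sigma^m$ be a submanifold of $M^n(c)\times\mathbb{R}$, with mean curvature vector field $H$ and shape operator $A$. If $V$ is a normal vector field on $\Sigma^m$ that is parallel in the normal bundle ($\nabla^\perp V=0$) and satisfies $\operatorname{trace}A_V=\text{constant}$, then $$\begin{aligned}\tfrac12\Delta|A_V|^2=\;&|\nabla A_V|^2+c\big\{(m-|T|^2)|A_V|^2-2m|A_VT|^2+3(\operatorname{trace}A_V)\langle A_VT,T\rangle\\&+m(\operatorname{trace}(A_NA_V))\langle V,N\rangle-(\operatorname{trace}A_V)^2-m(\operatorname{trace}A_V)\langle H,N\rangle\langle V,N\rangle\big\}\\&+\sum_{\alpha=m+1}^{n+1}\big\{(\operatorname{trace}A_\alpha)(\operatorname{trace}(A_V^2A_\alpha))-(\operatorname{trace}(A_VA_\alpha))^2\big\},\end{aligned}$$ where $\{E_\alpha\}_{\alpha=m+1}^{n+1}$ is a local orthonormal frame field in the normal bundle and $A_\alpha=A_{E_\alpha}$.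
   Context: $M^n(c)$ is a simply connected $n$-dimensional Riemannian manifold of constant sectional curvature $c\in\mathbb{R}$, and $M^n(c)\times\mathbb{R}$ has the product metric $\langle\cdot,\cdot\rangle$ with Levi-Civita connection $\bar\nabla$. $\Sigma^m$ is an immersed submanifold with $m\le n$, second fundamental form $\sigma$, and $H=\frac1m\operatorname{trace}\sigma$. The shape operator $A_V$ and the normal connection $\nabla^\perp$ are defined by $\bar\nabla_XV=-A_VX+\nabla^\perp_XV$ for $X$ tangent and $V$ normal. $\xi$ is the unit vector field tangent to the factor $\mathbb{R}$, and $T$, $N$ are its tangent and normal components along $\Sigma^m$, so $\xi=T+N$. $\Delta=\operatorname{trace}\nabla^2$ is the Laplacian on functions on $\Sigma^m$, and norms of tensors are the standard ones ($|A_V|^2=\operatorname{trace}A_V^2$). *)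

(* Defs.v *)
From HB Require Import structures.
From mathcomp Require Import all_boot all_order all_algebra.
From mathcomp Require Import all_classical all_reals all_analysis.

Set Implicit Arguments.
Unset Strict Implicit.
Unset Printing Implicit Defensive.

Import Order.TTheory GRing.Theory Num.Theory.
Import numFieldTopology.Exports numFieldNormedType.Exports.

Local Open Scope classical_set_scope.
Local Open Scope ring_scope.

(* Vectors are rows and linear maps act on the right:
   row i of the matrix of a linear map is the image of the i-th basis vector. *)

Section calculus.
Context {R : realType}.

Definition pder {n} (i : 'I_n) (u : 'rV[R]_n -> R) : 'rV[R]_n -> R :=
  fun x => 'D_(delta_mx 0 i) u x.

(* To be used for open U. *)
Fixpoint Ck {n} (k : nat) (U : set 'rV[R]_n) (u : 'rV[R]_n -> R) : Prop :=
  if k is k'.+1 then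
    (forall x, U x -> differentiable u x) /\ (forall i, Ck k' U (pder i u))
  else forall x, U x -> {for x, continuous u}.

Definition smooth_on {n} (U : set 'rV[R]_n) (u : 'rV[R]_n -> R) : Prop :=
  forall k, Ck k U u.

Definition smooth_rV {n p} (U : set 'rV[R]_n) (F : 'rV[R]_n -> 'rV[R]_p) :=
  forall b, smooth_on U (fun x => F x 0 b).

Definition smooth_mx {n p q} (U : set 'rV[R]_n) (F : 'rV[R]_n -> 'M[R]_(p, q)) :=
  forall b d, smooth_on U (fun x => F x b d).

Definition jac {n p} (F : 'rV[R]_n -> 'rV[R]_p) (x : 'rV[R]_n) : 'M[R]_(n, p) :=
  \matrix_(i, b) pder i (fun y => F y 0 b) x.

Definition dot {n} (g : 'M[R]_n) (u v : 'rV[R]_n) : R := (u *m g *m v^T) 0 0.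

End calculus.

Record manifold (R : realType) (n : nat) := Manifold {
  points :> topologicalType;
  chart : Type;
  dom : chart -> set points;
  rng : chart -> set 'rV[R]_n;
  crd : chart -> points -> 'rV[R]_n;
  pnt : chart -> 'rV[R]_n -> points;
  points_hausdorff : hausdorff_space points;
  points_second_countable : @second_countable points;
  dom_open : forall a, open (dom a);
  rng_open : forall a, open (rng a);
  dom_cover : forall p, exists a, dom a p;
  crd_rng : forall a p, dom a p -> rng a (crd a p);
  pnt_dom : forall a x, rng a x -> dom a (pnt a x);
  crdK : forall a p, dom a p -> pnt a (crd a p) = p;
  pntK : forall a x, rng a x -> crd a (pnt a x) = x;
  crd_continuous : forall a p, dom a p -> {for p, continuous (crd a)};
  pnt_continuous : forall a x, rng a x -> {for x, continuous (pnt a)};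
  trans_smooth : forall a b,
    smooth_rV [set x | rng a x /\ dom b (pnt a x)] (crd b \o pnt a)
}.

Arguments dom {R n m} _ _ : rename.
Arguments rng {R n m} _ _ : rename.
Arguments crd {R n m} _ _ : rename.
Arguments pnt {R n m} _ _ : rename.

Definition trans {R : realType} {n} {M : manifold R n} (a b : chart M) :
  'rV[R]_n -> 'rV[R]_n := crd b \o pnt a.

Record riemannian (R : realType) (n : nat) := Riemannian {
  rmanifold :> manifold R n;
  rmetric : chart rmanifold -> 'rV[R]_n -> 'M[R]_n;
  rmetric_smooth : forall a, smooth_mx (rng a) (rmetric a);
  rmetric_sym : forall a x, rng a x -> (rmetric a x)^T = rmetric a x;
  rmetric_pos : forall a x v, rng a x -> v != 0 -> 0 < dot (rmetric a x) v v;
  rmetric_trans : forall (a b : chart rmanifold) x, rng a x -> dom b (pnt a x) ->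
    rmetric a x = jac (trans a b) x *m rmetric b (trans a b x)
                 *m (jac (trans a b) x)^T
}.

(* A tangent vector is given by its components in all charts; components in
   charts not containing the base point are irrelevant. *)
Record tangent {R : realType} {n} (M : manifold R n) (q : M) := Tangent {
  tcrd :> chart M -> 'rV[R]_n;
  tcrd_trans : forall a b, dom a q -> dom b q ->
    tcrd b = tcrd a *m jac (trans a b) (crd a q)
}.

Section smooth_lemmas.
Context {R : realType}.

Lemma Ck_cst {n} k (U : set 'rV[R]_n) (c : R) : Ck k U (fun=> c).
Proof.
elim: k c => [|k IH] c /=; first by move=> x _; exact: cst_continuous.
split=> [x _|i]; first exact: differentiable_cst.
suff -> : pder i (fun=> c) = (fun=> 0) :> ('rV[R]_n -> R) by [].
by apply/funext => x; rewrite /pder derive_cst.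
Qed.

Lemma pder_coord {n} (i j : 'I_n) :
  pder i (fun x : 'rV[R]_n => x 0 j) = (fun=> (i == j)%:R).
Proof.
have @f : {linear 'rV[R]_n -> R}.
  by exists (fun x : 'rV[R]_n => x 0 j); do 2![eexists]; do ?[constructor];
    rewrite ?mxE// => ? *; rewrite ?mxE//; move=> ?; rewrite !mxE.
apply/funext => x; rewrite /pder deriveE; last exact: differentiable_coord.
rewrite (_ : (fun y : 'rV[R]_n => y 0 j) = f) // diff_lin.
  by rewrite /= /f /= mxE /= eq_sym.
exact: coord_continuous.
Qed.

Lemma pder_lsubmx {n1 n2} (i : 'I_(n1 + n2)) (u : 'rV[R]_n1 -> R) :
  pder i (u \o lsubmx)
  = match fintype.split i with inl j => pder j u \o lsubmx | inr _ => fun=> 0 end.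
Proof.
apply/funext => x; rewrite /pder -{1}(fintype.splitK i) /derive.
case: (fintype.split i) => j /=.
  have H : forall h : R, lsubmx (h *: delta_mx 0 (lshift n2 j) + x)
      = h *: delta_mx 0 j + lsubmx x.
    by move=> h; apply/rowP => l; rewrite !mxE eq_lshift.
  set F := (X in X @ _); set F' := (X in _ = lim (X @ _)).
  by have -> : F = F' by apply/funext => h; rewrite /F /F' /= H.
have H : forall h : R, lsubmx (h *: delta_mx 0 (rshift n1 j) + x) = lsubmx x.
  by move=> h; apply/rowP => l; rewrite !mxE eq_lrshift andbF mulr0 add0r.
rewrite [X in lim (X @ _)](_ : _ = cst 0) ?lim_cst //.
by apply/funext => h /=; rewrite H subrr scaler0.
Qed.

Lemma pder_rsubmx {n1 n2} (i : 'I_(n1 + n2)) (u : 'rV[R]_n2 -> R) :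
  pder i (u \o rsubmx)
  = match fintype.split i with inl _ => fun=> 0 | inr j => pder j u \o rsubmx end.
Proof.
apply/funext => x; rewrite /pder -{1}(fintype.splitK i) /derive.
case: (fintype.split i) => j /=; last first.
  have H : forall h : R, rsubmx (h *: delta_mx 0 (rshift n1 j) + x)
      = h *: delta_mx 0 j + rsubmx x.
    by move=> h; apply/rowP => l; rewrite !mxE eq_rshift.
  set F := (X in X @ _); set F' := (X in _ = lim (X @ _)).
  by have -> : F = F' by apply/funext => h; rewrite /F /F' /= H.
have H : forall h : R, rsubmx (h *: delta_mx 0 (lshift n2 j) + x) = rsubmx x.
  by move=> h; apply/rowP => l; rewrite !mxE eq_rlshift andbF mulr0 add0r.
rewrite [X in lim (X @ _)](_ : _ = cst 0) ?lim_cst //.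
by apply/funext => h /=; rewrite H subrr scaler0.
Qed.

Lemma Ck_sub {n} k (U V : set 'rV[R]_n) u : V `<=` U -> Ck k U u -> Ck k V u.
Proof.
move=> VU; elim: k u => [|k IH] u /=; first by move=> h x /VU /h.
by move=> [h1 h2]; split=> [x /VU /h1 //|i]; exact/IH/h2.
Qed.

Lemma Ck_lsubmx {n1 n2} k (U : set 'rV[R]_n1) (u : 'rV[R]_n1 -> R) :
  Ck k U u -> Ck k [set x : 'rV[R]_(n1 + n2) | U (lsubmx x)] (u \o lsubmx).
Proof.
elim: k u => [|k IH] u /=.
  by move=> h x Ux; apply: continuous_comp; [exact: continuous_lsubmx|exact: h].
move=> [h1 h2]; split=> [x Ux|i].
  by apply: differentiable_comp; [exact: differentiable_lsubmx|exact: h1].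
by rewrite pder_lsubmx; case: (fintype.split i) => j; [exact: IH|exact: Ck_cst].
Qed.

Lemma Ck_rsubmx {n1 n2} k (U : set 'rV[R]_n2) (u : 'rV[R]_n2 -> R) :
  Ck k U u -> Ck k [set x : 'rV[R]_(n1 + n2) | U (rsubmx x)] (u \o rsubmx).
Proof.
elim: k u => [|k IH] u /=.
  by move=> h x Ux; apply: continuous_comp; [exact: continuous_rsubmx|exact: h].
move=> [h1 h2]; split=> [x Ux|i].
  by apply: differentiable_comp; [exact: differentiable_rsubmx|exact: h1].
by rewrite pder_rsubmx; case: (fintype.split i) => j; [exact: Ck_cst|exact: IH].
Qed.

Lemma Ck_coord {n} k (U : set 'rV[R]_n) (j : 'I_n) : Ck k U (fun x => x 0 j).
Proof.
case: k => [|k] /=; first by move=> x _; exact: coord_continuous.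
split=> [x _|i]; first exact: differentiable_coord.
by rewrite pder_coord; exact: Ck_cst.
Qed.

End smooth_lemmas.

Section topology_lemmas.

Lemma hausdorff_prod (X Y : topologicalType) :
  hausdorff_space X -> hausdorff_space Y -> hausdorff_space (X * Y)%type.
Proof.
move=> hX hY [x y] [x' y'] cl; congr pair.
  apply: hX => A B nA nB.
  have [] := cl (fst @^-1` A) (fst @^-1` B).
  - by exists (A, setT) => //=; [split=> //; exact: filterT|move=> [? ?] []].
  - by exists (B, setT) => //=; [split=> //; exact: filterT|move=> [? ?] []].
  by move=> [u v] /= [? ?]; exists u.
apply: hY => A B nA nB.
have [] := cl (snd @^-1` A) (snd @^-1` B).
- by exists (setT, A) => //=; [split=> //; exact: filterT|move=> [? ?] []].
- by exists (setT, B) => //=; [split=> //; exact: filterT|move=> [? ?] []].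
by move=> [u v] /= [? ?]; exists v.
Qed.

Lemma open_prodX (X Y : topologicalType) (A : set X) (B : set Y) :
  open A -> open B -> open (A `*` B).
Proof.
move=> oA oB; rewrite openE => -[x y] [/= Ax By].
by exists (A, B) => //=; split; apply: open_nbhs_nbhs.
Qed.

Lemma second_countable_prod (X Y : topologicalType) :
  @second_countable X -> @second_countable Y ->
  @second_countable (X * Y)%type.
Proof.
move=> [A cA [oA bA]] [B cB [oB bB]].
exists [set p.1 `*` p.2 | p in A `*` B].
  by apply: (sub_countable (card_image_le _ _)); exact: countableX.
split=> [_ [[a b] [/= Aa Bb] <-]|[x y] C [[P Q] [/= nP nQ] PQC]].
  by apply: open_prodX; [exact: oA|exact: oB].
have [a [Aa ax] aP] := bA x _ nP; have [b [Bb yb] bQ] := bB y _ nQ.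
exists (a `*` b); first by split=> //; exists (a, b).
by move=> [u v] [/= /aP ? /bQ ?]; apply: PQC.
Qed.

Lemma second_countable_line (R : realType) : @second_countable R.
Proof.
exists [set (`]ratr p.1, ratr p.2[%classic : set R) | p in @setT (rat * rat)].
  by apply: (sub_countable (card_image_le _ _)); exact: countableP.
split=> [_ [p _ <-]|x A]; first exact: interval_open.
move=> /nbhs_ballP[e /= e0 eA].
have /rat_in_itvoo[p] : x - e < x by rewrite ltrBlDr ltrDl.
rewrite in_itv/= => /andP[p1 p2].
have /rat_in_itvoo[q] : x < x + e by rewrite ltrDl.
rewrite in_itv/= => /andP[q1 q2].
exists `]ratr p, ratr q[%classic; first by split; [exists (p, q)|rewrite /= in_itv/= p2 q1].
move=> z /=; rewrite in_itv/= => /andP[z1 z2]; apply: eA.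
rewrite -ball_normE /= ltr_distlC (lt_trans p1 z1) /=.
by rewrite (lt_trans z2 q2).
Qed.

End topology_lemmas.

Section product.
Context {R : realType} {n1 n2 : nat}.

Lemma row_mx_continuous (X : topologicalType) (p : X)
    (u : X -> 'rV[R]_n1) (v : X -> 'rV[R]_n2) :
  {for p, continuous u} -> {for p, continuous v} ->
  {for p, continuous (fun q => row_mx (u q) (v q) : 'rV[R]_(n1 + n2))}.
Proof.
move=> cu cv A /nbhs_ballP[e /= e0 eA].
have nu : \forall q \near p, ball (u p) e (u q).
  by apply: cu; exact: nbhsx_ballx.
have nv : \forall q \near p, ball (v p) e (v q).
  by apply: cv; exact: nbhsx_ballx.
apply: filterS2 nu nv => q [_ uq] [_ vq]; apply: eA; split=> // i j.
by rewrite !mxE; case: fintype.splitP => l _; [exact: uq|exact: vq].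
Qed.

Variables (M : manifold R n1) (N : manifold R n2).

Definition prod_crd (a : chart M * chart N) (p : M * N) : 'rV[R]_(n1 + n2) :=
  row_mx (crd a.1 p.1) (crd a.2 p.2).

Definition prod_pnt (a : chart M * chart N) (x : 'rV[R]_(n1 + n2)) : M * N :=
  (pnt a.1 (lsubmx x), pnt a.2 (rsubmx x)).

Definition prod_manifold : manifold R (n1 + n2).
Proof.
apply: (@Manifold R (n1 + n2) (M * N)%type (chart M * chart N)%type
  (fun a => dom a.1 `*` dom a.2)
  (fun a => [set x | rng a.1 (lsubmx x) /\ rng a.2 (rsubmx x)])
  prod_crd prod_pnt).
- by apply: hausdorff_prod; exact: points_hausdorff.
- by apply: second_countable_prod; exact: points_second_countable.
- by move=> a; apply: open_prodX; exact: dom_open.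
- move=> a; apply: openI.
    by apply: (open_comp (f := lsubmx)) => [x _|];
      [exact: continuous_lsubmx|exact: rng_open].
  by apply: (open_comp (f := rsubmx)) => [x _|];
    [exact: continuous_rsubmx|exact: rng_open].
- move=> [p q]; have [a pa] := dom_cover p; have [b qb] := dom_cover q.
  by exists (a, b).
- by move=> a p [/= pa pb]; rewrite /prod_crd row_mxKl row_mxKr;
    split; exact: crd_rng.
- by move=> a x [xa xb]; split=> /=; exact: pnt_dom.
- by move=> a [p q] [/= pa qb];
    rewrite /prod_pnt /prod_crd row_mxKl row_mxKr !crdK.
- by move=> a x [xa xb]; rewrite /prod_pnt /prod_crd /= !pntK // hsubmxK.
- move=> a [p q] [/= pa qb]; apply: row_mx_continuous.
    apply: (@continuous_comp _ _ _ fst (crd a.1)); first exact: cvg_fst.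
    exact: crd_continuous.
  apply: (@continuous_comp _ _ _ snd (crd a.2)); first exact: cvg_snd.
  exact: crd_continuous.
- move=> a x [xa xb].
  have c1 : {for x, continuous (pnt a.1 \o lsubmx)}.
    by apply: continuous_comp; [exact: continuous_lsubmx|exact: pnt_continuous].
  have c2 : {for x, continuous (pnt a.2 \o rsubmx)}.
    by apply: continuous_comp; [exact: continuous_rsubmx|exact: pnt_continuous].
  exact: cvg_pair c1 c2.
move=> a b j k; rewrite -(fintype.splitK j); case: (fintype.split j) => l /=.
  rewrite (_ : (fun x => _) =
      (fun y => trans a.1 b.1 y 0 l) \o (lsubmx : 'rV[R]_(n1 + n2) -> _)).
    apply: Ck_sub (Ck_lsubmx (@trans_smooth _ _ M a.1 b.1 l k)).
    by move=> x [[? ?] [? ?]].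
  by apply/funext => x /=; rewrite row_mxEl.
rewrite (_ : (fun x => _) =
    (fun y => trans a.2 b.2 y 0 l) \o (rsubmx : 'rV[R]_(n1 + n2) -> _)).
  apply: Ck_sub (Ck_rsubmx (@trans_smooth _ _ N a.2 b.2 l k)).
  by move=> x [[? ?] [? ?]].
by apply/funext => x /=; rewrite row_mxEr.
Defined.

End product.

Section riemannian_product.
Context {R : realType} {n1 n2 : nat}.

Lemma jac_prod (f : 'rV[R]_n1 -> 'rV[R]_n1) (g : 'rV[R]_n2 -> 'rV[R]_n2)
    (x : 'rV[R]_(n1 + n2)) :
  jac (fun y => row_mx (f (lsubmx y)) (g (rsubmx y))) x =
  block_mx (jac f (lsubmx x)) 0 0 (jac g (rsubmx x)).
Proof.
apply/matrixP => i j; rewrite -(fintype.splitK i) -(fintype.splitK j) mxE.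
case: (fintype.split j) => k /=.
  rewrite (_ : (fun y => _) = (fun z => f z 0 k) \o lsubmx); last first.
    by apply/funext => y; rewrite row_mxEl.
  rewrite pder_lsubmx -[in RHS](fintype.splitK i) fintype.unsplitK.
  by case: (fintype.split i) => l /=; rewrite ?block_mxEul ?block_mxEdl !mxE.
rewrite (_ : (fun y => _) = (fun z => g z 0 k) \o rsubmx); last first.
  by apply/funext => y; rewrite row_mxEr.
rewrite pder_rsubmx -[in RHS](fintype.splitK i) fintype.unsplitK.
by case: (fintype.split i) => l /=; rewrite ?block_mxEur ?block_mxEdr !mxE.
Qed.

Variables (M : riemannian R n1) (N : riemannian R n2).
Let P := prod_manifold M N.

Definition prod_metric (a : chart P) (x : 'rV[R]_(n1 + n2)) : 'M[R]_(n1 + n2) :=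
  block_mx (rmetric a.1 (lsubmx x)) 0 0 (rmetric a.2 (rsubmx x)).

Lemma dot_block (g : 'M[R]_n1) (h : 'M[R]_n2) (v : 'rV[R]_(n1 + n2)) :
  dot (block_mx g 0 0 h) v v =
  dot g (lsubmx v) (lsubmx v) + dot h (rsubmx v) (rsubmx v).
Proof.
rewrite /dot -[v in LHS]hsubmxK tr_row_mx mul_row_block mul_row_col.
by rewrite !mulmx0 addr0 add0r mxE.
Qed.

Lemma dot_ge0 n (g : 'M[R]_n) (v : 'rV[R]_n) :
  (v != 0 -> 0 < dot g v v) -> 0 <= dot g v v.
Proof.
case: (eqVneq v 0) => [-> _|_ /(_ isT)/ltW //].
by rewrite /dot !mul0mx mxE.
Qed.

Definition prod_riemannian : riemannian R (n1 + n2).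
Proof.
apply: (@Riemannian R (n1 + n2) P prod_metric).
- move=> a j k; rewrite -(fintype.splitK j) -(fintype.splitK k).
  case: (fintype.split j) => i; case: (fintype.split k) => l q /=.
  + rewrite (_ : (fun x => _) =
        (fun y => rmetric a.1 y i l) \o (lsubmx : 'rV[R]_(n1 + n2) -> _)).
      by apply: Ck_sub (Ck_lsubmx (@rmetric_smooth _ _ M a.1 i l q)) => x [].
    by apply/funext => x; rewrite /prod_metric block_mxEul.
  + rewrite (_ : (fun x => _) = fun=> 0); first exact: Ck_cst.
    by apply/funext => x; rewrite /prod_metric block_mxEur mxE.
  + rewrite (_ : (fun x => _) = fun=> 0); first exact: Ck_cst.
    by apply/funext => x; rewrite /prod_metric block_mxEdl mxE.
  + rewrite (_ : (fun x => _) =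
        (fun y => rmetric a.2 y i l) \o (rsubmx : 'rV[R]_(n1 + n2) -> _)).
      by apply: Ck_sub (Ck_rsubmx (@rmetric_smooth _ _ N a.2 i l q)) => x [].
    by apply/funext => x; rewrite /prod_metric block_mxEdr.
- move=> a x [xa xb].
  by rewrite /prod_metric tr_block_mx !rmetric_sym // !trmx0.
- move=> a x v [xa xb] v0; rewrite /prod_metric dot_block.
  have p1 := @rmetric_pos _ _ M a.1 _ (lsubmx v) xa.
  have p2 := @rmetric_pos _ _ N a.2 _ (rsubmx v) xb.
  case: (eqVneq (lsubmx v) 0) => [v1|v1]; last first.
    by apply: ltr_wpDr; [exact: dot_ge0|exact: p1].
  apply: ltr_wpDl; first exact: dot_ge0.
  apply: p2; apply: contraNneq v0 => v2.
  by rewrite -[v]hsubmxK v1 v2 row_mx0.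
move=> a b x [xa1 xa2] [xb1 xb2].
rewrite (_ : trans a b = fun y : 'rV[R]_(n1 + n2) =>
  row_mx (trans a.1 b.1 (lsubmx y)) (trans a.2 b.2 (rsubmx y))) //.
rewrite jac_prod /prod_metric tr_block_mx !mulmx_block row_mxKl row_mxKr.
rewrite !(mul0mx, mulmx0, addr0, add0r, trmx0).
by rewrite -!rmetric_trans.
Defined.

End riemannian_product.

Section line.
Variable R : realType.

Lemma const_mx_continuous : continuous (fun t : R => const_mx t : 'rV[R]_1).
Proof.
move=> t A /nbhs_ballP[e /= e0 eA].
have nt : \forall s \near t, ball t e s by exact: nbhsx_ballx.
by apply: filterS nt => s ts; apply: eA; split=> // i j; rewrite !mxE.
Qed.

Definition line_manifold : manifold R 1.
Proof.
apply: (@Manifold R 1 _ unit (fun=> [set: R]) (fun=> setT)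
  (fun _ t => const_mx t) (fun _ x => x 0 0)).
- exact: Rhausdorff.
- exact: second_countable_line.
- by move=> _; exact: openT.
- by move=> _; exact: openT.
- by move=> t; exists tt.
- by [].
- by [].
- by move=> _ t _; rewrite mxE.
- by move=> _ x _; apply/rowP => j; rewrite mxE ord1.
- by move=> _ t _; exact: const_mx_continuous.
- by move=> _ x _; exact: coord_continuous.
move=> a b j.
have -> : (fun x : 'rV[R]_1 => (const_mx (x 0 0) : 'rV[R]_1) 0 j)
    = (fun x : 'rV[R]_1 => x 0 0).
  by apply/funext => x; rewrite mxE.
by move=> k; exact: Ck_coord.
Defined.

Lemma jac_line (a b : chart line_manifold) x : jac (trans a b) x = 1%:M.
Proof.
apply/matrixP => i j; rewrite !ord1 mxE.
rewrite (_ : (fun y => _) = fun y : 'rV[R]_1 => y 0 0).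
  by rewrite pder_coord mxE.
by apply/funext => y; rewrite /trans /= mxE.
Qed.

Definition line : riemannian R 1.
Proof.
apply: (@Riemannian R 1 line_manifold (fun _ _ => 1%:M)).
- by move=> a i j k; exact: Ck_cst.
- by move=> a x _; exact: trmx1.
- move=> a x v _ v0; rewrite /dot mulmx1 mxE big_ord1 mxE -expr2.
  rewrite exprn_even_gt0 //=; apply: contraNneq v0 => v0.
  by apply/eqP/rowP => j; rewrite ord1 v0 mxE.
by move=> a b x _ _; rewrite jac_line !mul1mx trmx1.
Defined.

End line.

Definition product_with_line {R : realType} {n} (M : riemannian R n) :
  riemannian R (n + 1) := prod_riemannian M (line R).

(* the unit vector field tangent to the factor R *)
Definition vertical {R : realType} {n} {M : riemannian R n}
  (q : product_with_line M) : tangent q.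
Proof.
apply: (@Tangent _ _ _ q (fun=> row_mx 0 (const_mx 1))) => a b qa qb.
rewrite (_ : trans a b = fun y : 'rV[R]_(n + 1) =>
  row_mx (trans a.1 b.1 (lsubmx y)) (trans a.2 b.2 (rsubmx y))) //.
rewrite jac_prod jac_line mul_row_block.
by rewrite !(mul0mx, mulmx0, addr0, add0r) mulmx1.
Defined.

Definition simply_connected (R : realType) (X : topologicalType) : Prop :=
  let I : set R := `[0, 1]%classic in
  [/\ exists x : X, True,
      forall x y : X, exists gamma : R -> X,
        [/\ {within I, continuous gamma}, gamma 0 = x & gamma 1 = y]
    & forall gamma : R -> X,
        {within I, continuous gamma} -> gamma 0 = gamma 1 ->
        exists h : R * R -> X,
          [/\ {within I `*` I, continuous h},
              forall t, I t -> h (0, t) = gamma t,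
              forall t, I t -> h (1, t) = gamma 0
            & forall s, I s -> h (s, 0) = gamma 0 /\ h (s, 1) = gamma 0]].

Section metric_in_a_chart.
Context {R : realType} {n : nat}.
Variable g : 'rV[R]_n -> 'M[R]_n.

(* nabla_{d_i} d_j for the Levi-Civita connection of g *)
Definition christoffel (i j : 'I_n) (x : 'rV[R]_n) : 'rV[R]_n :=
  2^-1 *: ((\row_l (pder i (fun y => g y j l) x + pder j (fun y => g y i l) x
                    - pder l (fun y => g y i j) x)) *m invmx (g x)).

(* R(d_i, d_j) d_l with R(X,Y)Z = nabla_X nabla_Y Z - nabla_Y nabla_X Z
   - nabla_[X,Y] Z *)
Definition curvature (i j l : 'I_n) (x : 'rV[R]_n) : 'rV[R]_n :=
  \row_p (pder i (fun y => christoffel j l y 0 p) x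
          - pder j (fun y => christoffel i l y 0 p) x)
  + \sum_q (christoffel j l x 0 q *: christoffel i q x
            - christoffel i l x 0 q *: christoffel j q x).

Definition curvature_vec (X Y Z : 'rV[R]_n) (x : 'rV[R]_n) : 'rV[R]_n :=
  \sum_i \sum_j \sum_l (X 0 i * Y 0 j * Z 0 l) *: curvature i j l x.

Definition sectional (X Y : 'rV[R]_n) (x : 'rV[R]_n) : R :=
  dot (g x) (curvature_vec X Y Y x) X
  / (dot (g x) X X * dot (g x) Y Y - dot (g x) X Y ^+ 2).

Definition hessian (u : 'rV[R]_n -> R) (x : 'rV[R]_n) : 'M[R]_n :=
  \matrix_(i, j) (pder i (pder j u) x
                  - \sum_l christoffel i j x 0 l * pder l u x).

Definition laplacian (u : 'rV[R]_n -> R) (x : 'rV[R]_n) : R :=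
  \tr (invmx (g x) *m hessian u x).

(* For a field A of endomorphisms of the tangent spaces, the matrix of
   nabla_{d_i} A; the entry A x j l is the l-th component of A d_j. *)
Definition nabla_end (A : 'rV[R]_n -> 'M[R]_n) (i : 'I_n) (x : 'rV[R]_n) :
  'M[R]_n :=
  \matrix_(j, l) (pder i (fun y => A y j l) x
                  + \sum_q A x j q * christoffel i q x 0 l
                  - \sum_q christoffel i j x 0 q * A x q l).

(* <B, C> = trace (B o C^* ), C^* being the g-adjoint of C *)
Definition dot_end (B C : 'M[R]_n) (x : 'rV[R]_n) : R :=
  \tr (invmx (g x) *m B *m g x *m C^T).

Definition normsq_nabla_end (A : 'rV[R]_n -> 'M[R]_n) (x : 'rV[R]_n) : R :=
  \sum_i \sum_j
    invmx (g x) i j * dot_end (nabla_end A i x) (nabla_end A j x) x.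

End metric_in_a_chart.

Definition constant_curvature {R : realType} {n} (M : riemannian R n) (c : R) :=
  forall (a : chart M) x X Y, rng a x -> row_free (col_mx X Y) ->
    sectional (rmetric a) X Y x = c.

(* F is an immersion and G the metric of the target, both in coordinates; w is
   a vector at F x and W a vector field along F, in the target coordinates. *)
Section immersion_in_charts.
Context {R : realType} {m k : nat}.
Variables (G : 'rV[R]_k -> 'M[R]_k) (F : 'rV[R]_m -> 'rV[R]_k).

Definition induced_metric (x : 'rV[R]_m) : 'M[R]_m :=
  jac F x *m G (F x) *m (jac F x)^T.

Definition nabla_bar (i : 'I_m) (W : 'rV[R]_m -> 'rV[R]_k) (x : 'rV[R]_m) :
  'rV[R]_k :=
  \row_b pder i (fun y => W y 0 b) x
  + \sum_p \sum_q (jac F x i p * W x 0 q) *: christoffel G p q (F x).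

(* tangential component, in the coordinates of the source *)
Definition tangential (w : 'rV[R]_k) (x : 'rV[R]_m) : 'rV[R]_m :=
  w *m G (F x) *m (jac F x)^T *m invmx (induced_metric x).

Definition nor (w : 'rV[R]_k) (x : 'rV[R]_m) : 'rV[R]_k :=
  w - tangential w x *m jac F x.

Definition second_fundamental (i j : 'I_m) (x : 'rV[R]_m) : 'rV[R]_k :=
  nor (nabla_bar i (fun y => row j (jac F y)) x) x.

Definition mean_curvature (x : 'rV[R]_m) : 'rV[R]_k :=
  m%:R^-1 *: \sum_i \sum_j invmx (induced_metric x) i j *: second_fundamental i j x.

Definition shape_op (W : 'rV[R]_m -> 'rV[R]_k) (x : 'rV[R]_m) : 'M[R]_m :=
  \matrix_(i < m) - tangential (nabla_bar i W x) x.

Definition nabla_perp (i : 'I_m) (W : 'rV[R]_m -> 'rV[R]_k) (x : 'rV[R]_m) :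
  'rV[R]_k := nor (nabla_bar i W x) x.

End immersion_in_charts.

Section submanifolds.
Context {R : realType} {m k : nat} {S : manifold R m} {P : riemannian R k}.
Variable f : S -> P.

Definition lmap (i : chart S) (a : chart P) : 'rV[R]_m -> 'rV[R]_k :=
  crd a \o f \o pnt i.

Definition ldom (i : chart S) (a : chart P) : set 'rV[R]_m :=
  [set x | rng i x /\ dom a (f (pnt i x))].

Definition immersion : Prop :=
  continuous f /\
  forall i a, smooth_rV (ldom i a) (lmap i a) /\
    forall x, ldom i a x -> row_free (jac (lmap i a) x).

Definition lfield (W : forall p, tangent (f p)) (i : chart S) (a : chart P) :
  'rV[R]_m -> 'rV[R]_k := fun x => W (pnt i x) a.

Definition normal_field (U : set S) (W : forall p, tangent (f p)) : Prop :=
  forall i a,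
    let D := ldom i a `&` pnt i @^-1` U in
    smooth_rV D (lfield W i a) /\
    forall x, D x ->
      lfield W i a x *m rmetric a (lmap i a x) *m (jac (lmap i a) x)^T = 0.

Definition parallel (W : forall p, tangent (f p)) : Prop :=
  forall i a x, ldom i a x ->
    forall j, nabla_perp (rmetric a) (lmap i a) j (lfield W i a) x = 0.

Definition constant_trace (W : forall p, tangent (f p)) : Prop :=
  exists r : R, forall i a x, ldom i a x ->
    \tr (shape_op (rmetric a) (lmap i a) (lfield W i a) x) = r.

Definition orthonormal_normal_frame (U : set S)
    (E : 'I_(k - m) -> forall p, tangent (f p)) : Prop :=
  (forall alpha, normal_field U (E alpha)) /\
  forall p a, U p -> dom a (f p) ->
    forall alpha beta,
      dot (rmetric a (crd a (f p))) (E alpha p a) (E beta p a)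
      = (alpha == beta)%:R.

End submanifolds.

(* Main.v *)
Require Import Defs.
From HB Require Import structures.
From mathcomp Require Import all_boot all_order all_algebra ring lra.
From mathcomp Require Import all_classical all_reals all_analysis.
Set Implicit Arguments.
Unset Strict Implicit.
Unset Printing Implicit Defensive.
Import Order.TTheory GRing.Theory Num.Theory.
Import numFieldTopology.Exports numFieldNormedType.Exports.
Local Open Scope ring_scope.

(* Over the ring of smooth functions on a chart domain of the submanifold, with
   its commuting derivations, every tensor and connection becomes a matrix, and
   the formula is an identity of matrices. Codazzi and parallelism of V give
   (nabla_X A)Y - (nabla_Y A)X = c <V,xi> (<Y,T>X - <X,T>Y), so the rough
   Laplacian of A = A_V is obtained by exchanging the two covariant
   derivatives of A and using that tr A is constant. The exchange costs the
   curvature of the submanifold, which Gauss expresses through the curvature of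
   M x R and the A_alpha; Ricci shows that A_V commutes with every A_alpha.
   Finally (1/2) Delta |A|^2 = |nabla A|^2 + <A, Delta A>. *)

(** The algebra needs only Leibniz' rule, commuting derivations and an inverse of the Gram matrix,
    so an abstract differential ring suffices; differentiability conditions are met once, when the
    smooth functions on an open set are shown to form such a ring. The coordinate frame is kept
    throughout: its fields commute, at the price of contracting every trace with the inverse metric
    [gi]. The ambient connection is pulled back to the chart domain of the submanifold, so that
    fields along the immersion are plain rows over one ring. The right-hand side of Codazzi is not
    parallel. Since xi is parallel, d<V,xi> = -<AT,.> and nabla T = A_N; these derivatives produce
    the terms with A_N and complete the coefficients of |AT|^2 and <AT,T>, of which the curvature
    supplies only a part. Constant sectional curvature prescribes only a quadratic expression in the
    curvature of M, and only on independent pairs; the full tensor is recovered by polarisation. *)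

Lemma addmxE {A : nmodType} {p q} (X Y : 'M[A]_(p, q)) i j :
  (X + Y) i j = X i j + Y i j.
Proof. by rewrite mxE. Qed.

Lemma oppmxE {A : zmodType} {p q} (X : 'M[A]_(p, q)) i j :
  (- X) i j = - X i j.
Proof. by rewrite mxE. Qed.

(** Lets [ring] use one equation as a hypothesis: the goal follows once its two sides differ by the
    same polynomial as those of the known equation. *)
Lemma eq_of_subr {A : zmodType} (x y a b : A) : x = y -> a - b = x - y -> a = b.
Proof. by move=> -> /eqP; rewrite subrr subr_eq0 => /eqP. Qed.

Lemma tr_addmx {A : nmodType} {p q} (X Y : 'M[A]_(p, q)) :
  (X + Y)^T = X^T + Y^T.
Proof. by apply/matrixP => i j; rewrite !mxE. Qed.

Lemma tr_oppmx {A : zmodType} {p q} (X : 'M[A]_(p, q)) : (- X)^T = - X^T.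
Proof. by apply/matrixP => i j; rewrite !mxE. Qed.

(** * Connections over a differential ring *)

Section connection.
Context {C : comPzRingType} {m : nat}.
Variable d : 'I_m -> {additive C -> C}.
Hypothesis dM : forall i a b, d i (a * b) = d i a * b + a * d i b.
Hypothesis dC : forall i j a, d i (d j a) = d j (d i a).

Lemma dmxM i n p q (X : 'M[C]_(n, p)) (Y : 'M[C]_(p, q)) :
  map_mx (d i) (X *m Y) = map_mx (d i) X *m Y + X *m map_mx (d i) Y.
Proof.
apply/matrixP => a b; rewrite !mxE raddf_sum -big_split /=.
by apply: eq_bigr => l _; rewrite !mxE dM.
Qed.

Lemma dmx1 i n : map_mx (d i) (1%:M : 'M[C]_n) = 0.
Proof.
have d1 : d i 1 = 0.
  by have := dM i 1 1; rewrite !mulr1 mul1r -[LHS]addr0 => /addrI <-.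
by apply/matrixP => a b; rewrite !mxE; case: (a == b); rewrite ?d1 ?raddf0.
Qed.

Lemma dmxC i j p q (X : 'M[C]_(p, q)) :
  map_mx (d i) (map_mx (d j) X) = map_mx (d j) (map_mx (d i) X).
Proof. by apply/matrixP => a b; rewrite !mxE dC. Qed.

Lemma d_trace i n (X : 'M[C]_n) : d i (\tr X) = \tr (map_mx (d i) X).
Proof. by rewrite raddf_sum; apply: eq_bigr => l _; rewrite mxE. Qed.

Lemma dmx_tr i p q (X : 'M[C]_(p, q)) :
  map_mx (d i) X^T = (map_mx (d i) X)^T.
Proof. by rewrite map_trmx. Qed.

Section bundle.
Context {k : nat}.
Variable om : 'I_m -> 'M[C]_k.

(* om i is the connection matrix in the direction i, acting on rows; the
   definitions are locked so that matching up to conversion stays cheap. *)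
Definition cov {p} i (X : 'M[C]_(p, k)) := locked (map_mx (d i) X + X *m om i).

Definition curv i l :=
  locked (map_mx (d i) (om l) - map_mx (d l) (om i) + om l *m om i - om i *m om l).

Definition nab i (A : 'M[C]_k) :=
  locked (map_mx (d i) A + A *m om i - om i *m A).

Lemma covE i p (X : 'M[C]_(p, k)) : cov i X = map_mx (d i) X + X *m om i.
Proof. exact: esym (lock _). Qed.

Lemma curvE i l : curv i l =
  map_mx (d i) (om l) - map_mx (d l) (om i) + om l *m om i - om i *m om l.
Proof. exact: esym (lock _). Qed.

Lemma nabE i A : nab i A = map_mx (d i) A + A *m om i - om i *m A.
Proof. exact: esym (lock _). Qed.

Lemma covM i p q (Y : 'M[C]_(p, q)) (X : 'M[C]_(q, k)) :
  cov i (Y *m X) = map_mx (d i) Y *m X + Y *m cov i X.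
Proof. by rewrite !covE dmxM mulmxDr addrA mulmxA. Qed.

Lemma covD i p (X Y : 'M[C]_(p, k)) : cov i (X + Y) = cov i X + cov i Y.
Proof. by rewrite !covE map_mxD mulmxDl addrACA. Qed.

Lemma covN i p (X : 'M[C]_(p, k)) : cov i (- X) = - cov i X.
Proof. by rewrite !covE map_mxN mulNmx opprD. Qed.

Lemma row_cov i p (X : 'M[C]_(p, k)) j : row j (cov i X) = cov i (row j X).
Proof. by rewrite !covE raddfD /= row_mul map_row. Qed.

(** Sections are rows, so the later derivative multiplies further to the right: [cov i (cov l X)]
    contains [X *m om l *m om i], whence the order of the products in [curv]. *)
Lemma cov_cov i l p (X : 'M[C]_(p, k)) :
  cov i (cov l X) - cov l (cov i X) = X *m curv i l.
Proof.
rewrite !(covE, curvE) !(map_mxD, dmxM, mulmxDl, mulmxDr, mulmxN, mulNmx) !mulmxA.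
rewrite (dmxC l i).
by apply/matrixP => a b; rewrite !(addmxE, oppmxE); ring.
Qed.

(** Each curvature is a commutator of covariant derivatives of a row of [J]; torsion-freeness makes
    the six second derivatives cancel in pairs. *)
Lemma bianchi (J : 'M[C]_(m, k)) i j l :
  (forall i j, row j (cov i J) = row i (cov j J)) ->
  row l (J *m curv i j) + row i (J *m curv j l) + row j (J *m curv l i) = 0.
Proof.
move=> sym; have sym' p q : cov p (row q J) = cov q (row p J).
  by rewrite -!row_cov sym.
rewrite -!cov_cov !raddfB /= !row_cov (sym' j l) (sym' i l) (sym' i j).
by apply/matrixP => a b; rewrite !(addmxE, oppmxE) [RHS]mxE; ring.
Qed.

Lemma nab_nab i l A :
  nab i (nab l A) - nab l (nab i A) = A *m curv i l - curv i l *m A.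
Proof.
rewrite !(nabE, curvE).
rewrite !(map_mxD, map_mxN, dmxM, mulmxDl, mulmxDr, mulmxN, mulNmx) !mulmxA.
rewrite (dmxC l i).
by apply/matrixP => a b; rewrite !(addmxE, oppmxE); ring.
Qed.

(** The connection terms of [nab] form a commutator, which has trace zero. *)
Lemma d_trace_nab i A : d i (\tr A) = \tr (nab i A).
Proof.
by rewrite !nabE mxtraceD mxtraceD raddfN /= [\tr (om i *m A)]mxtrace_mulC
  addrK d_trace.
Qed.

Lemma nab_mul i A B : nab i (A *m B) = nab i A *m B + A *m nab i B.
Proof.
rewrite !nabE dmxM !(mulmxDl, mulmxDr, mulmxN, mulNmx) !mulmxA.
by apply/matrixP => a b; rewrite !(addmxE, oppmxE); ring.
Qed.

Section metric.
Variable G : 'M[C]_k.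
Hypothesis Gsym : G^T = G.
Hypothesis dG : forall i, map_mx (d i) G = om i *m G + G *m (om i)^T.

Lemma cov_metric i p q (X : 'M[C]_(p, k)) (Y : 'M[C]_(q, k)) :
  map_mx (d i) (X *m G *m Y^T) = cov i X *m G *m Y^T + X *m G *m (cov i Y)^T.
Proof.
rewrite !covE !dmxM dG dmx_tr tr_addmx trmx_mul.
rewrite !(mulmxDl, mulmxDr) !mulmxA.
by apply/matrixP => a b; rewrite !(addmxE, oppmxE); ring.
Qed.

Lemma nab_selfadj i A : A *m G = G *m A^T -> nab i A *m G = G *m (nab i A)^T.
Proof.
move=> AG; have := congr1 (map_mx (d i)) AG.
rewrite !dmxM dG !(mulmxDr, mulmxDl) !mulmxA dmx_tr AG => e.
rewrite !nabE !(tr_addmx, tr_oppmx, trmx_mul) !(mulmxDr, mulmxDl) mulNmx mulmxN.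
rewrite -(mulmxA _ A) AG !mulmxA.
apply/matrixP => a b; move/matrixP/(_ a b): e; rewrite !(addmxE, oppmxE) => e.
by apply: (@eq_of_subr C _ _ _ _ e); ring.
Qed.

(** Both orders of the second derivative of [G] are expanded by [dG]; the terms symmetric in the two
    indices drop out and the rest is the skewness. *)
Lemma curv_skew i l : curv i l *m G + G *m (curv i l)^T = 0.
Proof.
have dd p q : map_mx (d p) (map_mx (d q) G) =
    map_mx (d p) (om q) *m G + G *m (map_mx (d p) (om q))^T
    + (om q *m (om p *m G + G *m (om p)^T) + (om p *m G + G *m (om p)^T) *m (om q)^T).
  rewrite dG map_mxD !dmxM dmx_tr !dG; apply/matrixP => a b.
  by rewrite !(addmxE, oppmxE); ring.
have := dd i l; rewrite dmxC dd !curvE.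
rewrite !(tr_addmx, tr_oppmx, trmx_mul, mulmxDr, mulmxDl, mulmxN, mulNmx) !mulmxA => e.
apply/matrixP => a b; move/matrixP/(_ a b): e; rewrite !(addmxE, oppmxE) => e.
by rewrite [RHS]mxE; apply: (@eq_of_subr C _ _ _ _ (esym e)); ring.
Qed.

End metric.
End bundle.

(** Koszul's formula. It later identifies the induced connection [lc] with the Christoffel symbols
    of the induced metric. *)
Lemma koszul (om : 'I_m -> 'M[C]_m) (G : 'M[C]_m) i j l :
  G^T = G -> (forall i, map_mx (d i) G = om i *m G + G *m (om i)^T) ->
  (forall p q, row p (om q) = row q (om p)) ->
  d i (G j l) + d j (G i l) - d l (G i j) = (om i *m G) j l *+ 2.
Proof.
move=> Gsym dG sym; have dGE p q r : d p (G q r) = (om p *m G) q r + (om p *m G) r q.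
  have /matrixP/(_ q r) := dG p; rewrite [LHS]mxE addmxE => ->.
  by rewrite -[G *m _]trmxK trmx_mul trmxK Gsym [X in _ + X]mxE.
have symE p q r : (om p *m G) q r = (om q *m G) p r.
  by have /rowP/(_ r) := congr1 (mulmx^~ G) (sym q p); rewrite -!row_mul !mxE.
by rewrite !dGE (symE j i) (symE l i) (symE l j) (symE i l); ring.
Qed.

(** * Immersions: the equations of Gauss, Codazzi and Ricci *)

Section immersion.
Context {k : nat}.
Variables (om : 'I_m -> 'M[C]_k) (G : 'M[C]_k) (J : 'M[C]_(m, k)) (gi : 'M[C]_m).
Hypothesis Gsym : G^T = G.
Hypothesis dG : forall i, map_mx (d i) G = om i *m G + G *m (om i)^T.
Hypothesis torsion : forall i j, row j (cov om i J) = row i (cov om j J).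
Let g := J *m G *m J^T.
Hypothesis giK : gi *m g = 1%:M.
Hypothesis gKi : g *m gi = 1%:M.

(* J is the differential of the immersion, whose rows span the tangent space:
   tang is the tangential component, lc the induced connection, sff the second
   fundamental form and shape W the shape operator of W. *)
Definition tang := locked (G *m J^T *m gi).

Definition lc i := locked (cov om i J *m tang).

Definition sff i := locked (cov om i J - lc i *m J).

Definition shape (W : 'rV[C]_k) : 'M[C]_m :=
  locked (\matrix_i - (cov om i W *m tang)).

Lemma tangE : tang = G *m J^T *m gi. Proof. exact: esym (lock _). Qed.

Lemma lcE i : lc i = cov om i J *m tang. Proof. exact: esym (lock _). Qed.

Lemma sffE i : sff i = cov om i J - lc i *m J. Proof. exact: esym (lock _). Qed.

Lemma row_shape W i : row i (shape W) = - (cov om i W *m tang).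
Proof. by rewrite /shape -lock rowK. Qed.

Lemma induced_sym : g^T = g.
Proof. by rewrite /g !trmx_mul trmxK Gsym mulmxA. Qed.

Lemma tangK : J *m tang = 1%:M.
Proof. by rewrite tangE !mulmxA. Qed.

Lemma tang_metric : tang *m g = G *m J^T.
Proof. by rewrite tangE -mulmxA giK mulmx1. Qed.

Lemma tang_metric_tr : g *m tang^T = J *m G.
Proof. by rewrite -induced_sym -trmx_mul tang_metric trmx_mul trmxK Gsym. Qed.

Lemma lc_sym i j : row j (lc i) = row i (lc j).
Proof. by rewrite !lcE !row_mul torsion. Qed.

Lemma lc_metric i : map_mx (d i) g = lc i *m g + g *m (lc i)^T.
Proof.
rewrite {1}/g (cov_metric dG) lcE -[_ *m tang *m g]mulmxA tang_metric trmx_mul.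
by rewrite [g *m (_ *m _)]mulmxA tang_metric_tr !mulmxA.
Qed.

Lemma sff_normal i : sff i *m G *m J^T = 0.
Proof.
rewrite !sffE -mulmxA mulmxBl -mulmxA [J *m (G *m _)]mulmxA.
by rewrite !lcE -[X in _ - X]mulmxA tang_metric mulmxA subrr.
Qed.

Lemma sff_sym i j : row j (sff i) = row i (sff j).
Proof. by rewrite !sffE !raddfB /= !row_mul torsion lc_sym. Qed.

Lemma jac_cov i : cov om i J = lc i *m J + sff i.
Proof. by rewrite !sffE addrC subrK. Qed.

Lemma sff_tang i : sff i *m tang = 0.
Proof. by rewrite tangE !mulmxA sff_normal mul0mx. Qed.

(** Weingarten: differentiate <W,J> = 0. The tangential part of [cov om i J] pairs to zero with [W],
    so only the second fundamental form remains. *)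
Lemma normal_cov p (W : 'M[C]_(p, k)) i : W *m G *m J^T = 0 ->
  cov om i W *m G *m J^T = - (W *m G *m (sff i)^T).
Proof.
move=> W0; have := congr1 (map_mx (d i)) W0.
rewrite (cov_metric dG) map_mx0 jac_cov tr_addmx trmx_mul mulmxDr.
rewrite [W *m G *m (_ *m _)]mulmxA W0 mul0mx add0r => /eqP.
by rewrite addr_eq0 => /eqP.
Qed.

Lemma shape_lower W i : W *m G *m J^T = 0 ->
  row i (shape W *m g) = W *m G *m (sff i)^T.
Proof.
move=> W0; rewrite row_mul row_shape mulNmx -[_ *m tang *m g]mulmxA tang_metric mulmxA.
by rewrite normal_cov // opprK.
Qed.

Lemma shape_sym W : W *m G *m J^T = 0 -> (shape W *m g)^T = shape W *m g.
Proof.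
move=> W0; apply/matrixP => i j.
transitivity (row j (shape W *m g) 0 i); first by rewrite !mxE.
transitivity (row i (shape W *m g) 0 j); last by rewrite !mxE.
rewrite !shape_lower // !mxE; apply: eq_bigr => l _; congr (_ * _).
by have /rowP/(_ l) := sff_sym i j; rewrite !mxE.
Qed.

Lemma gauss i l : curv lc i l =
  J *m curv om i l *m tang
  + (sff l *m G *m (sff i)^T *m gi - sff i *m G *m (sff l)^T *m gi).
Proof.
(* Differentiating [lc q *m J] gives the intrinsic terms; the tangential part of the derivative of
   the normal [sff q] is given by [normal_cov]. Antisymmetrizing in p and q yields both
   curvatures. *)
have H p q : cov om p (cov om q J) *m tang
    = map_mx (d p) (lc q) + lc q *m lc p - sff q *m G *m (sff p)^T *m gi.
  rewrite jac_cov covD covM !mulmxDl -[_ *m J *m tang]mulmxA tangK mulmx1.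
  rewrite -[_ *m cov om p J *m tang]mulmxA; congr (_ + _ + _).
    by rewrite !lcE.
  by rewrite tangE !mulmxA normal_cov ?sff_normal // !mulNmx.
rewrite -(cov_cov om) mulmxBl !H !curvE.
by apply/matrixP => a b; rewrite !(addmxE, oppmxE); ring.
Qed.

Section parallel_normal_field.
Variable V : 'rV[C]_k.
Hypothesis V_normal : V *m G *m J^T = 0.
Hypothesis V_parallel : forall i, cov om i V = cov om i V *m tang *m J.
Let A := shape V.

Lemma parallel_cov i : cov om i V = - (row i A *m J).
Proof. by rewrite V_parallel /A row_shape mulNmx opprK. Qed.

(** Codazzi and Ricci at once: the derivative of [V] is tangent, and the commutator of its second
    derivatives splits into a tangential and a normal summand. *)
Lemma parallel_curv i l : V *m curv om i l =
  (row i (nab lc l A) - row l (nab lc i A)) *m J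
  + (row i A *m sff l - row l A *m sff i).
Proof.
rewrite -(cov_cov om) !parallel_cov !covN !covM !jac_cov !nabE !raddfD /= !raddfN /=.
rewrite !row_mul (lc_sym l i) -!map_row.
move: (row i A) (row l A) (row l (lc i)) => ai al b.
rewrite !(mulmxDl, mulmxDr, mulNmx) !mulmxA.
by apply/matrixP => x y; rewrite !(addmxE, oppmxE); ring.
Qed.

Lemma codazzi i l :
  row i (nab lc l A) - row l (nab lc i A) = V *m curv om i l *m tang.
Proof.
rewrite parallel_curv; set B := row i (nab _ _ _) - _.
rewrite mulmxDl -mulmxA tangK mulmx1 mulmxBl -!mulmxA !sff_tang !mulmx0 subrr.
by rewrite addr0.
Qed.

(** When the curvature applied to [V] is tangent, the normal summand of [parallel_curv] must
    vanish. *)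
Lemma ricci i l : V *m curv om i l = V *m curv om i l *m tang *m J ->
  row i A *m sff l = row l A *m sff i.
Proof.
rewrite -codazzi {1}parallel_curv -[RHS]addr0 => /addrI/eqP.
by rewrite subr_eq0 => /eqP.
Qed.

End parallel_normal_field.

Section parallel_ambient_field.
Variable xi : 'rV[C]_k.
Hypothesis xi_parallel : forall i, cov om i xi = 0.
Let T := xi *m tang.
Let N := xi - T *m J.
Let t := xi *m G *m J^T.

Lemma tang_lower : T *m g = t.
Proof. by rewrite /T -mulmxA tang_metric mulmxA. Qed.

Lemma nor_normal : N *m G *m J^T = 0.
Proof.
have e : T *m J *m G *m J^T = T *m g by rewrite !mulmxA.
by rewrite /N !mulmxBl e tang_lower subrr.
Qed.

Lemma nor_sff i : N *m G *m (sff i)^T = xi *m G *m (sff i)^T.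
Proof.
have /(congr1 trmx) := sff_normal i; rewrite !trmx_mul trmxK Gsym trmx0 => e.
have f : T *m J *m G *m (sff i)^T = T *m (J *m (G *m (sff i)^T)).
  by rewrite !mulmxA.
by rewrite /N !mulmxBl f e mulmx0 subr0.
Qed.

(** In invariant terms nabla T = A_N: as xi is parallel, only [J] is differentiated in <xi,J>; its
    tangential part is absorbed by [lc], and [sff] sees only the normal part of xi. *)
Lemma cov_tang_lower i :
  map_mx (d i) t - t *m (lc i)^T = row i (shape N *m g).
Proof.
rewrite shape_lower ?nor_normal // nor_sff /t (cov_metric dG) xi_parallel !mul0mx.
by rewrite add0r jac_cov tr_addmx trmx_mul mulmxDr !mulmxA addrAC subrr add0r.
Qed.

(** As xi is parallel and [V] moves only tangentially, by -A, the function <V,xi> has differential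
    -<AT,.>. *)
Lemma d_height V i : V *m G *m J^T = 0 ->
  (forall i, cov om i V = cov om i V *m tang *m J) ->
  map_mx (d i) (V *m G *m xi^T) = - (row i (shape V) *m t^T).
Proof.
move=> V0 Vp; rewrite (cov_metric dG) xi_parallel trmx0 mulmx0 addr0.
by rewrite (parallel_cov Vp) !mulNmx /t !trmx_mul trmxK Gsym !mulmxA.
Qed.

End parallel_ambient_field.
End immersion.

End connection.

(** * Simons' identity over a differential ring *)

Section rough_laplacian.
Context {C : comPzRingType} {m : nat}.
Variable d : 'I_m -> {additive C -> C}.
Hypothesis dM : forall i a b, d i (a * b) = d i a * b + a * d i b.
Hypothesis dC : forall i j a, d i (d j a) = d j (d i a).
Variables (th : 'I_m -> 'M[C]_m) (g gi : 'M[C]_m).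
Hypothesis th_sym : forall i j, row j (th i) = row i (th j).
Hypothesis dg : forall i, map_mx (d i) g = th i *m g + g *m (th i)^T.
Hypothesis g_sym : g^T = g.
Hypothesis giK : gi *m g = 1%:M.
Hypothesis gKi : g *m gi = 1%:M.

Lemma sum_mul_delta (F : 'I_m -> C) p : \sum_q F q * (q == p)%:R = F p.
Proof.
rewrite (bigD1 p) //= eqxx mulr1 big1 ?addr0 // => q /negbTE ->.
by rewrite mulr0.
Qed.

(** The second covariant derivative of [A]. Subtracting the derivative along nabla_i d_j makes it
    tensorial in both directions, so that it may be contracted with [gi]. *)
Definition hess (A : 'M[C]_m) i j : 'M[C]_m :=
  locked (nab d th i (nab d th j A) - \sum_l th i j l *: nab d th l A).

Lemma hess_nab A i j : hess A i j =
  nab d th i (nab d th j A) - \sum_l th i j l *: nab d th l A.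
Proof. exact: esym (lock _). Qed.

Lemma hessE A i j l p : hess A i j l p =
  d i (nab d th j A l p) + \sum_q nab d th j A l q * th i q p
  - \sum_q th i l q * nab d th j A q p - \sum_q th i j q * nab d th q A l p.
Proof.
rewrite !hess_nab addmxE oppmxE nabE !addmxE oppmxE !mxE summxE; congr (_ - _).
by apply: eq_bigr => q _; rewrite mxE.
Qed.

(** The correction terms of [hess] cancel because [th] is torsion-free; the curvature acting on
    endomorphisms remains. *)
Lemma hess_commute A i j :
  hess A i j - hess A j i = A *m curv d th i j - curv d th i j *m A.
Proof.
rewrite !hess_nab -(nab_nab dM dC) opprB.
under [X in _ - X + _]eq_bigr => l _.
  have /rowP/(_ l) := th_sym i j; rewrite !mxE => ->; over.
by apply/matrixP => x y; rewrite !(addmxE, oppmxE); ring.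
Qed.

Variable A : 'M[C]_m.
Hypothesis A_sym : A *m g = g *m A^T.
Hypothesis A_trace : forall i, d i (\tr A) = 0.

Lemma hess_sym i j : hess A i j *m g = g *m (hess A i j)^T.
Proof.
have nS := nab_selfadj dM dg.
rewrite !hess_nab mulmxBl (nS _ _ (nS _ _ A_sym)) tr_addmx tr_oppmx mulmxBr.
congr (_ - _); rewrite mulmx_suml linear_sum mulmx_sumr.
apply: eq_bigr => l _; rewrite -scalemxAl (nS _ _ A_sym).
by rewrite !linearZ /=.
Qed.

Lemma hess_trace i j : \tr (hess A i j) = 0.
Proof.
have e : \tr (\sum_l th i j l *: nab d th l A) = 0.
  rewrite raddf_sum big1 // => l _.
  by rewrite /= mxtraceZ -d_trace_nab A_trace mulr0.
by rewrite !hess_nab raddfB /= e -!d_trace_nab A_trace raddf0 subrr.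
Qed.

Variables (w : C) (t : 'rV[C]_m).
Hypothesis A_codazzi : forall j l p, nab d th j A l p - nab d th l A j p =
  w * (t 0 l * (j == p)%:R - t 0 j * (l == p)%:R).

Let dw : 'rV[C]_m := \row_i d i w.
Let s : 'M[C]_m := \matrix_i (map_mx (d i) t - t *m (th i)^T).

(** The covariant derivative of [A_codazzi]: [dw] and [s] are the derivatives of [w] and [t], and
    the identity endomorphism is parallel. *)
Lemma hess_codazzi i j l p : hess A i j l p - hess A i l j p =
  dw 0 i * (t 0 l * (j == p)%:R - t 0 j * (l == p)%:R)
  + w * (s i l * (j == p)%:R - s i j * (l == p)%:R).
Proof.
have dd a b : d i (a * (b == p :> 'I_m)%:R) = d i a * (b == p)%:R.
  by case: (_ == _); rewrite ?mulr1 ?mulr0 ?raddf0.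
have sE a : s i a = d i (t 0 a) - \sum_q th i a q * t 0 q.
  by rewrite !mxE; congr (_ - _); apply: eq_bigr => q _; rewrite mxE mulrC.
have H1 : \sum_q nab d th j A l q * th i q p - \sum_q nab d th l A j q * th i q p
    = w * (t 0 l * th i j p - t 0 j * th i l p).
  rewrite -sumrB.
  transitivity (\sum_q (w * t 0 l * th i q p * (q == j)%:R)
                - \sum_q (w * t 0 j * th i q p * (q == l)%:R)).
    rewrite -sumrB; apply: eq_bigr => q _; rewrite -mulrBl A_codazzi.
    by rewrite (eq_sym j) (eq_sym l); ring.
  by rewrite !sum_mul_delta; ring.
(* The connection terms of the two lower slots are paired crosswise, so that each pair is again a
   difference to which [A_codazzi] applies. *)
have H2 a b : \sum_q th i b q * nab d th a A q p - \sum_q th i b q * nab d th q A a p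
    = w * ((\sum_q th i b q * t 0 q) * (a == p)%:R - t 0 a * th i b p).
  rewrite -sumrB.
  transitivity (\sum_q w * (th i b q * t 0 q) * (a == p)%:R
                - \sum_q (w * t 0 a * th i b q) * (q == p)%:R).
    rewrite -sumrB; apply: eq_bigr => q _; rewrite -mulrBr A_codazzi; ring.
  by rewrite sum_mul_delta -mulr_suml -mulr_sumr; ring.
have H0 : d i (nab d th j A l p) - d i (nab d th l A j p) =
   d i w * (t 0 l * (j == p)%:R - t 0 j * (l == p)%:R)
   + w * (d i (t 0 l) * (j == p)%:R - d i (t 0 j) * (l == p)%:R).
  by rewrite -raddfB /= A_codazzi dM raddfB /= !dd.
rewrite !hessE !sE [dw _ _]mxE.
have H2l := H2 j l; have H2j := H2 l j.
move: H0 H1 H2l H2j.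
set a1 := d i (nab _ _ _ _ _ _); set a2 := d i (nab _ _ _ _ _ _).
set b1 := \sum_q _; set b2 := \sum_q _; set c1 := \sum_q _; set c2 := \sum_q _.
set e1 := \sum_q _; set e2 := \sum_q _; set e3 := \sum_q _.
move=> h0 h1 h2 h3.
transitivity ((a1 - a2) + (b1 - b2) - (c1 - c2) + (e2 - e3)); first by ring.
by rewrite h0 h1 h2 h3; ring.
Qed.

Lemma mxtrace2 p q (X : 'M[C]_(p, q)) (Y : 'M[C]_(q, p)) :
  \tr (X *m Y) = \sum_i \sum_j X i j * Y j i.
Proof. by apply: eq_bigr => i _; rewrite mxE. Qed.

Lemma bilinE p q (x : 'rV[C]_p) (X : 'M[C]_(p, q)) (y : 'rV[C]_q) :
  (x *m X *m y^T) 0 0 = \sum_i \sum_j x 0 i * X i j * y 0 j.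
Proof.
rewrite exchange_big mxE; apply: eq_bigr => j _.
by rewrite !mxE mulr_suml; apply: eq_bigr => i _.
Qed.

(** The trace of [A] composed with the endomorphism [F i j], contracted over i and j; for [hess]
    this is <A, Delta A>. *)
Let contr (F : 'I_m -> 'I_m -> 'I_m -> 'I_m -> C) :=
  \sum_i \sum_j \sum_l \sum_p gi i j * A p l * F i j l p.

Let contrD F F' : contr (fun i j l p => F i j l p + F' i j l p)
  = contr F + contr F'.
Proof.
rewrite /contr -big_split; apply: eq_bigr => i _.
rewrite -big_split; apply: eq_bigr => j _.
rewrite -big_split; apply: eq_bigr => l _.
by rewrite -big_split; apply: eq_bigr => p _; rewrite mulrDr.
Qed.

Let eq_contr F F' : (forall i j l p, F i j l p = F' i j l p) ->
  contr F = contr F'.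
Proof.
move=> e; rewrite /contr; apply: eq_bigr => i _; apply: eq_bigr => j _.
by apply: eq_bigr => l _; apply: eq_bigr => p _; rewrite e.
Qed.

(** Here [gi] is contracted with the inner derivative, which gives the derivative of the divergence
    of [A]. Self-adjointness turns the divergence into a trace, and Codazzi compares that trace with
    the derivative of tr A, which is zero. *)
Let contr_divergence : contr (fun i j l p => hess A l i j p) =
  (m%:R - 1) * ((t *m gi *m A *m dw^T) 0 0 + w * \tr (s *m gi *m A)).
Proof.
have giH l i : gi *m hess A l i = (hess A l i)^T *m gi.
  rewrite -[LHS]mulmx1 -gKi mulmxA -[gi *m _ *m g]mulmxA hess_sym mulmxA giK.
  by rewrite mul1mx.
have E1 : contr (fun i j l p => hess A l i j p) =
    \sum_l \sum_p \sum_q A p l * gi q p * \sum_i hess A l i q i.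
  rewrite /contr; under eq_bigr do rewrite exchange_big.
  rewrite exchange_big; apply: eq_bigr => l _.
  under eq_bigr do rewrite exchange_big.
  rewrite exchange_big; apply: eq_bigr => p _ /=.
  under eq_bigr => i _.
    have /matrixP/(_ i p) := giH l i; rewrite !mxE => e.
    rewrite (eq_bigr (fun j => A p l * (gi i j * hess A l i j p))); last first.
      by move=> j _; ring.
    rewrite -mulr_sumr e mulr_sumr; over.
  rewrite exchange_big; apply: eq_bigr => q _ /=.
  by rewrite mulr_sumr; apply: eq_bigr => i _; rewrite mxE; ring.
(* After Codazzi the trace of [hess A l q] vanishes; of the remaining terms one does not depend on i
   and occurs m times, the other is cut down by a Kronecker symbol to a single copy with the
   opposite sign. *)
have E2 l q : \sum_i hess A l i q i = (m%:R - 1) * (dw 0 l * t 0 q + w * s l q).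
  transitivity (\tr (hess A l q) + \sum_i (hess A l i q i - hess A l q i i)).
    by rewrite sumrB addrC subrK.
  rewrite hess_trace add0r; under eq_bigr do rewrite hess_codazzi.
  rewrite (eq_bigr (fun i => dw 0 l * t 0 q + w * s l q
    - (dw 0 l * t 0 i + w * s l i) * (i == q)%:R)); last first.
    by move=> i _; rewrite eqxx (eq_sym q) [true%:R]/=; ring.
  rewrite sumrB sum_mul_delta sumr_const card_ord.
  by rewrite -[X in X - _]mulr_natl; ring.
rewrite E1 mulrDr.
have -> : (t *m gi *m A *m dw^T) 0 0 = \sum_l \sum_p \sum_q t 0 q * gi q p * A p l * dw 0 l.
  rewrite mxE; apply: eq_bigr => l _; rewrite mxE mulr_suml; apply: eq_bigr => p _.
  by rewrite !mxE !mulr_suml.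
have -> : \tr (s *m gi *m A) = \sum_l \sum_p \sum_q s l q * gi q p * A p l.
  by rewrite mxtrace2; apply: eq_bigr => l _; apply: eq_bigr => p _; rewrite mxE mulr_suml.
rewrite !mulr_sumr -big_split; apply: eq_bigr => l _.
rewrite !mulr_sumr -big_split; apply: eq_bigr => p _.
rewrite !mulr_sumr -big_split; apply: eq_bigr => q _ /=.
by rewrite E2; ring.
Qed.

Lemma rough_laplacian :
  \sum_i \sum_j gi i j * \tr (A *m hess A i j) =
  \sum_i \sum_j \sum_l \sum_p
     gi i j * A p l * (A *m curv d th i l - curv d th i l *m A) j p
  + ((m%:R - 1) * ((t *m gi *m A *m dw^T) 0 0 + w * \tr (s *m gi *m A))
  + ((dw *m gi *m A *m t^T) 0 0 - \tr A * (dw *m gi *m t^T) 0 0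
     + w * (\tr (gi *m A *m s^T) - \tr A * \tr (gi *m s^T)))).
Proof.
rewrite -contr_divergence.
transitivity (contr (fun i j l p => hess A i j l p)).
  rewrite /contr; apply: eq_bigr => i _; apply: eq_bigr => j _.
  rewrite mxtrace2 exchange_big mulr_sumr; apply: eq_bigr => l _.
  by rewrite mulr_sumr; apply: eq_bigr => p _; rewrite mulrA.
(* From nabla_i nabla_j A_l to nabla_l nabla_i A_j: Codazzi exchanges j and l, then the curvature
   pays for exchanging i and l. *)
transitivity (contr (fun i j l p =>
  (A *m curv d th i l - curv d th i l *m A) j p + (hess A l i j p
   + (dw 0 i * (t 0 l * (j == p)%:R - t 0 j * (l == p)%:R)
  + w * (s i l * (j == p)%:R - s i j * (l == p)%:R))))).
  apply: eq_contr => i j l p; rewrite -hess_codazzi -hess_commute addmxE oppmxE.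
  by ring.
rewrite !contrD; congr (_ + (_ + _)).
have E (a b : 'I_m -> 'I_m -> C) :
  contr (fun i j l p => a i l * (j == p)%:R - b i j * (l == p)%:R)
  = \sum_i \sum_j \sum_l gi i j * A j l * a i l - \tr A * \sum_i \sum_j gi i j * b i j.
  rewrite mulr_sumr -sumrB; apply: eq_bigr => i _.
  rewrite mulr_sumr -sumrB; apply: eq_bigr => j _.
  rewrite /mxtrace mulr_suml -sumrB; apply: eq_bigr => l _.
  transitivity (\sum_p (gi i j * A p l * a i l * (p == j)%:R)
                - \sum_p (gi i j * A p l * b i j * (p == l)%:R)).
    by rewrite -sumrB; apply: eq_bigr => p _; rewrite (eq_sym j) (eq_sym l); ring.
  by rewrite !sum_mul_delta; ring.
have -> : contr (fun i j l p => dw 0 i * (t 0 l * (j == p)%:R - t 0 j * (l == p)%:R)) =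
    contr (fun i j l p => dw 0 i * t 0 l * (j == p)%:R - dw 0 i * t 0 j * (l == p)%:R).
  by apply: eq_contr => i j l p; ring.
have -> : contr (fun i j l p => w * (s i l * (j == p)%:R - s i j * (l == p)%:R)) =
    contr (fun i j l p => w * s i l * (j == p)%:R - w * s i j * (l == p)%:R).
  by apply: eq_contr => i j l p; ring.
rewrite (E (fun i l => dw 0 i * t 0 l) (fun i j => dw 0 i * t 0 j)).
rewrite (E (fun i l => w * s i l) (fun i j => w * s i j)).
rewrite -[dw *m gi *m A]mulmxA !bilinE mulrBr.
have -> : \tr (gi *m s^T) = \sum_i \sum_j gi i j * s i j.
  by rewrite mxtrace2; apply: eq_bigr => i _; apply: eq_bigr => j _; rewrite mxE.
have -> : \tr (gi *m A *m s^T) = \sum_i \sum_j \sum_l gi i j * A j l * s i l.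
  rewrite mxtrace2; apply: eq_bigr => i _; rewrite exchange_big; apply: eq_bigr => l _.
  by rewrite mxE mulr_suml; apply: eq_bigr => j _; rewrite [s^T _ _]mxE.
congr (_ - _ + (_ - _)).
- apply: eq_bigr => i _; rewrite exchange_big; apply: eq_bigr => l _.
  by rewrite [(gi *m A) _ _]mxE mulr_sumr mulr_suml; apply: eq_bigr => j _ /=; ring.
- by congr (_ * _); apply: eq_bigr => i _; apply: eq_bigr => j _; ring.
- rewrite mulr_sumr; apply: eq_bigr => i _; rewrite mulr_sumr; apply: eq_bigr => j _.
  by rewrite mulr_sumr; apply: eq_bigr => l _; ring.
- rewrite mulrCA; congr (_ * _); rewrite mulr_sumr; apply: eq_bigr => i _.
  by rewrite mulr_sumr; apply: eq_bigr => j _; ring.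
Qed.

End rough_laplacian.

(** * Contraction of curvature-like tensors with A *)

Section wedge.
Context {C : comPzRingType} {m : nat}.

(** As an endomorphism, Z goes to X(d_l,Z) Y d_i - X(d_i,Z) Y d_l, with X a bilinear form and Y an
    endomorphism. Every summand of the curvature of the submanifold has this shape. *)
Definition wedge (X Y : 'M[C]_m) (i l : 'I_m) : 'M[C]_m :=
  locked ((row l X)^T *m row i Y - (row i X)^T *m row l Y).

Lemma wedgeE X Y i l :
  wedge X Y i l = (row l X)^T *m row i Y - (row i X)^T *m row l Y.
Proof. exact: esym (lock _). Qed.

Variables (gi A : 'M[C]_m).

(** The curvature term in [rough_laplacian], as a linear function of the curvature. *)
Definition contract (K : 'I_m -> 'I_m -> 'M[C]_m) :=
  \sum_i \sum_j \sum_l \sum_p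
    gi i j * A p l * (A *m K i l - K i l *m A) j p.

Lemma contract_lin a K K' :
  contract (fun i l => a *: K i l + K' i l) = a * contract K + contract K'.
Proof.
rewrite mulr_sumr -big_split; apply: eq_bigr => i _.
rewrite mulr_sumr -big_split; apply: eq_bigr => j _.
rewrite mulr_sumr -big_split; apply: eq_bigr => l _.
rewrite mulr_sumr -big_split; apply: eq_bigr => p _ /=.
rewrite mulmxDr mulmxDl -scalemxAr -scalemxAl.
move: (A *m K i l) (A *m K' i l) (K i l *m A) (K' i l *m A) => B1 B2 B3 B4.
by rewrite !mxE; ring.
Qed.

Lemma eq_contract K K' : (forall i l, K i l = K' i l) -> contract K = contract K'.
Proof. by move=> e; do 4!(apply: eq_bigr => ? _); rewrite e. Qed.

Lemma contractB K K' :
  contract (fun i l => K i l - K' i l) = contract K - contract K'.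
Proof.
rewrite addrC -mulN1r -contract_lin; apply: eq_contract => i l.
by rewrite scaleN1r addrC.
Qed.

Lemma contract_sum (I : Type) (r : seq I) (K : I -> 'I_m -> 'I_m -> 'M[C]_m) :
  contract (fun i l => \sum_(a <- r) K a i l) = \sum_(a <- r) contract (K a).
Proof.
elim: r => [|a r IH]; rewrite ?big_cons ?big_nil.
  rewrite (eq_contract (K' := fun _ _ => 0)) => [|i l]; last by rewrite big_nil.
  by do 4!(rewrite /contract; apply: big1 => ? _); rewrite mulmx0 mul0mx subr0 mxE mulr0.
rewrite -IH -[contract (K a)]mul1r -contract_lin; apply: eq_contract => i l.
by rewrite big_cons scale1r.
Qed.

(** The four indices close up into one cycle of matrices; in the next lemma they close up into two
    cycles. *)
Lemma mxtrace_contract4 (U W Y : 'M[C]_m) : \tr (gi *m U *m W^T *m Y^T) =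
  \sum_i \sum_j \sum_l \sum_p gi i j * W p l * (U j l * Y i p).
Proof.
rewrite mxtrace2; apply: eq_bigr => i _.
under eq_bigr => p _ do rewrite mxE mulr_suml.
rewrite exchange_big; under eq_bigr => l _.
  under eq_bigr => p _ do rewrite mxE 2!mulr_suml.
  rewrite exchange_big; over.
rewrite exchange_big; apply: eq_bigr => j _; apply: eq_bigr => l _.
by apply: eq_bigr => p _ /=; rewrite !mxE; ring.
Qed.

Lemma mxtrace_contract22 (U W Y : 'M[C]_m) : \tr (gi *m U) * \tr (W *m Y) =
  \sum_i \sum_j \sum_l \sum_p gi i j * W p l * (U j i * Y l p).
Proof.
rewrite !mxtrace2 mulr_suml; apply: eq_bigr => i _.
rewrite mulr_suml; apply: eq_bigr => j _.
rewrite exchange_big mulr_sumr; apply: eq_bigr => l _.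
by rewrite mulr_sumr; apply: eq_bigr => p _; ring.
Qed.

Lemma contract_wedge X Y : contract (wedge X Y) =
  \tr (gi *m A *m X^T *m A^T *m Y^T) - \tr (gi *m A *m X^T) * \tr (A *m Y)
  - \tr (gi *m X^T *m A^T *m A^T *m Y^T) + \tr (gi *m X^T) * \tr (A *m Y *m A).
Proof.
rewrite -(mulmxA gi A) -[_ *m A^T *m Y^T in X in _ - X + _]mulmxA -trmx_mul.
rewrite -(mulmxA A Y) !mxtrace_contract4 !mxtrace_contract22 -!sumrB -big_split.
apply: eq_bigr => i _; rewrite -!sumrB -big_split.
apply: eq_bigr => j _; rewrite -!sumrB -big_split.
apply: eq_bigr => l _; rewrite -!sumrB -big_split.
apply: eq_bigr => p _ /=.
have H (c : 'cV[C]_m) (r : 'rV[C]_m) : (c *m r) j p = c j 0 * r 0 p.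
  by rewrite mxE big_ord1.
have U q : (A *m (row q X)^T) j 0 = (A *m X^T) j q.
  by rewrite !mxE; apply: eq_bigr => ? _; rewrite !mxE.
have W q : (row q Y *m A) 0 p = (Y *m A) q p by rewrite -row_mul mxE.
have E : (A *m wedge X Y i l - wedge X Y i l *m A) j p =
    (A *m X^T) j l * Y i p - (A *m X^T) j i * Y l p
    - (X^T j l * (Y *m A) i p - X^T j i * (Y *m A) l p).
  rewrite wedgeE mulmxBr mulmxBl !mulmxA -!(mulmxA _ _ A).
  by rewrite !(addmxE, oppmxE) !H !U !W ![row _ _ _ _]mxE ![(row _ _)^T _ _]mxE
    ![row _ _ _ _]mxE ![X^T _ _]mxE.
by rewrite E; ring.
Qed.

End wedge.

(** * Simons' formula for a parallel normal field *)

Section simons.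
Context {C : comPzRingType} {m k r : nat}.
Variable d : 'I_m -> {additive C -> C}.
Hypothesis dM : forall i a b, d i (a * b) = d i a * b + a * d i b.
Hypothesis dC : forall i j a, d i (d j a) = d j (d i a).
Variables (om : 'I_m -> 'M[C]_k) (G : 'M[C]_k) (J : 'M[C]_(m, k)) (gi : 'M[C]_m).
Hypothesis Gsym : G^T = G.
Hypothesis dG : forall i, map_mx (d i) G = om i *m G + G *m (om i)^T.
Hypothesis torsion : forall i j, row j (cov d om i J) = row i (cov d om j J).
Variable g : 'M[C]_m.
Hypothesis gE : J *m G *m J^T = g.
Hypothesis giK : gi *m g = 1%:M.
Hypothesis gKi : g *m gi = 1%:M.
Let giJ : gi *m (J *m G *m J^T) = 1%:M. Proof. by rewrite gE. Qed.
Let gJi : J *m G *m J^T *m gi = 1%:M. Proof. by rewrite gE. Qed.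
Variable xi : 'rV[C]_k.
Hypothesis xi_parallel : forall i, cov d om i xi = 0.
Let P := tang G J gi.
Variables (t T : 'rV[C]_m).
Hypothesis tE : xi *m G *m J^T = t.
Hypothesis TE : xi *m P = T.
Let N := xi - T *m J.
Variable c : C.
Hypothesis dc : forall i, d i c = 0.
Let dotG (W X : 'rV[C]_k) := (W *m G *m X^T) 0 0.
(* R(X,Y)W = c (<Y,W>X - <X,W>Y + <W,xi>(<X,xi>Y - <Y,xi>X)
   + (<Y,xi><X,W> - <X,xi><Y,W>)xi) with X = d_i, Y = d_l *)
Hypothesis ambient_curv : forall (W : 'rV[C]_k) i l, W *m curv d om i l = c *:
  (dotG W (row l J) *: row i J - dotG W (row i J) *: row l J
   + dotG W xi *: (t 0 i *: row l J - t 0 l *: row i J)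
   + (t 0 l * dotG W (row i J) - t 0 i * dotG W (row l J)) *: xi).
Variable V : 'rV[C]_k.
Hypothesis V_normal : V *m G *m J^T = 0.
Hypothesis V_parallel : forall i, cov d om i V = cov d om i V *m P *m J.
Let sh W := shape d om G J gi W.
Let A := sh V.
Hypothesis A_trace : forall i, d i (\tr A) = 0.
Variable E : 'I_r -> 'rV[C]_k.
Hypothesis E_normal : forall a, E a *m G *m J^T = 0.
(** Completeness: the tangential projection and the projections to the [E a] add up to the identity,
    with an index lowered. *)
Hypothesis E_frame : G = P *m J *m G + \sum_a G *m (E a)^T *m E a *m G.
Let B a := sh (E a).
Let th := lc d om G J gi.
Let u := (V *m G *m xi^T) 0 0.

Let g_sym : g^T = g. Proof. by rewrite -gE; exact: induced_sym. Qed.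

Let A_sym : A *m g = g *m A^T.
Proof.
rewrite -[g in RHS]g_sym -trmx_mul.
by rewrite -gE (shape_sym dM dG torsion giJ V_normal).
Qed.

Let B_sym a : B a *m g = g *m (B a)^T.
Proof.
rewrite -[g in RHS]g_sym -trmx_mul.
by rewrite -gE (shape_sym dM dG torsion giJ (E_normal a)).
Qed.

Let dot_row (W : 'rV[C]_k) i : dotG W (row i J) = (W *m G *m J^T) 0 i.
Proof. by rewrite /dotG !mxE; apply: eq_bigr => q _; rewrite !mxE. Qed.

Let dotC W X : dotG W X = dotG X W.
Proof.
transitivity ((W *m G *m X^T)^T 0 0); first by rewrite [RHS]mxE.
by rewrite !trmx_mul trmxK Gsym mulmxA.
Qed.

(** As [V] is orthogonal to the rows of [J], only the middle term of [ambient_curv] survives. It is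
    tangent, which is what [ricci] asks for. *)
Let V_curv i l : V *m curv d om i l = (c * u) *: (t 0 i *: row l J - t 0 l *: row i J).
Proof.
rewrite ambient_curv !dot_row V_normal !mxE !mulr0 subrr !scale0r subrr add0r addr0.
by rewrite scalerA.
Qed.

Let rowJP q : row q J *m P = row q 1%:M.
Proof. by rewrite -row_mul /P (tangK gJi). Qed.

Let A_codazzi j l p : nab d th j A l p - nab d th l A j p =
  (c * u) * (t 0 l * (j == p)%:R - t 0 j * (l == p)%:R).
Proof.
have /rowP/(_ p) := codazzi dM dC torsion giJ gJi V_parallel l j.
rewrite V_curv -scalemxAl mulmxBl -!scalemxAl !rowJP.
by rewrite !(addmxE, oppmxE) ![row _ _ _ _]mxE => ->; rewrite !mxE.
Qed.

Let A_ricci i l : row i A *m sff d om G J gi l = row l A *m sff d om G J gi i.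
Proof.
apply: (ricci dM dC torsion giJ gJi V_parallel).
rewrite V_curv -!scalemxAl mulmxBl -!scalemxAl mulmxBl -!scalemxAl !rowJP.
by rewrite -!row_mul !mul1mx.
Qed.

(** Paired with [E a], [A_ricci] says that <A d_i, B d_l> is symmetric in i and l; for self-adjoint
    A and B this means that they commute. *)
Let AB_commute a : A *m B a = B a *m A.
Proof.
have BE i : sff d om G J gi i *m G *m (E a)^T = (row i (B a *m g))^T.
  by rewrite -gE (shape_lower dM dG giJ _ (E_normal a)) !trmx_mul trmxK Gsym mulmxA.
have BgT : (B a *m g)^T = B a *m g.
  by rewrite -gE; exact: (shape_sym dM dG torsion giJ (E_normal a)).
have ABg : (A *m (B a *m g))^T = A *m (B a *m g).
  have e i l : (A *m (B a *m g)) i l = (row i A *m (row l (B a *m g))^T) 0 0.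
    rewrite mxE [RHS]mxE; apply: eq_bigr => q _.
    rewrite [row i A _ _]mxE [(row _ _)^T _ _]mxE [row l _ _ _]mxE.
    by rewrite -[in LHS]BgT [(B a *m g)^T _ _]mxE.
  by apply/matrixP => i l; rewrite [LHS]mxE !e -!BE !mulmxA A_ricci.
have e : A *m B a *m g = B a *m A *m g.
  rewrite -mulmxA -ABg trmx_mul BgT.
  by rewrite -[RHS]mulmxA A_sym mulmxA.
by rewrite -[LHS]mulmx1 -gKi mulmxA e -mulmxA gKi mulmx1.
Qed.

Let T_lower : T *m g = t. Proof. by rewrite -gE -TE -tE; exact: tang_lower. Qed.

Let t_trE : t^T = g *m T^T.
Proof. by rewrite -T_lower trmx_mul g_sym. Qed.

(** Gauss in [wedge] form: the projection of [ambient_curv] to the submanifold, where xi becomes T,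
    and one wedge for each normal direction. *)
Lemma curv_induced i l : curv d th i l =
  c *: (wedge g 1%:M i l - wedge (t^T *m t) 1%:M i l - wedge g (t^T *m T) i l)
  + \sum_a wedge (B a *m g) (B a) i l.
Proof.
have wE X Y q p : wedge X Y i l q p = X l q * Y i p - X i q * Y l p.
  by rewrite wedgeE !(addmxE, oppmxE) !mxE !big_ord1 !mxE.
rewrite /th (gauss dM dC dG giJ gJi); congr (_ + _).
  have gC q p : g q p = g p q by rewrite -[in LHS]g_sym mxE.
  have rowT q : dotG (row q J) xi = t 0 q.
    by rewrite dotC dot_row tE.
  have rowG q p : dotG (row q J) (row p J) = g q p.
    by rewrite dot_row -!row_mul gE mxE.
  apply/matrixP => q p.
  transitivity ((row q J *m curv d om i l *m P) 0 p).
    by rewrite -!row_mul [RHS]mxE.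
  rewrite ambient_curv -scalemxAl !mulmxDl !mulNmx -!scalemxAl !rowJP TE.
  rewrite !rowG rowT mulmxBl -!scalemxAl !rowJP mxE [RHS]mxE; congr (_ * _).
  have tt X j : (t^T *m X) j p = t 0 j * (X : 'rV_m) 0 p by rewrite !mxE big_ord1 !mxE.
  have tt' j : (t^T *m t) j q = t 0 j * t 0 q by rewrite !mxE big_ord1 !mxE.
  rewrite !(addmxE, oppmxE) !wE !tt !tt' (gC l) (gC i).
  have Z a (X : 'rV[C]_m) : (a *: X) 0 p = a * X 0 p by rewrite mxE.
  by rewrite !Z !(addmxE, oppmxE) !Z ![row _ _ _ _]mxE; ring.
(* [E_frame] is inserted between the two second fundamental forms; its tangential part is killed
   because [sff] is normal. *)
have K i' l' : sff d om G J gi l' *m G *m (sff d om G J gi i')^T *m gi =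
    \sum_a (row l' (B a *m g))^T *m row i' (B a).
  have e0 : sff d om G J gi l' *m (P *m J *m G) = 0.
    by rewrite !mulmxA (sff_tang d om giJ) !mul0mx.
  have := congr1 (mulmx (sff d om G J gi l')) E_frame.
  rewrite mulmxDr e0 add0r => ->.
  rewrite mulmx_sumr mulmx_suml mulmx_suml; apply: eq_bigr => a _.
  rewrite (_ : row i' (B a) = row i' (B a *m g) *m gi); last first.
    by rewrite -row_mul -mulmxA gKi mulmx1.
  rewrite -gE !(shape_lower dM dG giJ _ (E_normal a)) !trmx_mul trmxK Gsym.
  by rewrite !mulmxA.
by rewrite !K -sumrB; apply: eq_bigr => a _; rewrite wedgeE.
Qed.

Let mxtrace_rank1 (x y : 'rV[C]_m) : \tr (x^T *m y) = (y *m x^T) 0 0.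
Proof. by rewrite mxtrace_mulC trace_mx11. Qed.

Let gi_t : gi *m t^T = T^T.
Proof. by rewrite t_trE mulmxA giK mul1mx. Qed.

Let t_AT : t *m A^T = T *m A *m g.
Proof. by rewrite -T_lower -[RHS]mulmxA A_sym mulmxA. Qed.

Let gi_A : gi *m A = A^T *m gi.
Proof.
have -> : gi *m A = gi *m (A *m g) *m gi by rewrite mulmxA -mulmxA gKi mulmx1.
by rewrite A_sym mulmxA giK mul1mx.
Qed.

(** Here q = |AT|^2, p = <AT,T> and tau = |T|^2. *)
Let q := (T *m A *m g *m (T *m A)^T) 0 0.
Let p := (T *m A *m g *m T^T) 0 0.
Let tau := (T *m g *m T^T) 0 0.

Let AAT : (T *m A *m A *m g *m T^T) 0 0 = q.
Proof. by rewrite /q trmx_mul -[T *m A *m A *m g]mulmxA A_sym !mulmxA. Qed.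

(** By [contract_wedge] the three wedges, before their signs, give m|A|^2 - (tr A)^2, |T|^2|A|^2 -
    (tr A)p and mq - (tr A)p. *)
Lemma contract_curv_ambient :
  contract gi A (fun i l =>
    wedge g 1%:M i l - wedge (t^T *m t) 1%:M i l - wedge g (t^T *m T) i l)
  = (m%:R - tau) * \tr (A *m A) - m%:R * q + 2 * (\tr A * p) - \tr A ^+ 2.
Proof.
rewrite !contractB !contract_wedge !(trmx1, mulmx1, mul1mx).
have g_T : g^T = g := g_sym.
have trg : \tr (gi *m g) = m%:R by rewrite giK mxtrace1.
have trAT : \tr (A^T *m A^T) = \tr (A *m A) by rewrite -trmx_mul mxtrace_tr.
have giAg : gi *m A *m g = A^T by rewrite gi_A -mulmxA giK mulmx1.
rewrite !g_T trg giAg giK mul1mx trAT mxtrace_tr !trmx_mul !trmxK.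
have e1 : \tr (gi *m A *m (t^T *m t) *m A^T) = q.
  rewrite gi_A -(mulmxA A^T) [gi *m _]mulmxA gi_t mulmxA -mulmxA t_AT.
  by rewrite -trmx_mul mxtrace_rank1 /q.
have e2 : \tr (gi *m A *m (t^T *m t)) = p.
  rewrite gi_A -(mulmxA A^T) [gi *m _]mulmxA gi_t mulmxA.
  by rewrite -trmx_mul mxtrace_rank1 trmx_mul mulmxA t_AT.
have tAA : t *m A^T *m A^T = T *m A *m A *m g.
  by rewrite t_AT -mulmxA -A_sym mulmxA.
have At : A *m t^T = (T *m A *m g)^T by rewrite -t_AT trmx_mul trmxK.
have e3 : \tr (gi *m (t^T *m t) *m A^T *m A^T) = q.
  by rewrite [gi *m _]mulmxA gi_t -!(mulmxA T^T) tAA mxtrace_rank1.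
have e4 : \tr (gi *m (t^T *m t)) = tau.
  by rewrite mulmxA gi_t mxtrace_rank1 -T_lower.
have e6 : \tr (A *m (t^T *m T)) = p.
  by rewrite mulmxA At -mxtrace_tr trmx_mul trmxK mxtrace_rank1.
have e7 : \tr (A *m (t^T *m T) *m A) = q.
  by rewrite mulmxA At -mulmxA mxtrace_rank1 trmx_mul g_sym mulmxA.
by rewrite e1 e2 e3 e4 e6 e7; ring.
Qed.

(** The first and third terms of [contract_wedge] are traces of the product of two factors A and two
    factors B in different orders; they cancel because A and B commute. *)
Lemma contract_curv_frame a : contract gi A (wedge (B a *m g) (B a))
  = \tr (B a) * \tr (A *m A *m B a) - \tr (A *m B a) ^+ 2.
Proof.
have conj X : \tr (gi *m X *m g) = \tr X.
  by rewrite -mulmxA mxtrace_mulC -mulmxA gKi mulmx1.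
have BgT : (B a *m g)^T = B a *m g by rewrite trmx_mul g_sym B_sym.
have t1 : gi *m A *m (B a *m g) *m A^T *m (B a)^T
    = gi *m (A *m B a *m A *m B a) *m g.
  rewrite !mulmxA -(mulmxA _ g A^T) -A_sym mulmxA -(mulmxA _ g (B a)^T) -B_sym.
  by rewrite !mulmxA.
have t2 : gi *m A *m (B a *m g) = gi *m (A *m B a) *m g by rewrite !mulmxA.
have t3 : gi *m (B a *m g) *m A^T *m A^T *m (B a)^T
    = gi *m (B a *m A *m A *m B a) *m g.
  rewrite !mulmxA -(mulmxA _ g A^T) -A_sym mulmxA -(mulmxA _ g A^T) -A_sym mulmxA.
  by rewrite -(mulmxA _ g (B a)^T) -B_sym !mulmxA.
rewrite contract_wedge BgT t1 t2 t3 [gi *m (B a *m g)]mulmxA !conj.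
have -> : A *m B a *m A *m B a = A *m A *m B a *m B a.
  by rewrite -[A *m B a *m A]mulmxA -AB_commute mulmxA.
have -> : \tr (B a *m A *m A *m B a) = \tr (A *m A *m B a *m B a).
  by rewrite mxtrace_mulC !mulmxA mxtrace_mulC !mulmxA mxtrace_mulC !mulmxA.
have -> : A *m B a *m A = A *m A *m B a by rewrite -mulmxA -AB_commute mulmxA.
by ring.
Qed.

(** Twice the formula, with tr A_N standing for m<H,N> and u = <V,xi> for <V,N>. *)
Theorem simons :
  \sum_i \sum_j gi i j * (d i (d j (\tr (A *m A)))
     - \sum_l th i j l * d l (\tr (A *m A)))
  = 2 * (\sum_i \sum_j gi i j * \tr (nab d th i A *m nab d th j A)
    + c * ((m%:R - tau) * \tr (A *m A) - 2 * m%:R * q + 3 * \tr A * p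
           + m%:R * \tr (sh N *m A) * u - \tr A ^+ 2 - \tr A * \tr (sh N) * u)
    + \sum_a (\tr (B a) * \tr (A *m A *m B a) - \tr (A *m B a) ^+ 2)).
Proof.
have dA j : d j (\tr (A *m A)) = 2 * \tr (A *m nab d th j A).
  rewrite (d_trace_nab d th) (nab_mul dM) mxtraceD [\tr (nab _ _ _ _ *m _)]mxtrace_mulC.
  by ring.
(* The product rule twice; the connection term in the Hessian of a function becomes the correction
   term of [hess]. *)
have L i j : d i (d j (\tr (A *m A))) - \sum_l th i j l * d l (\tr (A *m A))
    = 2 * (\tr (nab d th i A *m nab d th j A) + \tr (A *m hess d th A i j)).
  have d2 x : d i (2 * x) = 2 * d i x.
    by rewrite !mulr_natl raddfMn.
  rewrite dA d2 (d_trace_nab d th) (nab_mul dM) mxtraceD hess_nab mulmxBr raddfB /=.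
  have -> : \sum_l th i j l * d l (\tr (A *m A))
      = 2 * \tr (A *m \sum_l th i j l *: nab d th l A).
    rewrite mulmx_sumr raddf_sum mulr_sumr; apply: eq_bigr => l _ /=.
    by rewrite dA -scalemxAr mxtraceZ; ring.
  by ring.
under eq_bigr => i _ do under eq_bigr => j _ do rewrite L mulrCA mulrDr.
under eq_bigr => i _ do rewrite -mulr_sumr big_split.
rewrite -mulr_sumr big_split /=; congr (2 * _); rewrite -addrA; congr (_ + _).
have dg i : map_mx (d i) g = th i *m g + g *m (th i)^T.
  by rewrite -gE (lc_metric dM Gsym dG giJ).
rewrite (rough_laplacian dM dC (lc_sym G gi torsion) dg giK gKi A_sym A_trace A_codazzi).
have N_normal : N *m G *m J^T = 0 by rewrite /N -TE; exact: nor_normal.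
have shN_sym : sh N *m g = g *m (sh N)^T.
  rewrite -[g in RHS]g_sym -trmx_mul.
  by rewrite -gE (shape_sym dM dG torsion giJ N_normal).
have -> : \matrix_i (map_mx (d i) t - t *m (lc d om G J gi i)^T) = sh N *m g.
  apply/row_matrixP => i; rewrite rowK /sh /N -TE -tE -gE.
  exact: (cov_tang_lower dM Gsym dG giJ xi_parallel).
(* Since [c] is constant, this is c times the differential of <V,xi>, supplied by [d_height]. *)
have -> : \row_i d i (c * u) = - c *: (t *m A^T).
  apply/rowP => i; rewrite [LHS]mxE dM dc mul0r add0r.
  have /matrixP/(_ 0 0) := d_height dM Gsym dG xi_parallel i V_normal V_parallel.
  rewrite [LHS]mxE -/u => ->; rewrite tE.
  rewrite oppmxE mxE [RHS]mxE mulNr mulrN [in RHS]mxE; congr (- (_ * _)).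
  by apply: eq_bigr => l _; rewrite !mxE mulrC.
rewrite -[X in X + _ = _]/(contract gi A (curv d th)).
rewrite (eq_contract gi A curv_induced) contract_lin contract_curv_ambient contract_sum.
under [X in _ + X + _]eq_bigr do rewrite contract_curv_frame.
have tgi : t *m gi = T by rewrite -T_lower -mulmxA gKi mulmx1.
have conj X : \tr (gi *m X *m g) = \tr X.
  by rewrite -mulmxA mxtrace_mulC -mulmxA gKi mulmx1.
have e1 : (t *m gi *m A *m (- c *: (t *m A^T))^T) 0 0 = - c * q.
  rewrite tgi linearZ /= -scalemxAr mxE trmx_mul trmxK mulmxA t_trE !mulmxA.
  by rewrite AAT.
have e2 : (- c *: (t *m A^T) *m gi *m A *m t^T) 0 0 = - c * q.
  rewrite t_AT -!scalemxAl mxE; congr (_ * _); rewrite -(mulmxA _ g gi) gKi mulmx1.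
  by rewrite t_trE !mulmxA AAT.
have e3 : (- c *: (t *m A^T) *m gi *m t^T) 0 0 = - c * p.
  by rewrite -!scalemxAl mxE -mulmxA gi_t t_AT.
have e4 : \tr (sh N *m g *m gi *m A) = \tr (sh N *m A).
  by rewrite -(mulmxA (sh N)) gKi mulmx1.
have e5 : \tr (gi *m A *m (sh N *m g)^T) = \tr (sh N *m A).
  rewrite trmx_mul g_sym -shN_sym mulmxA -(mulmxA gi) conj.
  by rewrite mxtrace_mulC.
have e6 : \tr (gi *m (sh N *m g)^T) = \tr (sh N).
  by rewrite trmx_mul g_sym -shN_sym mulmxA conj.
(* The terms -c q and c u tr(A_N A) occur m - 1 times through the divergence and once through
   Codazzi; with -m q from the curvature, q gets -2m. Codazzi also adds one (tr A) p to the two from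
   the curvature. *)
rewrite e1 e2 e3 e4 e5 e6; ring.
Qed.

End simons.

Local Open Scope classical_set_scope.
Local Open Scope ring_scope.

(** * Differential rings of smooth functions *)

Section differentiability.
Context {R : realType}.

Lemma near_eq_differentiable (V W : normedModType R) (f g : V -> W) (x : V) :
  (\near x, f x = g x) -> differentiable f x -> differentiable g x.
Proof.
move=> fg df.
have fgx : f x = g x by exact: nbhs_singleton fg.
have near0 : \forall y \near (0 : V), f (y + x) = g (y + x).
  by move: fg; rewrite (near_shift 0) subr0.
have E : g \o shift x = cst (g x) + 'd f x +o_ 0 id.
  apply/eqaddoP => e e0.
  have /eqaddoP/(_ e e0) H := diff_locally df.
  apply: filterS2 H near0 => y; rewrite !fctE /= => H fgy.
  by rewrite -fgx -fgy.
apply/diff_locallyP; rewrite (diff_unique _ E); last exact: diff_continuous.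
by split=> //; exact: diff_continuous.
Qed.

Lemma is_derive_line (V : normedModType R) (f : V -> R) (a v : V) (t : R) :
  derivable f (t *: v + a) v ->
  is_derive t 1 (fun s => f (s *: v + a)) ('D_v f (t *: v + a)).
Proof.
have E : (fun h : R => h^-1 *: (f ((h *: 1 + t) *: v + a) - f (t *: v + a)))
   = (fun h => h^-1 *: (f (h *: v + (t *: v + a)) - f (t *: v + a))).
  by apply/funext => h; rewrite scalerDl addrA [h *: 1]mulr1.
move=> df; split; first by rewrite /derivable /= E.
by rewrite /derive /= E.
Qed.

Lemma differentiable_rowP m n (F : 'rV[R]_m -> 'rV[R]_n) x :
  (forall b, differentiable (fun y => F y 0 b) x) -> differentiable F x.
Proof.
move=> dF; rewrite (_ : F = \sum_(b < n) (fun y => F y 0 b *: delta_mx 0 b)).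
  by apply: differentiable_sum => b; apply: differentiableZl.
by apply/funext => y; rewrite fct_sumE -row_sum_delta.
Qed.

Lemma pderE n (u : 'rV[R]_n -> R) i x : differentiable u x ->
  pder i u x = 'd u x (delta_mx 0 i).
Proof. exact: deriveE. Qed.

Lemma diff_pder n (u : 'rV[R]_n -> R) x v : differentiable u x ->
  'd u x v = \sum_i v 0 i * pder i u x.
Proof.
move=> du; rewrite {1}[v]row_sum_delta linear_sum; apply: eq_bigr => i _.
by rewrite linearZ pderE.
Qed.

Lemma pder_comp m n (u : 'rV[R]_n -> R) (F : 'rV[R]_m -> 'rV[R]_n) i x :
  (forall b, differentiable (fun y => F y 0 b) x) -> differentiable u (F x) ->
  pder i (u \o F) x = \sum_b pder i (fun y => F y 0 b) x * pder b u (F x).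
Proof.
move=> dF du; have dFx := differentiable_rowP dF.
rewrite pderE; last exact: differentiable_comp.
rewrite diff_comp //= diff_pder //; apply: eq_bigr => b _; congr (_ * _).
rewrite pderE // (_ : (fun y => F y 0 b) = (fun z : 'rV_n => z 0 b) \o F) //.
have dc : differentiable (fun z : 'rV[R]_n => z 0 b) (F x) by exact: differentiable_coord.
rewrite (diff_comp dFx dc) /= diff_pder // (bigD1 b) //= big1.
  by rewrite addr0 pder_coord eqxx mulr1.
by move=> j jb; rewrite pder_coord (negbTE jb) mulr0.
Qed.

Lemma near_open n (D : set 'rV[R]_n) (u v : 'rV[R]_n -> R) x : open D -> D x ->
  (forall y, D y -> u y = v y) -> \near x, u x = v x.
Proof.
by move=> oD Dx e; apply: filterS (open_nbhs_nbhs (conj oD Dx)) => y; exact: e.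
Qed.

Lemma eq_pder n (D : set 'rV[R]_n) (u v : 'rV[R]_n -> R) i x : open D -> D x ->
  (forall y, D y -> u y = v y) -> pder i u x = pder i v x.
Proof. by move=> oD Dx e; apply: near_eq_derive; exact: (near_open oD Dx). Qed.

Lemma pderD n (u v : 'rV[R]_n -> R) i x : differentiable u x -> differentiable v x ->
  pder i (fun y => u y + v y) x = pder i u x + pder i v x.
Proof. by move=> du dv; apply: deriveD; exact: diff_derivable. Qed.

Lemma pderM n (u v : 'rV[R]_n -> R) i x : differentiable u x -> differentiable v x ->
  pder i (fun y => u y * v y) x = pder i u x * v x + u x * pder i v x.
Proof.
move=> du dv; rewrite /pder [LHS]deriveM; try exact: diff_derivable.
by rewrite /GRing.scale /=; ring.
Qed.

Lemma pderV n (u : 'rV[R]_n -> R) i x : differentiable u x -> u x != 0 ->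
  pder i (fun y => (u y)^-1) x = - (pder i u x * (u x)^-1 * (u x)^-1).
Proof.
move=> du u0; rewrite /pder [LHS]deriveV //; last exact: diff_derivable.
by rewrite /GRing.scale /= expr2 invfM; ring.
Qed.

Lemma mvt_line n (u : 'rV[R]_n -> R) (a v : 'rV[R]_n) (h : R) : 0 < h ->
  (forall s, 0 <= s <= h -> derivable u (s *: v + a) v) ->
  exists2 s, 0 < s < h & u (h *: v + a) - u a = 'D_v u (s *: v + a) * h.
Proof.
move=> h0 du; pose f s := u (s *: v + a).
have df s : 0 <= s <= h -> is_derive s 1 f ('D_v u (s *: v + a)).
  by move=> /du; exact: is_derive_line.
have [||s] := @MVT R f (fun s => 'D_v u (s *: v + a)) 0 h h0.
- by move=> s; rewrite in_itv /= => /andP[s0 sh]; apply: df; rewrite !ltW.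
- apply: derivable_within_continuous => s; rewrite in_itv /= => sh.
  by have [] := df _ sh.
rewrite in_itv /= => sh; rewrite /f scale0r add0r subr0 => e.
by exists s.
Qed.

(** The mean value theorem twice: for y -> u(y + h e_j) - u(y) along e_i, then for the i-th
    derivative of u along e_j. *)
Lemma mixed_difference n (D : set 'rV[R]_n) (u : 'rV[R]_n -> R) i j x (h : R) : 0 < h ->
  (forall y, D y -> differentiable u y) ->
  (forall y, D y -> differentiable (pder i u) y) ->
  (forall s t, 0 <= s <= h -> 0 <= t <= h ->
     D (s *: delta_mx 0 i + (t *: delta_mx 0 j + x))) ->
  exists s t, [/\ 0 <= s <= h, 0 <= t <= h &
    (u (h *: delta_mx 0 i + (h *: delta_mx 0 j + x)) - u (h *: delta_mx 0 j + x))
    - (u (h *: delta_mx 0 i + x) - u x)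
    = pder j (pder i u) (s *: delta_mx 0 i + (t *: delta_mx 0 j + x)) * h * h].
Proof.
move=> h0 du ddu Dst; set ei := delta_mx 0 i : 'rV[R]_n; set ej := delta_mx 0 j : 'rV[R]_n.
have h00 : 0 <= h <= h by rewrite lexx ltW.
have z00 : 0 <= (0 : R) <= h by rewrite lexx ltW.
have ij0 s : 0 <= s <= h -> D (s *: ei + x).
  by move=> sh; have := Dst s 0 sh z00; rewrite scale0r add0r.
pose w y := u (h *: ej + y) - u y.
have dw s : 0 <= s <= h -> is_derive (s *: ei + x) ei w
    (pder i u (h *: ej + (s *: ei + x)) - pder i u (s *: ei + x)).
  move=> sh; apply: is_deriveB.
    have E : (fun k : R => k^-1 *: (u (h *: ej + (k *: ei + (s *: ei + x))) - u (h *: ej + (s *: ei + x))))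
       = (fun k : R => k^-1 *: (u (k *: ei + (h *: ej + (s *: ei + x))) - u (h *: ej + (s *: ei + x)))).
      by apply/funext => k; rewrite addrCA.
    have : derivable u (h *: ej + (s *: ei + x)) ei.
      by apply: diff_derivable; apply: du; rewrite addrCA; exact: Dst.
    by rewrite /derivable -E => d; split=> //; rewrite /pder /derive E.
  by apply: derivableP; apply: diff_derivable; apply: du; exact: ij0.
have [|s sh e] := @mvt_line _ w x ei h h0; first by move=> s /dw[].
have sh' : 0 <= s <= h by case/andP: sh => s0 sh; rewrite !ltW.
have [|t th e'] := @mvt_line _ (pder i u) (s *: ei + x) ej h h0.
  by move=> t th; apply: diff_derivable; apply: ddu; rewrite addrCA; exact: Dst.
exists s, t; split=> //; first by case/andP: th => ? ?; rewrite !ltW.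
move: e; rewrite (@derive_val _ _ _ _ _ _ _ (dw s sh')) e' /w => e2.
by rewrite [s *: _ + (t *: _ + x)]addrCA {1}/pder -e2 [h *: ei + (_ + x)]addrCA; ring.
Qed.

Lemma dist_le_half2 (p q X e : R) :
  `|p - X| < e / 2 -> `|q - X| < e / 2 -> `|q - p| <= e.
Proof.
by rewrite !ltr_distl ler_distl => /andP[? ?] /andP[? ?]; apply/andP; split; lra.
Qed.

(** The second difference is symmetric in i and j, so the two mixed derivatives take a common value
    at points of any small square; continuity at x then identifies them. *)
Lemma pderC n (D : set 'rV[R]_n) (u : 'rV[R]_n -> R) i j x : open D -> D x ->
  Ck 2 D u -> pder i (pder j u) x = pder j (pder i u) x.
Proof.
move=> oD Dx [du /= ddu].
have ci : {for x, continuous (pder j (pder i u))} by apply: (ddu i).2.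
have cj : {for x, continuous (pder i (pder j u))} by apply: (ddu j).2.
apply/eqP; rewrite -subr_eq0 -normr_le0; apply/ler_addgt0Pl => e e0; rewrite addr0.
have e20 : 0 < e / 2 by rewrite divr_gt0.
have nD : \forall y \near x, [/\ D y,
    `|pder j (pder i u) x - pder j (pder i u) y| < e / 2 &
    `|pder i (pder j u) x - pder i (pder j u) y| < e / 2].
  have ni : \forall y \near x, `|pder j (pder i u) x - pder j (pder i u) y| < e / 2.
    by move/cvgrPdist_lt : ci => /(_ _ e20).
  have nj : \forall y \near x, `|pder i (pder j u) x - pder i (pder j u) y| < e / 2.
    by move/cvgrPdist_lt : cj => /(_ _ e20).
  by apply: filterS3 ni nj (open_nbhs_nbhs (conj oD Dx)) => y ? ?; split.
have /nbhs_ballP[r /= r0 rD] := nD.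
(* The square of side h stays within 2h < r of x, as basis vectors have norm at most 1. *)
pose h := r / 4.
have h0 : 0 < h by rewrite divr_gt0.
have B p q s t : 0 <= s <= h -> 0 <= t <= h ->
    ball x r (s *: delta_mx 0 p + (t *: delta_mx 0 q + x)).
  move=> /andP[s0 sh] /andP[t0 th].
  rewrite -ball_normE /= addrA opprD addrCA subrr addr0 normrN.
  have N1 (l : 'I_n) : `|delta_mx 0 l : 'rV[R]_n| <= 1.
    rewrite [leLHS]/Num.Def.normr /= mx_normrE bigmax_le // => -[k k'] _ /=.
    by rewrite mxE; case: (_ && _); rewrite ?normr1 ?normr0.
  have hr : h + h < r by rewrite /h; lra.
  apply: le_lt_trans hr; apply: le_trans (ler_normD _ _) _.
  rewrite !normrZ !ger0_norm //; apply: lerD.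
    by apply: le_trans sh; rewrite ler_piMr.
  by apply: le_trans th; rewrite ler_piMr.
have hD p q s t : 0 <= s <= h -> 0 <= t <= h ->
    D (s *: delta_mx 0 p + (t *: delta_mx 0 q + x)).
  by move=> sh th; have [] := rD _ (B p q s t sh th).
have [s [t [sh th e1]]] := mixed_difference h0 du (ddu i).1 (hD i j).
have [s' [t' [sh' th' e2]]] := mixed_difference h0 du (ddu j).1 (hD j i).
have {e1 e2} e12 : pder j (pder i u) (s *: delta_mx 0 i + (t *: delta_mx 0 j + x)) =
   pder i (pder j u) (s' *: delta_mx 0 j + (t' *: delta_mx 0 i + x)).
  apply: (mulIf (lt0r_neq0 h0)); apply: (mulIf (lt0r_neq0 h0)).
  apply: (etrans (esym e1)); apply: (etrans _ e2).
  by rewrite [h *: delta_mx 0 j + (_ + x)]addrCA; ring.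
have [_ r1 _] := rD _ (B i j s t sh th); have [_ _ r2] := rD _ (B j i s' t' sh' th').
by rewrite e12 in r1; exact: dist_le_half2 r1 r2.
Qed.

End differentiability.

(** * Closure properties of C^k functions *)

Section smooth_closure.
Context {R : realType} {n : nat}.
Implicit Types (D : set 'rV[R]_n) (u v : 'rV[R]_n -> R).

Lemma CkW k D u : Ck k.+1 D u -> Ck k D u.
Proof.
elim: k u => [|k IH] u; first by move=> [du _] x Dx; apply/differentiable_continuous/du.
by move=> [du ddu]; split=> // i; exact/IH/ddu.
Qed.

(** The formulas for derivatives hold only on D, so the inductions below must replace a function by
    one that agrees with it there. *)
Lemma eq_Ck k D u v : open D -> (forall x, D x -> u x = v x) ->
  Ck k D u -> Ck k D v.
Proof.
move=> oD; elim: k u v => [|k IH] u v e /=.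
  move=> cu x Dx; have eD := near_open oD Dx e.
  have cux : u y @[y --> x] --> u x := cu x Dx.
  rewrite (e x Dx) in cux.
  exact: cvg_trans (near_eq_cvg eD) cux.
move=> [du ddu]; split=> [x Dx|i].
  exact: near_eq_differentiable (near_open oD Dx e) (du x Dx).
by apply: IH (ddu i) => x Dx; exact: eq_pder oD Dx e.
Qed.

Lemma CkD k D u v : open D -> Ck k D u -> Ck k D v -> Ck k D (fun x => u x + v x).
Proof.
move=> oD; elim: k u v => [|k IH] u v /=.
  by move=> cu cv x Dx; exact: cvgD (cu x Dx) (cv x Dx).
move=> [du ddu] [dv ddv]; split=> [x Dx|i].
  by apply: differentiableD; [exact: du|exact: dv].
apply: eq_Ck (IH _ _ (ddu i) (ddv i)) => // x Dx.
by rewrite pderD //; [exact: du|exact: dv].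
Qed.

Lemma CkM k D u v : open D -> Ck k D u -> Ck k D v -> Ck k D (fun x => u x * v x).
Proof.
move=> oD; elim: k u v => [|k IH] u v.
  by move=> cu cv x Dx; exact: cvgM (cu x Dx) (cv x Dx).
move=> cu cv; have [[du ddu] [dv ddv]] := (cu, cv); split=> [x Dx|i].
  by apply: differentiableM; [exact: du|exact: dv].
have c := CkD oD (IH _ _ (ddu i) (CkW cv)) (IH _ _ (CkW cu) (ddv i)).
by apply: eq_Ck c => // x Dx; rewrite pderM //; [exact: du|exact: dv].
Qed.

Lemma CkV k D u : open D -> (forall x, D x -> u x != 0) ->
  Ck k D u -> Ck k D (fun x => (u x)^-1).
Proof.
move=> oD u0; elim: k => [|k IH].
  by move=> cu x Dx; exact: cvgV (u0 x Dx) (cu x Dx).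
move=> cu; have [du ddu] := cu; split=> [x Dx|i].
  by apply: differentiableV; [exact: du|exact: u0].
have c := CkM oD (CkM oD (CkM oD (ddu i) (IH (CkW cu))) (IH (CkW cu))) (Ck_cst k D (-1)).
by apply: eq_Ck c => // x Dx; rewrite pderV ?mulrN1 //; [exact: du|exact: u0].
Qed.

Lemma Ck_sum k D (I : Type) (r : seq I) (F : I -> 'rV[R]_n -> R) : open D ->
  (forall a, Ck k D (F a)) -> Ck k D (fun x => \sum_(a <- r) F a x).
Proof.
move=> oD cF; elim: r => [|a r IH].
  by apply: eq_Ck (Ck_cst k D 0) => // x _; rewrite big_nil.
by apply: eq_Ck (CkD oD (cF a) IH) => // x _; rewrite big_cons.
Qed.

Lemma smooth_differentiable D u x : smooth_on D u -> D x -> differentiable u x.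
Proof. by move=> su Dx; exact: (su 1%N).1. Qed.

Lemma smooth_pder D u i : smooth_on D u -> smooth_on D (pder i u).
Proof. by move=> su k; exact: (su k.+1).2. Qed.

End smooth_closure.

Lemma Ck_comp (R : realType) m n k (D : set 'rV[R]_m) (O : set 'rV[R]_n)
    (u : 'rV[R]_n -> R) (F : 'rV[R]_m -> 'rV[R]_n) :
  open D -> smooth_rV D F -> (forall x, D x -> O (F x)) ->
  Ck k O u -> Ck k D (u \o F).
Proof.
move=> oD sF FO.
have dF x : D x -> forall b, differentiable (fun y => F y 0 b) x.
  by move=> Dx b; exact: smooth_differentiable (sF b) Dx.
elim: k u => [|k IH] u.
  move=> cu x Dx; apply: continuous_comp; last exact/cu/FO.
  exact/differentiable_continuous/differentiable_rowP/dF.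
move=> [du ddu]; split=> [x Dx|i].
  by apply: differentiable_comp; [exact/differentiable_rowP/dF|exact/du/FO].
have c := Ck_sum (index_enum 'I_n) oD (fun b : 'I_n => CkM oD (smooth_pder i (sF b) k) (IH _ (ddu b))).
by apply: eq_Ck c => // x Dx; rewrite pder_comp //; [exact: dF|exact/du/FO].
Qed.

(** * The ring of smooth functions on an open set *)

Record open_set (T : topologicalType) := OpenSet {
  oset : set T;
  osetP : open oset }.

(* Extending by 0 outside D makes equality of such functions equality on D. *)
Record smooth_fun (R : realType) n (D : open_set 'rV[R]_n) := SmoothFun {
  smooth_val :> 'rV[R]_n -> R;
  smooth_valP : smooth_on (oset D) smooth_val;
  smooth_out : forall x, ~ oset D x -> smooth_val x = 0 }.

HB.instance Definition _ (R : realType) n (D : open_set 'rV[R]_n) :=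
  gen_eqMixin (smooth_fun D).
HB.instance Definition _ (R : realType) n (D : open_set 'rV[R]_n) :=
  gen_choiceMixin (smooth_fun D).

Section smooth_ring.
Context {R : realType} {n : nat} (D : open_set 'rV[R]_n).
Implicit Types (a b c : smooth_fun D) (u v : 'rV[R]_n -> R).

Let oD : open (oset D) := osetP D.

Lemma smooth_funP a b : (forall x, oset D x -> a x = b x) -> a = b.
Proof.
case: a b => [u su u0] [v sv v0] /= e.
have {}e : u = v.
  by apply/funext => x; have [/e|Dx] := pselect (oset D x); [|rewrite u0 ?v0].
by move: sv v0; rewrite -e => sv v0; congr SmoothFun; exact: Prop_irrelevance.
Qed.

Definition restrict0 u : 'rV[R]_n -> R := fun x => if pselect (oset D x) then u x else 0.

Lemma restrict0E u x : oset D x -> restrict0 u x = u x.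
Proof. by rewrite /restrict0; case: pselect. Qed.

Lemma restrict0_smooth u : smooth_on (oset D) u -> smooth_on (oset D) (restrict0 u).
Proof. by move=> su k; apply: eq_Ck (su k) => // x Dx; rewrite restrict0E. Qed.

Lemma restrict0_out u x : ~ oset D x -> restrict0 u x = 0.
Proof. by rewrite /restrict0; case: pselect. Qed.

Definition mk_smooth u (su : smooth_on (oset D) u) : smooth_fun D :=
  SmoothFun (restrict0_smooth su) (@restrict0_out u).

Definition smooth_zero := mk_smooth (fun k => Ck_cst k (oset D) 0).
Definition smooth_one := mk_smooth (fun k => Ck_cst k (oset D) 1).
Definition smooth_add a b :=
  mk_smooth (fun k => CkD oD (smooth_valP a k) (smooth_valP b k)).
Definition smooth_mul a b :=
  mk_smooth (fun k => CkM oD (smooth_valP a k) (smooth_valP b k)).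
Definition smooth_opp a := smooth_mul (mk_smooth (fun k => Ck_cst k (oset D) (-1))) a.

Let addA : associative smooth_add.
Proof. by move=> a b c; apply: smooth_funP => x Dx; rewrite /= !restrict0E // addrA. Qed.
Let addC : commutative smooth_add.
Proof. by move=> a b; apply: smooth_funP => x Dx; rewrite /= !restrict0E // addrC. Qed.
Let add0 : left_id smooth_zero smooth_add.
Proof. by move=> a; apply: smooth_funP => x Dx; rewrite /= !restrict0E // add0r. Qed.
Let addN : left_inverse smooth_zero smooth_opp smooth_add.
Proof.
by move=> a; apply: smooth_funP => x Dx; rewrite /= !restrict0E // mulN1r addNr.
Qed.

HB.instance Definition _ := GRing.isZmodule.Build (smooth_fun D) addA addC add0 addN.

Let mulA : associative smooth_mul.
Proof. by move=> a b c; apply: smooth_funP => x Dx; rewrite /= !restrict0E // mulrA. Qed.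
Let mulC : commutative smooth_mul.
Proof. by move=> a b; apply: smooth_funP => x Dx; rewrite /= !restrict0E // mulrC. Qed.
Let mul1 : left_id smooth_one smooth_mul.
Proof. by move=> a; apply: smooth_funP => x Dx; rewrite /= !restrict0E // mul1r. Qed.
Let mulDl : left_distributive smooth_mul smooth_add.
Proof.
by move=> a b c; apply: smooth_funP => x Dx; rewrite /= !restrict0E // mulrDl.
Qed.

HB.instance Definition _ := GRing.Zmodule_isComPzRing.Build (smooth_fun D)
  mulA mulC mul1 mulDl.

End smooth_ring.

Section smooth_calculus.
Context {R : realType} {n : nat} {D : open_set 'rV[R]_n}.
Implicit Types (a b c : smooth_fun D) (u v : 'rV[R]_n -> R).

Let oD : open (oset D) := osetP D.

Lemma smooth_addE a b x : oset D x -> (a + b) x = a x + b x.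
Proof. exact: restrict0E. Qed.

Lemma smooth_oppE a x : oset D x -> (- a) x = - a x.
Proof. by move=> Dx; rewrite /= !restrict0E // mulN1r. Qed.

Lemma smooth_mulE a b x : oset D x -> (a * b) x = a x * b x.
Proof. exact: restrict0E. Qed.

Definition smooth_eval x (Dx : oset D x) (a : smooth_fun D) : R := a x.

Lemma smooth_eval_is_zmod_morphism x (Dx : oset D x) :
  zmod_morphism (smooth_eval Dx).
Proof. by move=> a b; rewrite /smooth_eval smooth_addE // smooth_oppE. Qed.

HB.instance Definition _ x (Dx : oset D x) :=
  GRing.isZmodMorphism.Build _ _ (smooth_eval Dx) (smooth_eval_is_zmod_morphism Dx).

Lemma smooth_eval_is_monoid_morphism x (Dx : oset D x) :
  monoid_morphism (smooth_eval Dx).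
Proof.
split=> [|a b]; first exact: restrict0E.
by rewrite /smooth_eval smooth_mulE.
Qed.

HB.instance Definition _ x (Dx : oset D x) :=
  GRing.isMonoidMorphism.Build _ _ (smooth_eval Dx)
    (smooth_eval_is_monoid_morphism Dx).

Definition smooth_d i a : smooth_fun D :=
  mk_smooth (smooth_pder i (smooth_valP a)).

Lemma smooth_dE i a x : oset D x -> smooth_d i a x = pder i a x.
Proof. exact: restrict0E. Qed.

Lemma smooth_diff a x : oset D x -> differentiable a x.
Proof. exact: smooth_differentiable (smooth_valP a). Qed.

Lemma smooth_d_is_zmod_morphism i : zmod_morphism (smooth_d i).
Proof.
move=> a b; apply: smooth_funP => x Dx.
rewrite smooth_addE // smooth_oppE // !smooth_dE //.
rewrite (eq_pder i oD Dx (v := fun y => a y + (-1) * b y)); last first.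
  by move=> y Dy; rewrite smooth_addE // smooth_oppE // mulN1r.
rewrite pderD ?pderM; try exact: smooth_diff; try exact: differentiable_cst.
  by rewrite /pder derive_cst mul0r add0r mulN1r.
by apply: differentiableM; [exact: differentiable_cst|exact: smooth_diff].
Qed.

HB.instance Definition _ i :=
  GRing.isZmodMorphism.Build _ _ (smooth_d i) (smooth_d_is_zmod_morphism i).

Lemma smooth_dM i a b : smooth_d i (a * b) = smooth_d i a * b + a * smooth_d i b.
Proof.
apply: smooth_funP => x Dx; rewrite smooth_addE // !smooth_mulE // !smooth_dE //.
rewrite -pderM; try exact: smooth_diff.
by apply: (eq_pder i oD Dx) => y Dy; exact: smooth_mulE.
Qed.

Lemma smooth_dC i j a : smooth_d i (smooth_d j a) = smooth_d j (smooth_d i a).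
Proof.
have E p q b x : oset D x -> smooth_d p (smooth_d q b) x = pder p (pder q b) x.
  move=> Dx; apply: (etrans (smooth_dE p (smooth_d q b) Dx)).
  by apply: (eq_pder p oD Dx) => y; exact: smooth_dE.
apply: smooth_funP => x Dx.
exact: etrans (E i j a x Dx) (etrans (pderC i j oD Dx (smooth_valP a 2%N)) (esym (E j i a x Dx))).
Qed.

Lemma pder_smooth_d i u a x : (forall y, oset D y -> u y = a y) -> oset D x ->
  pder i u x = smooth_d i a x.
Proof. by move=> e Dx; rewrite smooth_dE //; exact: (eq_pder i oD Dx e). Qed.

(** The default 0 makes the lift total, so that matrices of functions lift entry by entry without
    carrying smoothness proofs. *)
Definition lift u : smooth_fun D :=
  if pselect (smooth_on (oset D) u) is left su then mk_smooth su else 0.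

Lemma liftE u x : smooth_on (oset D) u -> oset D x -> lift u x = u x.
Proof. by rewrite /lift; case: pselect => // su _ Dx; exact: restrict0E. Qed.

Lemma eq_smooth_on u a : (forall x, oset D x -> u x = a x) -> smooth_on (oset D) u.
Proof. by move=> e k; apply: eq_Ck (smooth_valP a k) => // x Dx; rewrite e. Qed.

End smooth_calculus.

(* An abstract presentation of the differential ring of smooth functions on D;
   its only instance is opaque, so that unification never unfolds functions. *)
Record smooth_model (R : realType) n (D : set 'rV[R]_n) := SmoothModel {
  sm_ring :> comPzRingType;
  sm_d : 'I_n -> {additive sm_ring -> sm_ring};
  sm_ev : forall x, D x -> {rmorphism sm_ring -> R};
  sm_lift : ('rV[R]_n -> R) -> sm_ring;
  sm_dM : forall i a b, sm_d i (a * b) = sm_d i a * b + a * sm_d i b;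
  sm_dC : forall i j a, sm_d i (sm_d j a) = sm_d j (sm_d i a);
  sm_inj : forall a b, (forall x (Dx : D x), sm_ev Dx a = sm_ev Dx b) -> a = b;
  sm_liftE : forall u x (Dx : D x), smooth_on D u -> sm_ev Dx (sm_lift u) = u x;
  sm_dE : forall i u a x (Dx : D x), (forall y (Dy : D y), u y = sm_ev Dy a) ->
    sm_ev Dx (sm_d i a) = pder i u x;
  sm_smooth : forall u a, (forall y (Dy : D y), u y = sm_ev Dy a) -> smooth_on D u }.

Lemma smooth_model_of (R : realType) n (D : set 'rV[R]_n) : open D -> smooth_model D.
Proof.
move=> oD; pose D' := OpenSet oD.
apply: (@SmoothModel R n D (smooth_fun D') (fun i => smooth_d i)
  (fun x Dx => @smooth_eval R n D' x Dx) (@lift R n D')).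
- exact: smooth_dM.
- exact: smooth_dC.
- by move=> a b e; apply: smooth_funP => x Dx; exact: e x Dx.
- by move=> u x Dx su; exact: (@liftE R n D').
- by move=> i u a x Dx e; apply: esym; exact: (@pder_smooth_d R n D').
- by move=> u a e; exact: (@eq_smooth_on R n D' u a e).
Qed.

(** * Matrices of smooth functions and their values *)

Section smooth_model_theory.
Context {R : realType} {n : nat} {D : set 'rV[R]_n}.
Variable S : smooth_model D.

Lemma sm_ev_irr x (Dx Dx' : D x) (a : S) : sm_ev S Dx a = sm_ev S Dx' a.
Proof. by rewrite (Prop_irrelevance Dx Dx'). Qed.

Definition lift_mx p q (F : 'rV[R]_n -> 'M[R]_(p, q)) : 'M[S]_(p, q) :=
  \matrix_(i, j) sm_lift S (fun x => F x i j).

Definition ev_mx p q x (Dx : D x) (A : 'M[S]_(p, q)) : 'M[R]_(p, q) :=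
  map_mx (sm_ev S Dx) A.

Lemma ev_lift_mx p q (F : 'rV[R]_n -> 'M[R]_(p, q)) x (Dx : D x) :
  smooth_mx D F -> ev_mx Dx (lift_mx F) = F x.
Proof. by move=> sF; apply/matrixP => i j; rewrite !mxE (sm_liftE _ Dx (sF i j)). Qed.

Lemma ev_mxP p q (A B : 'M[S]_(p, q)) :
  (forall x (Dx : D x), ev_mx Dx A = ev_mx Dx B) -> A = B.
Proof.
move=> e; apply/matrixP => i j; apply: sm_inj => x Dx.
by have /matrixP/(_ i j) := e x Dx; rewrite !mxE.
Qed.

Section ev_mx.
Context {x : 'rV[R]_n} (Dx : D x).

Lemma ev_mxD p q (A B : 'M[S]_(p, q)) : ev_mx Dx (A + B) = ev_mx Dx A + ev_mx Dx B.
Proof. exact: map_mxD. Qed.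

Lemma ev_mxN p q (A : 'M[S]_(p, q)) : ev_mx Dx (- A) = - ev_mx Dx A.
Proof. exact: map_mxN. Qed.

Lemma ev_mx0 p q : ev_mx Dx (0 : 'M[S]_(p, q)) = 0.
Proof. exact: map_mx0. Qed.

Lemma ev_mx1 p : ev_mx Dx (1%:M : 'M[S]_p) = 1%:M.
Proof. exact: map_mx1. Qed.

Lemma ev_mxM p q r (A : 'M[S]_(p, q)) (B : 'M[S]_(q, r)) :
  ev_mx Dx (A *m B) = ev_mx Dx A *m ev_mx Dx B.
Proof. exact: map_mxM. Qed.

Lemma ev_mxZ p q a (A : 'M[S]_(p, q)) : ev_mx Dx (a *: A) = sm_ev S Dx a *: ev_mx Dx A.
Proof. exact: map_mxZ. Qed.

Lemma ev_mxT p q (A : 'M[S]_(p, q)) : ev_mx Dx A^T = (ev_mx Dx A)^T.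
Proof. by rewrite /ev_mx map_trmx. Qed.

Lemma ev_mx_row p q (A : 'M[S]_(p, q)) i : ev_mx Dx (row i A) = row i (ev_mx Dx A).
Proof. by rewrite /ev_mx map_row. Qed.

Lemma ev_mx_sum p q (I : Type) (s : seq I) (A : I -> 'M[S]_(p, q)) :
  ev_mx Dx (\sum_(l <- s) A l) = \sum_(l <- s) ev_mx Dx (A l).
Proof. exact: raddf_sum. Qed.

Lemma ev_mxE p q (A : 'M[S]_(p, q)) i j : ev_mx Dx A i j = sm_ev S Dx (A i j).
Proof. by rewrite mxE. Qed.

Lemma ev_mx_d p q i (A : 'M[S]_(p, q)) (F : 'rV[R]_n -> 'M[R]_(p, q)) j l :
  (forall y (Dy : D y), F y = ev_mx Dy A) ->
  ev_mx Dx (map_mx (sm_d S i) A) j l = pder i (fun y => F y j l) x.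
Proof. by move=> e; rewrite !mxE; apply: sm_dE => y Dy; rewrite (e y Dy) mxE. Qed.

Lemma ev_mx_inv p (A B : 'M[S]_p) : B *m A = 1%:M -> ev_mx Dx B = invmx (ev_mx Dx A).
Proof.
move=> /(congr1 (ev_mx Dx)); rewrite ev_mxM ev_mx1 => BA.
have [_ uA] := mulmx1_unit BA.
by rewrite -[LHS]mulmx1 -(mulmxV uA) mulmxA BA mul1mx.
Qed.

End ev_mx.

Lemma ev_mx_smooth p q (A : 'M[S]_(p, q)) (F : 'rV[R]_n -> 'M[R]_(p, q)) :
  (forall x (Dx : D x), F x = ev_mx Dx A) -> smooth_mx D F.
Proof.
by move=> e i j; apply: (sm_smooth (a := A i j)) => y Dy; rewrite (e y Dy) mxE.
Qed.

Definition sm_val (a : S) (x : 'rV[R]_n) : R :=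
  if pselect (D x) is left Dx then sm_ev S Dx a else 0.

Lemma sm_valE a x (Dx : D x) : sm_val a x = sm_ev S Dx a.
Proof. by rewrite /sm_val; case: pselect => // Dx'; exact: sm_ev_irr. Qed.

Lemma sm_val_smooth a : smooth_on D (sm_val a).
Proof. by apply: (sm_smooth (a := a)) => x Dx; exact: sm_valE. Qed.

(** The determinant vanishes nowhere, so its reciprocal is smooth and the adjugate provides an
    inverse inside the ring. *)
Lemma sm_mx_inv p (A : 'M[S]_p) : open D ->
  (forall x (Dx : D x), ev_mx Dx A \in unitmx) ->
  exists2 B, B *m A = 1%:M & A *m B = 1%:M.
Proof.
move=> oD uA; have dA x : D x -> sm_val (\det A) x != 0.
  by move=> Dx; have := uA x Dx; rewrite unitmxE det_map_mx unitfE sm_valE.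
pose b := sm_lift S (fun x => (sm_val (\det A) x)^-1).
have sb : smooth_on D (fun x => (sm_val (\det A) x)^-1).
  by move=> k; apply: CkV => //; exact: sm_val_smooth.
have bA : b * \det A = 1.
  apply: sm_inj => x Dx; rewrite rmorphM rmorph1 sm_liftE // (sm_valE _ Dx).
  by rewrite mulVf // -sm_valE dA.
have BA : (b *: \adj A) *m A = 1%:M.
  by rewrite -scalemxAl mul_adj_mx scale_scalar_mx bA.
by exists (b *: \adj A) => //; exact: mulmx1C.
Qed.

Lemma smooth_invmx p (F : 'rV[R]_n -> 'M[R]_p) : open D -> smooth_mx D F ->
  (forall x, D x -> F x \in unitmx) -> smooth_mx D (fun x => invmx (F x)).
Proof.
move=> oD sF uF; have [x Dx|B BA _] := @sm_mx_inv _ (lift_mx F) oD.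
  by rewrite ev_lift_mx //; exact: uF.
apply: (ev_mx_smooth (A := B)) => x Dx.
by rewrite (ev_mx_inv Dx BA) ev_lift_mx.
Qed.

End smooth_model_theory.

(** * Pulling back smooth functions *)

Section smooth_pullback.
Context {R : realType} {m n : nat} {D : set 'rV[R]_m} {O : set 'rV[R]_n}.
Variables (SD : smooth_model D) (SO : smooth_model O).
Hypothesis oD : open D.
Variable F : 'rV[R]_m -> 'rV[R]_n.
Hypothesis sF : smooth_rV D F.
Hypothesis FO : forall x, D x -> O (F x).

(** The proofs are arguments of the term so that the ring morphism structure below can be attached
    to it. *)
Definition pullback of open D & smooth_rV D F & (forall x, D x -> O (F x)) :=
  fun a : SO => sm_lift SD (sm_val a \o F) : SD.

Let phi := pullback oD sF FO.

Lemma pullbackE a x (Dx : D x) : sm_ev SD Dx (phi a) = sm_ev SO (FO Dx) a.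
Proof.
rewrite sm_liftE /= ?(sm_valE _ (FO Dx)) // => k.
exact: Ck_comp oD sF FO (sm_val_smooth a k).
Qed.

Lemma pullback_is_zmod_morphism : zmod_morphism phi.
Proof.
by move=> a b; apply: sm_inj => x Dx; rewrite rmorphB !pullbackE rmorphB.
Qed.

Lemma pullback_is_monoid_morphism : monoid_morphism phi.
Proof.
split=> [|a b]; apply: sm_inj => x Dx; first by rewrite pullbackE !rmorph1.
by rewrite rmorphM !pullbackE rmorphM.
Qed.

HB.instance Definition _ :=
  GRing.isZmodMorphism.Build _ _ (pullback oD sF FO) pullback_is_zmod_morphism.

HB.instance Definition _ :=
  GRing.isMonoidMorphism.Build _ _ (pullback oD sF FO) pullback_is_monoid_morphism.

Lemma smooth_jac : smooth_mx D (jac F).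
Proof.
move=> i b; rewrite (_ : (fun x => _) = pder i (fun y => F y 0 b)).
  exact/smooth_pder/sF.
by apply/funext => x; rewrite mxE.
Qed.

Lemma d_pullback i a : sm_d SD i (pullback oD sF FO a)
  = \sum_p lift_mx SD (jac F) i p * pullback oD sF FO (sm_d SO p a).
Proof.
apply: sm_inj => x Dx; rewrite (@sm_dE _ _ _ SD i (sm_val a \o F)); last first.
  by move=> y Dy; rewrite pullbackE /= (sm_valE _ (FO Dy)).
rewrite pder_comp; first last.
- exact: smooth_differentiable (sm_val_smooth a) (FO Dx).
- by move=> b; exact: smooth_differentiable (sF b) Dx.
rewrite rmorph_sum; apply: eq_bigr => p _; rewrite rmorphM pullbackE; congr (_ * _).
  by rewrite -ev_mxE ev_lift_mx ?mxE //; exact: smooth_jac.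
by rewrite (@sm_dE _ _ _ SO p (sm_val a)) // => y Dy; exact: sm_valE.
Qed.

Lemma d_jac i l p :
  sm_d SD i (lift_mx SD (jac F) l p) = sm_d SD l (lift_mx SD (jac F) i p).
Proof.
have E j : lift_mx SD (jac F) j p = sm_d SD j (sm_lift SD (fun y => F y 0 p)).
  apply: sm_inj => x Dx; rewrite -ev_mxE ev_lift_mx; last exact: smooth_jac.
  rewrite (@sm_dE _ _ _ SD j (fun y => F y 0 p)) ?mxE // => y Dy.
  by rewrite sm_liftE //; exact: sF.
by rewrite !E sm_dC.
Qed.

End smooth_pullback.

(** * Curvature of a space form *)

(** A curvature-like tensor is determined by its sectional values: polarisation makes K alternating
    in the first three arguments, and the cyclic identity then reads 3 K = 0. *)
Lemma curvature_like_eq0 (R : realFieldType) (V : nmodType) (K : V -> V -> V -> V -> R) :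
  (forall X X' Y Z W, K (X + X') Y Z W = K X Y Z W + K X' Y Z W) ->
  (forall X Y Y' Z W, K X (Y + Y') Z W = K X Y Z W + K X Y' Z W) ->
  (forall X Y Z Z' W, K X Y (Z + Z') W = K X Y Z W + K X Y Z' W) ->
  (forall X Y Z W W', K X Y Z (W + W') = K X Y Z W + K X Y Z W') ->
  (forall X Y Z W, K Y X Z W = - K X Y Z W) ->
  (forall X Y Z W, K X Y W Z = - K X Y Z W) ->
  (forall X Y Z W, K X Y Z W + K Y Z X W + K Z X Y W = 0) ->
  (forall X Y, K X Y Y X = 0) ->
  forall X Y Z W, K X Y Z W = 0.
Proof.
move=> D1 D2 D3 D4 s12 s34 B K0.
(* Pair symmetry is a linear consequence of the four cyclic identities obtained by rotating the
   arguments. *)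
have pair X Y Z W : K X Y Z W = K Z W X Y.
  move: (B X Y Z W) (B Y Z W X) (B Z W X Y) (B W X Y Z).
  move: (s34 X Y Z W) (s34 Y Z X W) (s34 Z W X Y) (s34 W X Z Y).
  by move: (s34 Z X Y W) (s12 Z X W Y) (s34 W Y Z X) (s12 W Y X Z); lra.
(* Expand K (X + W) Y Y (X + W) = 0; the two cross terms are equal by pair symmetry. *)
have K1 X Y W : K X Y Y W = 0.
  move: (K0 (X + W) Y) (K0 X Y) (K0 W Y).
  rewrite D1 !D4; move: (pair W Y Y X) (s12 X Y W Y) (s34 X Y Y W) (s12 Y X W Y).
  by move: (s34 Y X Y W) (s12 Y X Y W) (s12 X Y Y W); lra.
have s23 X Y Z W : K X Z Y W = - K X Y Z W.
  by move: (K1 X (Y + Z) W) (K1 X Y W) (K1 X Z W); rewrite D2 !D3; lra.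
move=> X Y Z W; move: (B X Y Z W).
by move: (s23 Y Z X W) (s12 X Y Z W) (s23 X Y Z W) (s12 X Z Y W); lra.
Qed.

(** * The Levi-Civita connection of a metric in coordinates *)

Section christoffel_ring.
Context {R : realType} {n : nat} {O : set 'rV[R]_n}.
Variables (C : smooth_model O) (G : 'rV[R]_n -> 'M[R]_n).
Hypothesis oO : open O.
Hypothesis sG : smooth_mx O G.
Hypothesis Gsym : forall z, O z -> (G z)^T = G z.
Hypothesis Gunit : forall z, O z -> G z \in unitmx.

(* A name for the Christoffel symbols that unification cannot unfold. *)
Variable chr : 'I_n -> 'I_n -> 'rV[R]_n -> 'rV[R]_n.
Hypothesis chrE : christoffel G = chr.

(** The connection matrix in the direction p, acting on rows: row q is nabla_p d_q. *)
Definition christoffel_mx p z : 'M[R]_n := \matrix_q chr p q z.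

Lemma smooth_christoffel p : smooth_mx O (christoffel_mx p).
Proof.
have sGi := smooth_invmx C oO sG Gunit.
move=> q s k; pose rhs z := \sum_l (2^-1 * (pder p (fun y => G y q l) z
   + pder q (fun y => G y p l) z + (-1) * pder l (fun y => G y p q) z)) * invmx (G z) l s.
have cr : Ck k O rhs.
  apply: Ck_sum => // l; apply: CkM => //; last exact: sGi.
  apply: CkM => //; first exact: Ck_cst.
  by do ![apply: CkD => //|apply: CkM => //|exact: Ck_cst|exact: smooth_pder (sG _ _) k].
apply: eq_Ck cr => // z Oz; rewrite mxE -chrE /christoffel mxE mxE mulr_sumr.
by apply: eq_bigr => l _; rewrite mxE mulN1r mulrA.
Qed.

Lemma christoffel_lower p q r z : O z -> (christoffel_mx p z *m G z) q r =
  2^-1 * (pder p (fun y => G y q r) z + pder q (fun y => G y p r) z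
          - pder r (fun y => G y p q) z).
Proof.
move=> Oz; transitivity ((row q (christoffel_mx p z) *m G z) 0 r).
  by rewrite -row_mul [RHS]mxE.
by rewrite rowK -chrE /christoffel -scalemxAl mulmxKV ?Gunit // !mxE.
Qed.

Let pderG_sym i p q z : O z ->
  pder i (fun y => G y p q) z = pder i (fun y => G y q p) z.
Proof.
move=> Oz; apply: (eq_pder i oO Oz) => y Oy.
by rewrite -[in LHS](Gsym Oy) mxE.
Qed.

Definition metric_ring : 'M[C]_n := lift_mx C G.
Definition christoffel_ring p : 'M[C]_n := lift_mx C (christoffel_mx p).
Local Notation GC := metric_ring.
Local Notation Gam := christoffel_ring.
Local Notation d := (sm_d C).

Lemma ev_metric z (Oz : O z) : ev_mx Oz GC = G z.
Proof. exact: ev_lift_mx. Qed.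

Lemma ev_christoffel p z (Oz : O z) : ev_mx Oz (Gam p) = christoffel_mx p z.
Proof. exact/ev_lift_mx/smooth_christoffel. Qed.

Lemma metric_ring_sym : GC^T = GC.
Proof. by apply: ev_mxP => z Oz; rewrite ev_mxT !ev_metric Gsym. Qed.

Lemma christoffel_metric p : map_mx (d p) GC = Gam p *m GC + GC *m (Gam p)^T.
Proof.
apply: ev_mxP => z Oz; rewrite ev_mxD !ev_mxM ev_mxT ev_metric ev_christoffel.
apply/matrixP => q r; rewrite (ev_mx_d _ _ _ _ (fun y Oy => esym (ev_metric Oy))).
rewrite [RHS]addmxE -[in X in _ + X](Gsym Oz) -trmx_mul [_^T q r]mxE.
rewrite !christoffel_lower //.
rewrite (pderG_sym p r q Oz) (pderG_sym q p r Oz) (pderG_sym r p q Oz).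
rewrite (pderG_sym q r p Oz) (pderG_sym r q p Oz).
move: (pder p (fun y => G y q r) z) (pder q (fun y => G y p r) z)
  (pder r (fun y => G y p q) z) => x1 x2 x3.
by field.
Qed.

Lemma christoffelC p q z : O z -> chr p q z = chr q p z.
Proof.
move=> Oz; rewrite -chrE; apply: (congr1 (fun v => 2^-1 *: (v *m invmx (G z)))).
apply/rowP => l; apply: (etrans (mxE _ _ _ _)); apply: (etrans _ (esym (mxE _ _ _ _))).
rewrite [X in X - _]addrC; apply: (congr1 (fun e => _ + _ - e)).
exact: pderG_sym.
Qed.

Lemma christoffel_ring_sym p q : row q (Gam p) = row p (Gam q).
Proof.
have E p' q' z (Oz : O z) : ev_mx Oz (row q' (Gam p')) = chr p' q' z.
  by rewrite ev_mx_row ev_christoffel rowK.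
apply: ev_mxP => z Oz; rewrite [LHS]E [RHS]E; exact: christoffelC.
Qed.

Lemma ev_curv i j z (Oz : O z) :
  ev_mx Oz (curv d Gam i j) = \matrix_l curvature G i j l z.
Proof.
rewrite curvE !(ev_mxD, ev_mxN, ev_mxM) !ev_christoffel.
apply/matrixP => l p; rewrite [RHS]mxE.
have E q q' : ev_mx Oz (map_mx (d q) (Gam q')) l p
   = pder q (fun y => chr q' l y 0 p) z.
  rewrite (ev_mx_d _ _ _ _ (fun y Oy => esym (ev_christoffel q' Oy))).
  by apply: (congr1 (fun u => pder q u z)); apply/funext => y; rewrite mxE.
have E' q q' : (christoffel_mx q z *m christoffel_mx q' z) l p
   = \sum_s chr q l z 0 s * chr q' s z 0 p.
  rewrite mxE; apply: eq_bigr => s _.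
  by rewrite [christoffel_mx q _ _ _]mxE [christoffel_mx q' _ _ _]mxE.
rewrite /curvature chrE !(addmxE, oppmxE) !E !E' summxE -addrA.
congr (_ + _); first by rewrite mxE.
rewrite -sumrB.
by apply: eq_bigr => q _; rewrite addmxE oppmxE; congr (_ - _); rewrite mxE.
Qed.

Lemma curvature_skew12 i j l z : curvature G j i l z = - curvature G i j l z.
Proof.
rewrite /curvature opprD -sumrN; congr (_ + _).
  by apply/rowP => p; rewrite !mxE opprB.
by apply: eq_bigr => q _; rewrite opprB.
Qed.

Lemma curvature_skew34 i j z : O z ->
  (\matrix_l curvature G i j l z) *m G z + G z *m (\matrix_l curvature G i j l z)^T = 0.
Proof.
move=> Oz; have e := curv_skew (@sm_dM _ _ _ C) (@sm_dC _ _ _ C) christoffel_metric i j.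
by rewrite -(ev_curv i j Oz) -(ev_metric Oz) -ev_mxT -!ev_mxM -ev_mxD e ev_mx0.
Qed.

(** [bianchi] for the identity matrix, whose torsion-freeness is the symmetry of the Christoffel
    symbols. *)
Lemma curvature_bianchi i j l z : O z ->
  curvature G i j l z + curvature G j l i z + curvature G l i j z = 0.
Proof.
move=> Oz; have sym p q : row q (cov d Gam p (1%:M : 'M[C]_n)) = row p (cov d Gam q 1%:M).
  by rewrite !covE !(dmx1 (@sm_dM _ _ _ C)) !mul1mx !add0r christoffel_ring_sym.
have e := bianchi (@sm_dM _ _ _ C) (@sm_dC _ _ _ C) i j l sym.
have := congr1 (ev_mx Oz) e; rewrite !mul1mx !ev_mxD !ev_mx_row !ev_curv ev_mx0.
by rewrite !rowK.
Qed.

End christoffel_ring.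

(** * Constant sectional curvature determines the curvature tensor *)

Section constant_sectional.
Context {R : realType} {n : nat}.
Variables (g : 'M[R]_n) (Om : 'I_n -> 'I_n -> 'M[R]_n) (c : R).
Hypothesis g_sym : g^T = g.
Hypothesis g_pos : forall v, v != 0 -> 0 < dot g v v.
Hypothesis g_unit : g \in unitmx.
Hypothesis skew12 : forall i j, Om j i = - Om i j.
Hypothesis skew34 : forall i j, Om i j *m g + g *m (Om i j)^T = 0.
Hypothesis cyclic : forall i j l, row l (Om i j) + row i (Om j l) + row j (Om l i) = 0.

Definition curv2 (X Y : 'rV[R]_n) := \sum_i \sum_j (X 0 i * Y 0 j) *: Om i j.

Hypothesis sect : forall X Y, row_free (col_mx X Y) ->
  dot g (Y *m curv2 X Y) X = c * (dot g X X * dot g Y Y - dot g X Y ^+ 2).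

Let dotC u v : dot g u v = dot g v u.
Proof.
rewrite /dot; transitivity ((u *m g *m v^T)^T 0 0); first by rewrite [RHS]mxE.
by rewrite !trmx_mul trmxK g_sym mulmxA.
Qed.

Let dotDl u v w : dot g (u + v) w = dot g u w + dot g v w.
Proof. by rewrite /dot !mulmxDl mxE. Qed.

Let dotDr u v w : dot g w (u + v) = dot g w u + dot g w v.
Proof. by rewrite !(dotC w) dotDl. Qed.

Let dotZl a u w : dot g (a *: u) w = a * dot g u w.
Proof. by rewrite /dot -!scalemxAl mxE. Qed.

Let dotZr a u w : dot g w (a *: u) = a * dot g w u.
Proof. by rewrite dotC dotZl dotC. Qed.

Let dotNl u w : dot g (- u) w = - dot g u w.
Proof. by rewrite -scaleN1r dotZl mulN1r. Qed.

Let dot0l w : dot g 0 w = 0.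
Proof. by rewrite /dot !mul0mx mxE. Qed.

Let dot0r w : dot g w 0 = 0.
Proof. by rewrite dotC dot0l. Qed.

Let curv2Dl X X' Y : curv2 (X + X') Y = curv2 X Y + curv2 X' Y.
Proof.
rewrite /curv2 -big_split; apply: eq_bigr => i _; rewrite -big_split.
by apply: eq_bigr => j _ /=; rewrite mxE mulrDl scalerDl.
Qed.

Let curv2_skew X Y : curv2 Y X = - curv2 X Y.
Proof.
rewrite /curv2 exchange_big -sumrN; apply: eq_bigr => i _; rewrite -sumrN.
by apply: eq_bigr => j _; rewrite skew12 scalerN mulrC.
Qed.

Let curv2Dr X Y Y' : curv2 X (Y + Y') = curv2 X Y + curv2 X Y'.
Proof. by rewrite !(curv2_skew _ X) curv2Dl opprD. Qed.

Let curv2_skew34 X Y : curv2 X Y *m g + g *m (curv2 X Y)^T = 0.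
Proof.
rewrite /curv2 mulmx_suml raddf_sum mulmx_sumr -big_split big1 // => i _ /=.
rewrite mulmx_suml raddf_sum mulmx_sumr -big_split big1 // => j _ /=.
by rewrite linearZ -scalemxAl -scalemxAr -scalerDr skew34 scaler0.
Qed.

Let curv2_skew_dot X Y Z W : dot g (W *m curv2 X Y) Z = - dot g (Z *m curv2 X Y) W.
Proof.
have := congr1 (fun M : 'M[R]_n => (Z *m M *m W^T) 0 0) (curv2_skew34 X Y).
rewrite mulmxDr mulmxDl mulmx0 mul0mx addmxE [RHS]mxE => /eqP.
rewrite addr_eq0 => /eqP e; rewrite (dotC _ Z) /dot trmx_mul !mulmxA.
by rewrite -[LHS]opprK; congr (- _); move: e; rewrite !mulmxA => ->.
Qed.

Let curv2_cyclic X Y Z : Z *m curv2 X Y + X *m curv2 Y Z + Y *m curv2 Z X = 0.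
Proof.
have E (A B D : 'rV[R]_n) : D *m curv2 A B =
    \sum_i \sum_j \sum_l (A 0 i * B 0 j * D 0 l) *: row l (Om i j).
  rewrite mulmx_sumr; apply: eq_bigr => i _; rewrite mulmx_sumr.
  apply: eq_bigr => j _; rewrite -scalemxAr mulmx_sum_row scaler_sumr.
  by apply: eq_bigr => l _; rewrite scalerA.
rewrite !E [X in _ + X + _]exchange_big [X in _ + X]exchange_big /=.
under [X in _ + X + _]eq_bigr do rewrite exchange_big.
rewrite [X in _ + X + _]exchange_big /=.
under [X in _ + X + _]eq_bigr do rewrite exchange_big.
under [X in _ + X]eq_bigr do rewrite exchange_big.
rewrite -!big_split big1 // => i _ /=; rewrite -!big_split big1 // => j _ /=.
rewrite -!big_split big1 // => l _ /=.
rewrite (_ : Y 0 j * Z 0 l * X 0 i = X 0 i * Y 0 j * Z 0 l); last by ring.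
rewrite (_ : Z 0 l * X 0 i * Y 0 j = X 0 i * Y 0 j * Z 0 l); last by ring.
by rewrite -!scalerDr cyclic scaler0.
Qed.

(** The deviation from the curvature tensor of a space form; it is again curvature-like, so
    [curvature_like_eq0] applies to it. *)
Definition curvature_defect X Y Z W := dot g (Z *m curv2 X Y) W
  - c * (dot g Y Z * dot g X W - dot g X Z * dot g Y W).

Let defect_free X Y : row_free (col_mx X Y) -> curvature_defect X Y Y X = 0.
Proof.
by move=> /sect e; rewrite /curvature_defect e (dotC Y X); ring.
Qed.

Let defect_scale X a : curvature_defect X (a *: X) (a *: X) X = 0.
Proof.
have XX : curv2 X X = 0.
  have /eqP := curv2_skew X X; rewrite -subr_eq0 opprK -mulr2n.
  by rewrite -scaler_nat scaler_eq0 pnatr_eq0 => /eqP.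
have Xa : curv2 X (a *: X) = 0.
  rewrite -[RHS](scaler0 _ a) -XX /curv2 scaler_sumr; apply: eq_bigr => i _.
  rewrite scaler_sumr; apply: eq_bigr => j _; rewrite scalerA mxE.
  by congr (_ *: _); ring.
by rewrite /curvature_defect Xa mulmx0 dot0l !(dotZl, dotZr); ring.
Qed.

(** [sect] speaks of independent pairs only. In a dependent pair X = 0 or Y is a multiple of X, and
    then both parts of the defect vanish. *)
Let defect0 X Y : curvature_defect X Y Y X = 0.
Proof.
have [|nf] := boolP (row_free (col_mx X Y)); first exact: defect_free.
have [->|X0] := eqVneq X 0.
  by rewrite /curvature_defect !dot0r !dot0l; ring.
suff [a ->] : exists a, Y = a *: X by exact: defect_scale.
apply: contrapT => na; case/negP: nf; apply: inj_row_free => v.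
rewrite -[v]hsubmxK mul_row_col; set a := lsubmx v; set b := rsubmx v.
have sc (w : 'M[R]_1) (Z : 'rV[R]_n) : w *m Z = w 0 0 *: Z.
  by rewrite [w in LHS]mx11_scalar mul_scalar_mx.
rewrite !sc => e.
have b0 : b 0 0 = 0.
  apply/eqP; apply/negPn/negP => b0; apply: na; exists (- (b 0 0)^-1 * a 0 0).
  apply: (scalerI b0); apply/eqP; rewrite -subr_eq0 scalerA.
  by rewrite mulrA mulrN divff // mulN1r scaleNr opprK addrC e.
have a0 : a 0 0 = 0.
  move: e; rewrite b0 scale0r addr0 => /eqP.
  by rewrite scaler_eq0 (negbTE X0) orbF => /eqP.
by rewrite [a]mx11_scalar [b]mx11_scalar a0 b0 !raddf0 row_mx0.
Qed.

Lemma curvature_defect_eq0 X Y Z W : curvature_defect X Y Z W = 0.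
Proof.
apply: curvature_like_eq0 => //.
- by move=> *; rewrite /curvature_defect curv2Dl mulmxDr !dotDl; ring.
- by move=> *; rewrite /curvature_defect curv2Dr mulmxDr !dotDl; ring.
- by move=> *; rewrite /curvature_defect mulmxDl !(dotDl, dotDr); ring.
- by move=> *; rewrite /curvature_defect !dotDr; ring.
- by move=> X1 Y1 *; rewrite /curvature_defect (curv2_skew X1 Y1) mulmxN dotNl; ring.
- move=> X1 Y1 Z1 W1; rewrite /curvature_defect curv2_skew_dot.
  by rewrite (dotC Y1 W1) (dotC X1 Z1) (dotC X1 W1) (dotC Y1 Z1); ring.
- move=> X1 Y1 Z1 W1; rewrite /curvature_defect.
  have := congr1 (fun v => dot g v W1) (curv2_cyclic X1 Y1 Z1).
  rewrite !dotDl dot0l (dotC Z1 X1) (dotC Y1 X1) (dotC Z1 Y1) => e.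
  by apply: (@eq_of_subr R _ _ _ _ e); ring.
Qed.

Lemma constant_curvature_row i j l :
  row l (Om i j) = c *: (g j l *: delta_mx 0 i - g i l *: delta_mx 0 j).
Proof.
have E p q : curv2 (delta_mx 0 p) (delta_mx 0 q) = Om p q.
  rewrite /curv2 (bigD1 p) //= (bigD1 q) //= !mxE !eqxx mulr1 scale1r.
  rewrite big1 ?addr0 => [|s sq]; last by rewrite !mxE (negbTE sq) andbF mulr0 scale0r.
  rewrite big1 ?addr0 // => s sp; apply: big1 => r _.
  by rewrite !mxE (negbTE sp) andbF mul0r scale0r.
have dE p q : dot g (delta_mx 0 p) (delta_mx 0 q) = g p q.
  by rewrite /dot -rowE trmx_delta -colE !mxE.
have H W : dot g (row l (Om i j) - c *: (g j l *: delta_mx 0 i - g i l *: delta_mx 0 j)) W = 0.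
  have := curvature_defect_eq0 (delta_mx 0 i) (delta_mx 0 j) (delta_mx 0 l) W.
  rewrite /curvature_defect E -rowE !dE => <-.
  by rewrite dotDl dotNl dotZl dotDl dotNl !dotZl.
apply/eqP; rewrite -subr_eq0; apply/negPn/negP => /g_pos.
by rewrite H ltxx.
Qed.

End constant_sectional.

Section gram.
Context {R : realType} {n : nat}.
Variable g : 'M[R]_n.
Hypothesis g_sym : g^T = g.
Hypothesis g_pos : forall v, v != 0 -> 0 < dot g v v.

(** Strict Cauchy-Schwarz: W = |Y|^2 X - <X,Y> Y has squared length |Y|^2 times the Gram
    determinant. If that is 0, then W = 0 is a linear relation, which forces Y = 0, against
    independence. *)
Lemma gram_neq0 X Y : row_free (col_mx X Y) ->
  dot g X X * dot g Y Y - dot g X Y ^+ 2 != 0.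
Proof.
move=> /row_free_inj inj; pose x := dot g X X; pose y := dot g Y Y; pose z := dot g X Y.
have lin (a b : 'M[R]_1) : a *m X + b *m Y = 0 -> a = 0 /\ b = 0.
  move=> e; have /inj/eq_row_mx[] // : mulmxr (col_mx X Y) (row_mx a b) = mulmxr (col_mx X Y) (row_mx 0 0).
  by rewrite /= !mul_row_col !mul0mx addr0 e.
apply/negP => /eqP e0; pose W := y *: X - z *: Y.
have dYX : dot g Y X = z.
  rewrite /z /dot; transitivity ((Y *m g *m X^T)^T 0 0); first by rewrite [RHS]mxE.
  by rewrite !trmx_mul trmxK g_sym mulmxA.
have WW : dot g W W = y * (x * y - z ^+ 2).
  have E (a b c d : R) u v s t : dot g (a *: u + b *: v) (c *: s + d *: t) =
      a * c * dot g u s + a * d * dot g u t + b * c * dot g v s + b * d * dot g v t.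
    rewrite /dot linearD !linearZ /= !(mulmxDl, mulmxDr) -!scalemxAl -!scalemxAr.
    move: (u *m g *m s^T) (u *m g *m t^T) (v *m g *m s^T) (v *m g *m t^T) => p q r w.
    by rewrite !mxE; ring.
  by rewrite /W -scaleNr E dYX -/x -/y -/z; ring.
have W0 : W = 0.
  by apply/eqP/negPn/negP => /g_pos; rewrite WW e0 mulr0 ltxx.
have [/(congr1 (fun M : 'M[R]_1 => M 0 0))] : (y%:M : 'M[R]_1) = 0 /\ (- z)%:M = 0 :> 'M[R]_1.
  by apply: lin; rewrite !mul_scalar_mx scaleNr.
rewrite !mxE eqxx mulr1n => y0 _.
have Y0 : Y = 0 by apply/eqP/negPn/negP => /g_pos; rewrite -/y y0 ltxx.
have [_ /(congr1 (fun M : 'M[R]_1 => M 0 0))] : (0 : 'M[R]_1) = 0 /\ (1%:M : 'M[R]_1) = 0.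
  by apply: lin; rewrite mul0mx add0r Y0 mulmx0.
by rewrite !mxE eqxx => /eqP; rewrite oner_eq0.
Qed.

Lemma posdef_unit : g \in unitmx.
Proof.
rewrite -row_free_unit; apply: inj_row_free => v vg.
by apply/eqP/negPn/negP => /g_pos; rewrite /dot vg mul0mx mxE ltxx.
Qed.

End gram.

Section space_form.
Context {R : realType} {n : nat} {O : set 'rV[R]_n}.
Variables (C : smooth_model O) (G : 'rV[R]_n -> 'M[R]_n) (c : R).
Hypothesis oO : open O.
Hypothesis sG : smooth_mx O G.
Hypothesis Gsym : forall z, O z -> (G z)^T = G z.
Hypothesis Gpos : forall z v, O z -> v != 0 -> 0 < dot (G z) v v.
Hypothesis Gsect : forall z X Y, O z -> row_free (col_mx X Y) -> sectional G X Y z = c.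

Let Gunit z : O z -> G z \in unitmx.
Proof. by move=> Oz; apply: posdef_unit => v; exact: Gpos. Qed.

Lemma curvature_space_form i j l z : O z ->
  curvature G i j l z = c *: (G z j l *: delta_mx 0 i - G z i l *: delta_mx 0 j).
Proof.
(* An opaque name for the curvature, which unification cannot unfold. *)
move=> Oz; have [K KE] : exists K, curvature G = K by exists (curvature G).
have K12 p q r : K q p r z = - K p q r z by rewrite -KE; exact: curvature_skew12.
have Kcyc p q r : K p q r z + K q r p z + K r p q z = 0.
  by rewrite -KE; exact: (curvature_bianchi C oO sG Gsym Gunit (erefl _)).
have K34 p q : (\matrix_r K p q r z) *m G z + G z *m (\matrix_r K p q r z)^T = 0.
  by rewrite -KE; exact: (curvature_skew34 C oO sG Gsym Gunit (erefl _) p q Oz).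
have Kvec X Y Z : curvature_vec G X Y Z z =
    \sum_p \sum_q \sum_r (X 0 p * Y 0 q * Z 0 r) *: K p q r z by rewrite -KE.
rewrite KE; pose Om p q := \matrix_r K p q r z.
have s12 p q : Om q p = - Om p q.
  by apply/row_matrixP => r; rewrite raddfN /= !rowK K12.
have cyc p q r : row r (Om p q) + row p (Om q r) + row q (Om r p) = 0.
  by rewrite !rowK Kcyc.
have sect X Y : row_free (col_mx X Y) -> dot (G z) (Y *m curv2 Om X Y) X =
    c * (dot (G z) X X * dot (G z) Y Y - dot (G z) X Y ^+ 2).
  move=> f; rewrite -(Gsect Oz f) /sectional divfK; last first.
    by apply: gram_neq0 => // [|v]; [exact: Gsym|exact: Gpos].
  congr (dot _ _ _); rewrite Kvec mulmx_sumr; apply: eq_bigr => p _.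
  rewrite mulmx_sumr; apply: eq_bigr => q _; rewrite -scalemxAr mulmx_sum_row scaler_sumr.
  by apply: eq_bigr => r _; rewrite scalerA rowK.
have := constant_curvature_row (Gsym Oz) (fun v => @Gpos z v Oz) s12 K34 cyc sect i j l.
by rewrite rowK.
Qed.

Lemma curv_ring_space_form i j :
  curv (sm_d C) (christoffel_ring C (christoffel G)) i j
  = sm_lift C (fun=> c) *: ((row j (metric_ring C G))^T *m row i 1%:M
        - (row i (metric_ring C G))^T *m row j 1%:M).
Proof.
apply: ev_mxP => z Oz; rewrite (ev_curv C oO sG Gunit (erefl _)).
apply/row_matrixP => l; rewrite rowK curvature_space_form //.
have sc : smooth_on O (fun=> c) by move=> k; exact: Ck_cst.
rewrite ev_mxZ sm_liftE // ev_mxD ev_mxN !ev_mxM !ev_mxT !ev_mx_row ev_mx1 ev_metric //.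
by apply/rowP => s; rewrite !row1 !mxE !big_ord1 !mxE.
Qed.

End space_form.

(** * Pullback connections and the product with a line *)

Section pullback_connection.
Context {B C : comPzRingType} {m n : nat}.
Variables (e : 'I_n -> {additive B -> B}) (d : 'I_m -> {additive C -> C}).
Variables (phi : {rmorphism B -> C}) (J : 'M[C]_(m, n)).
Hypothesis dM : forall i a b, d i (a * b) = d i a * b + a * d i b.
Hypothesis chain : forall i b, d i (phi b) = \sum_p J i p * phi (e p b).
Hypothesis dJ : forall i l p, d i (J l p) = d l (J i p).
Variable Gam : 'I_n -> 'M[B]_n.

Definition pullback_conn i : 'M[C]_n := \sum_p J i p *: map_mx phi (Gam p).
Local Notation om := pullback_conn.

Lemma d_map p q i (X : 'M[B]_(p, q)) :
  map_mx (d i) (map_mx phi X) = \sum_s J i s *: map_mx phi (map_mx (e s) X).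
Proof.
apply/matrixP => a b; rewrite !mxE chain summxE.
by apply: eq_bigr => s _; rewrite !mxE.
Qed.

Lemma pullback_metric (G : 'M[B]_n) i :
  (forall p, map_mx (e p) G = Gam p *m G + G *m (Gam p)^T) ->
  map_mx (d i) (map_mx phi G) = om i *m map_mx phi G + map_mx phi G *m (om i)^T.
Proof.
move=> eG; rewrite d_map /om mulmx_suml linear_sum mulmx_sumr -big_split.
apply: eq_bigr => p _ /=; rewrite eG map_mxD !map_mxM -map_trmx.
by rewrite linearZ /= -scalemxAl -scalemxAr scalerDr.
Qed.

Lemma pullback_torsion i j : (forall p q, row q (Gam p) = row p (Gam q)) ->
  row j (cov d om i J) = row i (cov d om j J).
Proof.
move=> sym; rewrite !covE; apply/rowP => s; rewrite !mxE dJ; congr (_ + _).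
under eq_bigr => q _ do rewrite summxE mulr_sumr.
under [RHS]eq_bigr => q _ do rewrite summxE mulr_sumr.
rewrite exchange_big; apply: eq_bigr => p _; apply: eq_bigr => q _.
have /rowP/(_ s) := sym p q; rewrite !mxE => ->; ring.
Qed.

(** Curvature is natural under pullback: the terms in which [J] is differentiated are symmetric in i
    and l by [dJ] and cancel. *)
Lemma pullback_curv i l : curv d om i l =
  \sum_p \sum_q (J i p * J l q) *: map_mx phi (curv e Gam p q).
Proof.
have dom a b : map_mx (d a) (om b) =
    \sum_q d a (J b q) *: map_mx phi (Gam q)
    + \sum_p \sum_q (J a p * J b q) *: map_mx phi (map_mx (e p) (Gam q)).
  rewrite /om raddf_sum exchange_big -big_split; apply: eq_bigr => q _ /=.
  have -> : map_mx (d a) (J b q *: map_mx phi (Gam q)) =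
     d a (J b q) *: map_mx phi (Gam q) + J b q *: map_mx (d a) (map_mx phi (Gam q)).
    by apply/matrixP => x y; rewrite !mxE dM.
  rewrite d_map scaler_sumr; congr (_ + _); apply: eq_bigr => p _.
  by rewrite scalerA mulrC.
have omM a b : om a *m om b = \sum_p \sum_q (J a p * J b q) *: (map_mx phi (Gam p) *m map_mx phi (Gam q)).
  rewrite /om mulmx_suml; apply: eq_bigr => p _; rewrite mulmx_sumr.
  by apply: eq_bigr => q _; rewrite -scalemxAl -scalemxAr scalerA.
rewrite curvE !dom !omM.
under eq_bigr do rewrite dJ.
rewrite [X in _ - (_ + X) + _ - _]exchange_big [X in _ + X - _]exchange_big /=.
set S := \sum_q d l (J i q) *: _.
rewrite opprD addrACA subrr add0r -!sumrN -!big_split /=; apply: eq_bigr => p _.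
rewrite -!sumrN -!big_split /=; apply: eq_bigr => q _.
rewrite curvE !(map_mxB, map_mxD, map_mxM) /= !scalerDr !scalerN.
by rewrite [J l q * _]mulrC.
Qed.

Lemma pullback_curv_space_form (c : B) (G : 'M[B]_n) (W : 'rV[C]_n) i l :
  G^T = G ->
  (forall p q, curv e Gam p q = c *: ((row q G)^T *m row p 1%:M - (row p G)^T *m row q 1%:M)) ->
  W *m curv d om i l = phi c *: ((W *m map_mx phi G *m (row l J)^T) 0 0 *: row i J
     - (W *m map_mx phi G *m (row i J)^T) 0 0 *: row l J).
Proof.
move=> Gsym cE; rewrite pullback_curv.
have rowG p : map_mx phi (row p G)^T = map_mx phi G *m (row p 1%:M)^T.
  by rewrite tr_row Gsym row1 trmx_delta -colE map_col.
have sc (v : 'rV[C]_n) (u : 'cV[C]_n) (r : 'rV[C]_n) : v *m (u *m r) = (v *m u) 0 0 *: r.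
  by rewrite mulmxA [X in X *m r]mx11_scalar mul_scalar_mx.
have E p q : W *m map_mx phi (curv e Gam p q) =
    phi c *: ((W *m map_mx phi G *m (row q 1%:M)^T) 0 0 *: row p 1%:M
      - (W *m map_mx phi G *m (row p 1%:M)^T) 0 0 *: row q 1%:M).
  rewrite cE map_mxZ map_mxB !map_mxM /= !rowG !map_row !map_mx1.
  by rewrite -scalemxAr mulmxBr !sc !mulmxA.
have rJ q : row q J = \sum_p J q p *: row p 1%:M.
  by rewrite [LHS]row_sum_delta; apply: eq_bigr => p _; rewrite row1 mxE.
have dJW q : (W *m map_mx phi G *m (row q J)^T) 0 0
    = \sum_p J q p * (W *m map_mx phi G *m (row p 1%:M)^T) 0 0.
  rewrite {1}rJ linear_sum mulmx_sumr summxE; apply: eq_bigr => p _.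
  by rewrite linearZ -scalemxAr mxE.
rewrite mulmx_sumr; under eq_bigr do rewrite mulmx_sumr.
under eq_bigr => p _ do under eq_bigr => q _ do
  rewrite -scalemxAr E scalerA [_ * phi c]mulrC -scalerA scalerBr !scalerA.
under eq_bigr => p _ do rewrite -scaler_sumr.
rewrite -scaler_sumr; congr (_ *: _).
under eq_bigr => p _ do rewrite sumrB.
rewrite sumrB; congr (_ - _); rewrite !dJW scaler_suml.
  rewrite exchange_big; apply: eq_bigr => q _; rewrite rJ scaler_sumr.
  by apply: eq_bigr => p _; rewrite scalerA; congr (_ *: _); ring.
apply: eq_bigr => p _; rewrite rJ scaler_sumr.
by apply: eq_bigr => q _; rewrite scalerA; congr (_ *: _); ring.
Qed.

End pullback_connection.

(** * The Riemannian product with a line *)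

Section line_product.
Context {C : comPzRingType} {m n : nat}.
Variable d : 'I_m -> {additive C -> C}.
Hypothesis dM : forall i a b, d i (a * b) = d i a * b + a * d i b.
Variables (om : 'I_m -> 'M[C]_n) (G : 'M[C]_n) (J1 : 'M[C]_(m, n)) (J2 : 'M[C]_(m, 1)).
Variable c : C.
Hypothesis dG : forall i, map_mx (d i) G = om i *m G + G *m (om i)^T.
Hypothesis Gsym : G^T = G.
Hypothesis torsion1 : forall i j, row j (cov d om i J1) = row i (cov d om j J1).
Hypothesis torsion2 : forall i j, row j (map_mx (d i) J2) = row i (map_mx (d j) J2).
Hypothesis curv1 : forall (W : 'rV[C]_n) i l, W *m curv d om i l =
  c *: ((W *m G *m (row l J1)^T) 0 0 *: row i J1 - (W *m G *m (row i J1)^T) 0 0 *: row l J1).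

Definition prod_conn i : 'M[C]_(n + 1) := block_mx (om i) 0 0 0.
Definition prod_metric_mx : 'M[C]_(n + 1) := block_mx G 0 0 1%:M.
Local Notation om' := prod_conn.
Local Notation G' := prod_metric_mx.
Let J : 'M[C]_(m, n + 1) := row_mx J1 J2.
Let xi : 'rV[C]_(n + 1) := row_mx 0 1%:M.

Lemma prod_metric_mx_sym : G'^T = G'.
Proof. by rewrite /prod_metric_mx tr_block_mx Gsym !trmx0 trmx1. Qed.

Lemma prod_conn_metric i : map_mx (d i) G' = om' i *m G' + G' *m (om' i)^T.
Proof.
rewrite /prod_metric_mx /prod_conn map_block_mx !map_mx0 (dmx1 dM) tr_block_mx.
rewrite !mulmx_block !trmx0 add_block_mx dG.
by rewrite !(mul0mx, mulmx0, addr0).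
Qed.

Lemma cov_prod i p (X : 'M[C]_(p, n)) (Y : 'M[C]_(p, 1)) :
  cov d om' i (row_mx X Y) = row_mx (cov d om i X) (map_mx (d i) Y).
Proof.
rewrite !covE map_row_mx /prod_conn mul_row_block !(mulmx0, addr0) add_row_mx.
by rewrite addr0.
Qed.

Lemma prod_torsion i j : row j (cov d om' i J) = row i (cov d om' j J).
Proof. by rewrite !cov_prod !row_row_mx torsion1 torsion2. Qed.

Lemma vertical_parallel i : cov d om' i xi = 0.
Proof. by rewrite cov_prod (dmx1 dM) covE map_mx0 mul0mx addr0 row_mx0. Qed.

Lemma curv_prod i l : curv d om' i l = block_mx (curv d om i l) 0 0 0.
Proof.
rewrite !curvE /prod_conn !map_block_mx !map_mx0 !mulmx_block.
by rewrite !(opp_block_mx, add_block_mx, mul0mx, mulmx0, addr0, subrr).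
Qed.

(** The curvature sees only horizontal parts: <Y,W> - <Y,xi><W,xi> multiplies X - <X,xi>xi. After
    antisymmetrizing in X and Y, the terms with three xi-components cancel. *)
Lemma prod_curv (W : 'rV[C]_(n + 1)) i l (t := xi *m G' *m J^T) :
  W *m curv d om' i l = c *:
  ((W *m G' *m (row l J)^T) 0 0 *: row i J - (W *m G' *m (row i J)^T) 0 0 *: row l J
   + (W *m G' *m xi^T) 0 0 *: (t 0 i *: row l J - t 0 l *: row i J)
   + (t 0 l * (W *m G' *m (row i J)^T) 0 0 - t 0 i * (W *m G' *m (row l J)^T) 0 0) *: xi).
Proof.
have tE q : t 0 q = J2 q 0.
  rewrite /t /xi /J /prod_metric_mx tr_row_mx mul_row_block !(mul0mx, mulmx0, add0r, addr0).
  by rewrite mul_row_col mul0mx add0r !mul1mx mxE.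
rewrite -[W]hsubmxK; set W1 := lsubmx W; set W2 := rsubmx W.
have e q : (row_mx W1 W2 *m G' *m (row q J)^T) 0 0
    = (W1 *m G *m (row q J1)^T) 0 0 + W2 0 0 * J2 q 0.
  rewrite /J row_row_mx tr_row_mx mul_row_block !(mulmx0, addr0, add0r) mul_row_col mulmx1.
  by rewrite mxE [(W2 *m _) _ _]mxE big_ord1 !mxE.
have ex : (row_mx W1 W2 *m G' *m xi^T) 0 0 = W2 0 0.
  rewrite /xi tr_row_mx mul_row_block !(mulmx0, addr0, add0r) mul_row_col mulmx1.
  by rewrite trmx0 trmx1 mulmx0 add0r mulmx1.
rewrite !e ex !tE curv_prod mul_row_block !(mulmx0, addr0) curv1 /J !row_row_mx /xi.
rewrite !(scale_row_mx, opp_row_mx, add_row_mx); congr row_mx.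
  move: (_ 0 0) ((W1 *m G *m (row i J1)^T) 0 0) => x y.
  by apply/rowP => s; rewrite !mxE; ring.
move: (_ 0 0) ((W1 *m G *m (row i J1)^T) 0 0) => x y.
by apply/rowP => s; rewrite ord1 !mxE eqxx [true%:R]/=; ring.
Qed.

End line_product.

(** * Immersions in charts *)

Section immersion_values.
Context {R : realType} {m k : nat} {D : set 'rV[R]_m}.
Variables (C : smooth_model D) (G : 'rV[R]_k -> 'M[R]_k) (F : 'rV[R]_m -> 'rV[R]_k).
Variables (GC : 'M[C]_k) (J : 'M[C]_(m, k)) (gi : 'M[C]_m) (om : 'I_m -> 'M[C]_k).
Local Notation d := (sm_d C).
Hypothesis evG : forall y (Dy : D y), ev_mx Dy GC = G (F y).
Hypothesis evJ : forall y (Dy : D y), ev_mx Dy J = jac F y.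
Hypothesis evom : forall y (Dy : D y) j q,
  \sum_p jac F y j p *: christoffel G p q (F y) = row q (ev_mx Dy (om j)).
Hypothesis Gsym : GC^T = GC.
Hypothesis dG : forall i, map_mx (d i) GC = om i *m GC + GC *m (om i)^T.
Hypothesis torsion : forall i j, row j (cov d om i J) = row i (cov d om j J).
Hypothesis giK : gi *m (J *m GC *m J^T) = 1%:M.
Hypothesis gKi : J *m GC *m J^T *m gi = 1%:M.

Let dM := @sm_dM _ _ _ C.

Lemma ev_induced y (Dy : D y) : ev_mx Dy (J *m GC *m J^T) = induced_metric G F y.
Proof. by rewrite !ev_mxM ev_mxT evG evJ. Qed.

Lemma ev_induced_inv y (Dy : D y) : ev_mx Dy gi = invmx (induced_metric G F y).
Proof. by rewrite (ev_mx_inv Dy giK) ev_induced. Qed.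

Lemma ev_nabla_bar (W : 'rV[R]_m -> 'rV[R]_k) (Wc : 'rV[C]_k) j y (Dy : D y) :
  (forall z (Dz : D z), W z = ev_mx Dz Wc) ->
  nabla_bar G F j W y = ev_mx Dy (cov d om j Wc).
Proof.
move=> WE; have := evom Dy j; rewrite /nabla_bar.
move: (christoffel G) => K KE.
rewrite covE ev_mxD ev_mxM; congr (_ + _).
  by apply/rowP => b; rewrite (ev_mx_d _ _ _ _ WE) mxE.
rewrite exchange_big [ev_mx Dy Wc *m _]mulmx_sum_row -(WE y Dy).
apply: eq_bigr => q _; rewrite -KE scaler_sumr.
by apply: eq_bigr => p _; rewrite scalerA mulrC.
Qed.

Lemma ev_tangential (w : 'rV[C]_k) y (Dy : D y) :
  tangential G F (ev_mx Dy w) y = ev_mx Dy (w *m tang GC J gi).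
Proof. by rewrite tangE !ev_mxM ev_mxT evG evJ ev_induced_inv /tangential !mulmxA. Qed.

Lemma ev_nor (w : 'rV[C]_k) y (Dy : D y) :
  nor G F (ev_mx Dy w) y = ev_mx Dy (w - w *m tang GC J gi *m J).
Proof. by rewrite /nor ev_tangential ev_mxD ev_mxN [ev_mx Dy (_ *m J)]ev_mxM evJ. Qed.

Lemma ev_shape_op (W : 'rV[R]_m -> 'rV[R]_k) (Wc : 'rV[C]_k) y (Dy : D y) :
  (forall z (Dz : D z), W z = ev_mx Dz Wc) ->
  shape_op G F W y = ev_mx Dy (shape d om GC J gi Wc).
Proof.
move=> WE; apply/row_matrixP => j; rewrite rowK -ev_mx_row row_shape.
by rewrite (ev_nabla_bar j Dy WE) ev_tangential ev_mxN.
Qed.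

(** By [koszul] the bracket of metric derivatives is twice the lowered induced connection; [gi]
    raises the index again. *)
Lemma ev_christoffel_induced i j y (Dy : D y) :
  christoffel (induced_metric G F) i j y = row j (ev_mx Dy (lc d om GC J gi i)).
Proof.
have E p q l : pder p (fun z => induced_metric G F z q l) y
    = sm_ev C Dy (d p ((J *m GC *m J^T) q l)).
  by apply: esym; apply: sm_dE => z Dz; rewrite -ev_induced ev_mxE.
rewrite /christoffel -(ev_induced_inv Dy).
rewrite (_ : \row_l _ = (2 *: row j (ev_mx Dy (lc d om GC J gi i *m (J *m GC *m J^T))))).
  rewrite -scalemxAl scalerA mulVf ?pnatr_eq0 // scale1r -row_mul -ev_mxM.
  by rewrite -[_ *m _ *m gi]mulmxA gKi mulmx1.
apply/rowP => l; rewrite mxE !E -rmorphD -rmorphB.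
rewrite (koszul _ _ _ (induced_sym J Gsym) (lc_metric dM Gsym dG giK) (fun p q => lc_sym GC gi torsion q p)).
by rewrite rmorphMn [RHS]mxE [(row j _) _ _]mxE ev_mxE mulr_natl.
Qed.

Lemma ev_second_fundamental i j y (Dy : D y) :
  second_fundamental G F i j y = ev_mx Dy (row j (sff d om GC J gi i)).
Proof.
rewrite /second_fundamental (ev_nabla_bar i (Wc := row j J) Dy); last first.
  by move=> z Dz; rewrite ev_mx_row evJ.
by rewrite ev_nor -row_cov sffE lcE raddfB /= !row_mul.
Qed.

(** Converts the tr A_N of [simons]: both sides contract <sff,N> with the inverse metric, and m > 0
    cancels the factor 1/m in H. *)
Lemma dot_mean_curvature (N : 'rV[C]_k) y (Dy : D y) : (0 < m)%N ->
  N *m GC *m J^T = 0 ->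
  m%:R * dot (G (F y)) (mean_curvature G F y) (ev_mx Dy N)
  = \tr (ev_mx Dy (shape d om GC J gi N)).
Proof.
move=> m0 N0; rewrite /mean_curvature /dot -(evG Dy).
rewrite -!scalemxAl mxE mulrA divff ?pnatr_eq0 -?lt0n // mul1r.
have -> : shape d om GC J gi N = shape d om GC J gi N *m (J *m GC *m J^T) *m gi.
  by rewrite -mulmxA gKi mulmx1.
rewrite ev_mxM mxtrace_mulC mxtrace2 !mulmx_suml summxE ev_induced_inv.
apply: eq_bigr => i _; rewrite !mulmx_suml summxE; apply: eq_bigr => j _.
rewrite -!scalemxAl mxE; congr (_ * _).
rewrite (ev_second_fundamental _ _ Dy) -ev_mxM -ev_mxT -ev_mxM.
have S := shape_sym dM dG torsion giK N0.
rewrite -S ev_mxT [RHS]mxE.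
have /rowP/(_ j) := shape_lower dM dG giK i N0.
rewrite [LHS]mxE ev_mxE => ->.
rewrite ev_mxE; congr (sm_ev C Dy _).
transitivity ((row j (sff d om GC J gi i) *m GC *m N^T)^T 0 0).
  by rewrite [RHS]mxE.
rewrite !trmx_mul trmxK Gsym mulmxA [LHS]mxE [RHS]mxE.
by apply: eq_bigr => q _; rewrite [X in _ * X]mxE [X in _ * X]mxE [X in _ = _ * X]mxE.
Qed.

Lemma ev_laplacian (u : 'rV[R]_m -> R) (uc : C) y (Dy : D y) :
  (forall z (Dz : D z), u z = sm_ev C Dz uc) ->
  laplacian (induced_metric G F) u y = sm_ev C Dy (\sum_i \sum_j gi i j *
    (d i (d j uc) - \sum_l lc d om GC J gi i j l * d l uc)).
Proof.
move=> uE; have := fun i j => ev_christoffel_induced i j Dy.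
rewrite /laplacian /hessian; move: (christoffel _) => K KE.
have du j z (Dz : D z) : pder j u z = sm_ev C Dz (d j uc).
  by apply: esym; apply: sm_dE.
rewrite mxtrace2 rmorph_sum; apply: eq_bigr => i _.
rewrite rmorph_sum; apply: eq_bigr => j _.
rewrite -(ev_induced_inv Dy) ev_mxE rmorphM; congr (_ * _).
rewrite mxE rmorphB rmorph_sum.
have -> : pder j (pder i u) y = sm_ev C Dy (d j (d i uc)).
  by apply: esym; apply: sm_dE => z Dz; exact: du.
(* The trace pairs the entry i, j of [gi] with the entry j, i of the Hessian, so derivatives and
   symbols are put back in order by their symmetry. *)
rewrite sm_dC; congr (_ - _); apply: eq_bigr => l _.
rewrite KE (du l y Dy) rmorphM mxE ev_mxE.
have /rowP/(_ l) := lc_sym GC gi torsion i j; rewrite !mxE => ->.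
by [].
Qed.

Lemma ev_nabla_end (A : 'rV[R]_m -> 'M[R]_m) (Ac : 'M[C]_m) i y (Dy : D y) :
  (forall z (Dz : D z), A z = ev_mx Dz Ac) ->
  nabla_end (induced_metric G F) A i y = ev_mx Dy (nab d (lc d om GC J gi) i Ac).
Proof.
move=> AE; have := fun i j => ev_christoffel_induced i j Dy.
rewrite /nabla_end; move: (christoffel _) => K KE.
rewrite nabE !(ev_mxD, ev_mxN) ![ev_mx Dy (_ *m _)]ev_mxM -(AE y Dy).
apply/matrixP => j l; rewrite mxE !(addmxE, oppmxE) (ev_mx_d _ _ _ _ AE).
congr (_ + _ - _); rewrite mxE; apply: eq_bigr => q _.
  by rewrite KE mxE.
by rewrite KE mxE.
Qed.

(** The adjoint in [dot_end] disappears because nabla A inherits self-adjointness from A. *)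
Lemma ev_normsq_nabla_end (A : 'rV[R]_m -> 'M[R]_m) (Ac : 'M[C]_m) y (Dy : D y) :
  (forall z (Dz : D z), A z = ev_mx Dz Ac) ->
  Ac *m (J *m GC *m J^T) = J *m GC *m J^T *m Ac^T ->
  normsq_nabla_end (induced_metric G F) A y = sm_ev C Dy (\sum_i \sum_j gi i j *
    \tr (nab d (lc d om GC J gi) i Ac *m nab d (lc d om GC J gi) j Ac)).
Proof.
move=> AE A_sym; rewrite /normsq_nabla_end rmorph_sum; apply: eq_bigr => i _.
rewrite rmorph_sum; apply: eq_bigr => j _; rewrite rmorphM -(ev_induced_inv Dy) ev_mxE.
congr (_ * _); rewrite !(ev_nabla_end _ Dy AE) /dot_end -(ev_induced_inv Dy) -(ev_induced Dy).
set X := nab _ _ i Ac; set Y := nab _ _ j Ac.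
rewrite -ev_mxT -!ev_mxM -[LHS]/(\tr (map_mx _ _)) trace_map_mx; congr (sm_ev C Dy _).
have YS : Y *m (J *m GC *m J^T) = J *m GC *m J^T *m Y^T.
  exact: (nab_selfadj dM (lc_metric dM Gsym dG giK)).
move: gKi YS; move: (J *m GC *m J^T) => g gKi' YS.
by rewrite -[_ *m g *m _]mulmxA -YS !mulmxA mxtrace_mulC !mulmxA gKi' mul1mx.
Qed.

End immersion_values.

(** Stacking [J] and the [e a] gives a matrix B, square because m + r = k. The inverse of B G B^T is
    block diagonal, with blocks [gi] and 1; conjugating it by the invertible B yields Q with G Q G =
    G, which is the claim. *)
Lemma frame_complete (F : fieldType) (m r k : nat) (G : 'M[F]_k) (J : 'M[F]_(m, k))
    (gi : 'M[F]_m) (e : 'I_r -> 'rV[F]_k) :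
  (m + r)%N = k -> G^T = G ->
  gi *m (J *m G *m J^T) = 1%:M -> J *m G *m J^T *m gi = 1%:M ->
  (forall a, e a *m G *m J^T = 0) ->
  (forall a b, (e a *m G *m (e b)^T) 0 0 = (a == b)%:R) ->
  G = G *m J^T *m gi *m J *m G + \sum_a G *m (e a)^T *m e a *m G.
Proof.
move=> mr Gsym giK gKi e0 ee.
pose E : 'M[F]_(r, k) := \matrix_a e a; pose B := col_mx J E.
have EGJ : E *m G *m J^T = 0.
  by apply/row_matrixP => a; rewrite !row_mul rowK e0 row0.
have JGE : J *m G *m E^T = 0.
  by apply: trmx_inj; rewrite !trmx_mul trmxK Gsym mulmxA EGJ trmx0.
have EGE : E *m G *m E^T = 1%:M.
  apply/matrixP => a b; rewrite [RHS]mxE -ee.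
  transitivity ((row a (E *m G) *m (row b E)^T) 0 0); last by rewrite row_mul !rowK.
  rewrite [LHS]mxE [RHS]mxE; apply: eq_bigr => q _.
  by rewrite [_^T _ _]mxE [row _ _ _ _]mxE [(row _ _)^T _ _]mxE [row _ _ _ _]mxE.
have BGB : B *m G *m B^T = block_mx (J *m G *m J^T) 0 0 1%:M.
  by rewrite /B mul_col_mx tr_col_mx mul_col_row EGJ JGE EGE.
have BI : block_mx gi 0 0 1%:M *m (B *m G *m B^T) = 1%:M.
  rewrite BGB mulmx_block !(mul0mx, mulmx0, addr0, add0r) giK mulmx1.
  by rewrite -scalar_mx_block.
have Bfree : row_free B.
  apply: inj_row_free => v vB; rewrite -[v]mulmx1 -(mulmx1C BI) !mulmxA vB !mul0mx.
  by [].
have Bfull : row_full B by rewrite -col_leq_rank (eqP Bfree) mr.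
have [B' BK] := row_fullP Bfull.
pose Q := B^T *m block_mx gi 0 0 1%:M *m B.
have QE : Q = J^T *m gi *m J + \sum_a (e a)^T *m e a.
  rewrite /Q /B tr_col_mx mul_row_block !(mulmx0, addr0, add0r) mulmx1 mul_row_col.
  congr (_ + _); apply/matrixP => p q; rewrite mxE summxE; apply: eq_bigr => a _.
  by rewrite !mxE big_ord1 !mxE.
have GQG : G *m Q *m G = G.
  have H : B *m (G *m Q *m G) *m B^T = B *m G *m B^T.
    have -> : B *m (G *m Q *m G) *m B^T
        = B *m G *m B^T *m (block_mx gi 0 0 1%:M *m (B *m G *m B^T)).
      by rewrite /Q !mulmxA.
    by rewrite BI mulmx1.
  have : B' *m (B *m (G *m Q *m G) *m B^T) *m B'^T = B' *m (B *m G *m B^T) *m B'^T by rewrite H.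
  by rewrite !mulmxA BK mul1mx -!mulmxA -trmx_mul BK trmx1 !mulmx1 !mulmxA.
rewrite -[LHS]GQG QE mulmxDr mulmxDl !mulmxA; congr (_ + _).
rewrite mulmx_sumr mulmx_suml; apply: eq_bigr => a _.
by rewrite !mulmxA.
Qed.

Section christoffel_line_product.
Context {R : realType} {n : nat}.
Variable G1 : 'rV[R]_n -> 'M[R]_n.

Definition line_product_metric (z : 'rV[R]_(n + 1)) : 'M[R]_(n + 1) :=
  block_mx (G1 (lsubmx z)) 0 0 1%:M.
Local Notation G := line_product_metric.

Let pder_cst (i : 'I_(n + 1)) (u : 'rV[R]_(n + 1) -> R) (b : R) z :
  (forall y, u y = b) -> pder i u z = 0.
Proof.
move=> e; have -> : u = cst b by apply/funext.
by rewrite /pder derive_cst.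
Qed.

Let pderG_rl i (p : 'I_1) q z : pder i (fun y => G y (rshift n p) q) z = 0.
Proof.
rewrite -(fintype.splitK q); case: (fintype.split q) => l /=.
  by apply: (pder_cst _ (b := 0)) => y; rewrite /G block_mxEdl mxE.
by apply: (pder_cst _ (b := (1%:M : 'M[R]_1) p l)) => y; rewrite /G block_mxEdr.
Qed.

Let pderG_lr i (p : 'I_n) (q : 'I_1) z : pder i (fun y => G y (lshift 1 p) (rshift n q)) z = 0.
Proof. by apply: (pder_cst _ (b := 0)) => y; rewrite /G block_mxEur mxE. Qed.

Let pderG_r (i : 'I_1) p q z : pder (rshift n i) (fun y => G y p q) z = 0.
Proof.
rewrite -(fintype.splitK p); case: (fintype.split p) => j /=; last exact: pderG_rl.
rewrite -(fintype.splitK q); case: (fintype.split q) => l /=; last exact: pderG_lr.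
rewrite (_ : (fun y => _) = (fun z => G1 z j l) \o lsubmx); last first.
  by apply/funext => y; rewrite /G block_mxEul.
by rewrite pder_lsubmx (fintype.unsplitK (inr i : 'I_n + 'I_1)).
Qed.

(** The metric is block diagonal and independent of the last coordinate, so only the symbols of the
    first factor survive. *)
Lemma christoffel_line_product p q z : G1 (lsubmx z) \in unitmx ->
  christoffel G p q z =
  match fintype.split p, fintype.split q with
  | inl p', inl q' => row_mx (christoffel G1 p' q' (lsubmx z)) 0
  | _, _ => 0
  end.
Proof.
move=> uG; have giG : invmx (G z) = block_mx (invmx (G1 (lsubmx z))) 0 0 1%:M.
  have e : block_mx (invmx (G1 (lsubmx z))) 0 0 1%:M *m G z = 1%:M.
    rewrite /G mulmx_block !(mul0mx, mulmx0, addr0, add0r) mulmx1 mulVmx //.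
    by rewrite -scalar_mx_block.
  have [_ uGz] := mulmx1_unit e.
  by rewrite -[LHS]mul1mx -e mulmxK.
have D0 u (w : 'rV[R]_(n + 1)) : (forall l, w 0 l = 0) -> 2^-1 *: (w *m u) = 0 :> 'rV[R]_(n + 1).
  by move=> w0; rewrite (_ : w = 0) ?mul0mx ?scaler0 //; apply/rowP => l; rewrite w0 mxE.
rewrite /christoffel giG -{1 2 3}(fintype.splitK p) -{1 2 3}(fintype.splitK q).
case: (fintype.split p) => p' /=; last first.
  by apply: (D0) => l; rewrite mxE pderG_r !pderG_rl addr0 subr0.
case: (fintype.split q) => q' /=; last first.
  by apply: (D0) => l; rewrite mxE pderG_r pderG_rl pderG_lr addr0 subr0.
have L (i j l : 'I_n) : pder (lshift 1 i) (fun y => G y (lshift 1 j) (lshift 1 l)) z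
    = pder i (fun y => G1 y j l) (lsubmx z).
  rewrite (_ : (fun y => _) = (fun z => G1 z j l) \o lsubmx); last first.
    by apply/funext => y; rewrite /G block_mxEul.
  by rewrite pder_lsubmx (fintype.unsplitK (inl i : 'I_n + 'I_1)).
rewrite (_ : \row_l _ = row_mx (\row_l (pder p' (fun y => G1 y q' l) (lsubmx z) +
    pder q' (fun y => G1 y p' l) (lsubmx z) - pder l (fun y => G1 y p' q') (lsubmx z))) 0).
  by rewrite mul_row_block !(mul0mx, mulmx0, addr0) scale_row_mx scaler0.
apply/rowP => l; rewrite mxE -(fintype.splitK l); case: (fintype.split l) => l' /=.
  by rewrite row_mxEl mxE !L.
by rewrite row_mxEr mxE !pderG_lr pderG_r addr0 subr0.
Qed.

End christoffel_line_product.

(** * From the ring back to functions: the formula in a chart *)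

Section simons_in_charts.
Context {R : realType} {m k r : nat} {D : set 'rV[R]_m}.
Variables (C : smooth_model D) (G : 'rV[R]_k -> 'M[R]_k) (F : 'rV[R]_m -> 'rV[R]_k).
Variables (GC : 'M[C]_k) (J : 'M[C]_(m, k)) (om : 'I_m -> 'M[C]_k).
Local Notation d := (sm_d C).
Hypothesis oD : open D.
Hypothesis evG : forall y (Dy : D y), ev_mx Dy GC = G (F y).
Hypothesis evJ : forall y (Dy : D y), ev_mx Dy J = jac F y.
Hypothesis evom : forall y (Dy : D y) j q,
  \sum_p jac F y j p *: christoffel G p q (F y) = row q (ev_mx Dy (om j)).
Hypothesis Gsym : GC^T = GC.
Hypothesis dG : forall i, map_mx (d i) GC = om i *m GC + GC *m (om i)^T.
Hypothesis torsion : forall i j, row j (cov d om i J) = row i (cov d om j J).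
Hypothesis g_unit : forall y, D y -> induced_metric G F y \in unitmx.
Variables (xi : 'rV[C]_k) (c : R).
Hypothesis xi_parallel : forall i, cov d om i xi = 0.
Let t := xi *m GC *m J^T.
Hypothesis ambient_curv : forall (W : 'rV[C]_k) i l,
  W *m curv d om i l = sm_lift C (fun=> c) *:
  ((W *m GC *m (row l J)^T) 0 0 *: row i J - (W *m GC *m (row i J)^T) 0 0 *: row l J
   + (W *m GC *m xi^T) 0 0 *: (t 0 i *: row l J - t 0 l *: row i J)
   + (t 0 l * (W *m GC *m (row i J)^T) 0 0
      - t 0 i * (W *m GC *m (row l J)^T) 0 0) *: xi).
Variables (V : 'rV[R]_m -> 'rV[R]_k) (b : R).
Hypothesis sV : smooth_rV D V.
Hypothesis V_normal : forall y, D y -> V y *m G (F y) *m (jac F y)^T = 0.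
Hypothesis V_parallel : forall y j, D y -> nabla_perp G F j V y = 0.
Hypothesis V_trace : forall y, D y -> \tr (shape_op G F V y) = b.
Variable E : 'I_r -> 'rV[R]_m -> 'rV[R]_k.
Hypothesis sE : forall a, smooth_rV D (E a).
Hypothesis E_normal : forall a y, D y -> E a y *m G (F y) *m (jac F y)^T = 0.
Hypothesis E_orthonormal : forall a a' y, D y ->
  dot (G (F y)) (E a y) (E a' y) = (a == a')%:R.
Hypothesis m_gt0 : (0 < m)%N.
Hypothesis mrk : (m + r)%N = k.
Variable xiF : 'rV[R]_m -> 'rV[R]_k.
Hypothesis ev_xi : forall y (Dy : D y), xiF y = ev_mx Dy xi.

Let dM := @sm_dM _ _ _ C.
Let dC := @sm_dC _ _ _ C.

Let lift_row (W : 'rV[R]_m -> 'rV[R]_k) : smooth_rV D W ->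
  forall y (Dy : D y), W y = ev_mx Dy (lift_mx C W).
Proof. by move=> sW y Dy; rewrite ev_lift_mx // => i j; rewrite ord1; exact: sW. Qed.

Lemma simons_in_chart x : D x ->
  let g := induced_metric G F in
  let AV := shape_op G F V in
  let AE a := shape_op G F (E a) in
  let AN := shape_op G F (fun y => nor G F (xiF y) y) in
  let T := tangential G F (xiF x) x in
  let N := nor G F (xiF x) x in
  let H := mean_curvature G F x in
  let v := V x in
  let AVT := T *m AV x in
  let tdot := dot (g x) in
  let ndot := dot (G (F x)) in
  2^-1 * laplacian g (fun y => \tr (AV y *m AV y)) x
  = normsq_nabla_end g AV x
    + c * ((m%:R - tdot T T) * \tr (AV x *m AV x)
           - 2 * m%:R * tdot AVT AVT
           + 3 * \tr (AV x) * tdot AVT T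
           + m%:R * \tr (AN x *m AV x) * ndot v N
           - \tr (AV x) ^+ 2
           - m%:R * \tr (AV x) * ndot H N * ndot v N)
    + \sum_a (\tr (AE a x) * \tr (AV x *m AV x *m AE a x)
                  - \tr (AV x *m AE a x) ^+ 2).
Proof.
move=> Dx; have [y Dy|gi giK gKi] := @sm_mx_inv _ _ _ C _ (J *m GC *m J^T) oD.
  by rewrite (ev_induced evG evJ); exact: g_unit.
pose Vc := lift_mx C V; have VE := lift_row sV.
pose Ec a := lift_mx C (E a); have EE a := lift_row (sE a).
pose P := tang GC J gi.
have norE y (Dy : D y) W Wc : W = ev_mx Dy Wc -> nor G F W y = ev_mx Dy (Wc - Wc *m P *m J).
  by move=> ->; exact: (ev_nor evG evJ giK).
have Vc_normal : Vc *m GC *m J^T = 0.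
  apply: ev_mxP => y Dy; rewrite !ev_mxM ev_mxT evG evJ -VE ev_mx0; exact: V_normal.
have Ec_normal a : Ec a *m GC *m J^T = 0.
  apply: ev_mxP => y Dy; rewrite !ev_mxM ev_mxT evG evJ -EE ev_mx0; exact: E_normal.
have Vc_parallel i : cov d om i Vc = cov d om i Vc *m P *m J.
  apply/eqP; rewrite -subr_eq0; apply/eqP/ev_mxP => y Dy.
  rewrite -(norE y Dy _ _ (erefl _)) -(ev_nabla_bar evom i Dy VE) ev_mx0.
  exact: V_parallel.
pose sh W := shape d om GC J gi W.
have shE := fun W Wc y Dy e => @ev_shape_op _ _ _ _ _ _ _ _ _ _ _ evG evJ evom giK W Wc y Dy e.
have trE y (Dy : D y) (X : 'M[C]_m) : \tr (ev_mx Dy X) = sm_ev C Dy (\tr X).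
  by rewrite /ev_mx trace_map_mx.
have Vc_trace i : d i (\tr (sh Vc)) = 0.
  apply: sm_inj => y Dy; rewrite rmorph0 (@sm_dE _ _ _ C i (fun=> b)).
    by rewrite /pder derive_cst.
  by move=> z Dz; rewrite -trE -(shE _ _ _ Dz VE) V_trace.
(* Checked at each point, where the entries lie in a field and ranks can be counted. *)
have Ec_frame : GC = P *m J *m GC + \sum_a GC *m (Ec a)^T *m Ec a *m GC.
  apply: ev_mxP => y Dy; rewrite ev_mxD ev_mx_sum /P tangE !ev_mxM ev_mxT evG evJ.
  rewrite (ev_induced_inv evG evJ giK).
  under eq_bigr => a _ do rewrite !ev_mxM ev_mxT evG -EE.
  apply: frame_complete => //; first by rewrite -(evG Dy) -ev_mxT Gsym.
  - exact/mulVmx/g_unit.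
  - exact/mulmxV/g_unit.
  - by move=> a; exact: E_normal.
  - by move=> a a'; exact: E_orthonormal.
have dc i : d i (sm_lift C (fun=> c)) = 0.
  apply: sm_inj => y Dy; rewrite rmorph0 (@sm_dE _ _ _ C i (fun=> c)).
    by rewrite /pder derive_cst.
  by move=> z Dz; rewrite sm_liftE // => s; exact: Ck_cst.
have S := simons dM dC Gsym dG torsion (erefl _) giK gKi xi_parallel (erefl t)
  (erefl (xi *m P)) dc ambient_curv Vc_normal Vc_parallel Vc_trace Ec_normal Ec_frame.
cbv zeta.
pose Nc := xi - xi *m P *m J.
have Nc_normal : Nc *m GC *m J^T = 0 by exact: (nor_normal giK).
have NE y (Dy : D y) : nor G F (xiF y) y = ev_mx Dy Nc by apply: norE; exact: ev_xi.
(* [V] is normal, so <V,N> = <V,xi>, the form in which [simons] has it. *)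
have uE : (Vc *m GC *m Nc^T) 0 0 = (Vc *m GC *m xi^T) 0 0.
  rewrite /Nc raddfB /= mulmxBr trmx_mul [Vc *m GC *m (J^T *m _)]mulmxA Vc_normal.
  by rewrite mul0mx subr0.
have AVE y (Dy : D y) := shE _ _ y Dy VE.
have AEE a := shE _ _ x Dx (EE a).
have ANE := shE _ _ x Dx NE.
have TE : tangential G F (xiF x) x = ev_mx Dx (xi *m P).
  by rewrite (ev_xi Dx); exact: (ev_tangential evG evJ giK).
have HN := dot_mean_curvature evG evJ evom Gsym dG torsion giK gKi Dx m_gt0 Nc_normal.
have trAA y (Dy : D y) : \tr (shape_op G F V y *m shape_op G F V y) = sm_ev C Dy (\tr (sh Vc *m sh Vc)).
  by rewrite (AVE y Dy) -ev_mxM trE.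
have A_sym : sh Vc *m (J *m GC *m J^T) = J *m GC *m J^T *m (sh Vc)^T.
  rewrite -[LHS](shape_sym dM dG torsion giK Vc_normal) trmx_mul.
  by rewrite (induced_sym J Gsym).
move/(congr1 (sm_ev C Dx)): S; rewrite -(ev_laplacian evG evJ Gsym dG torsion giK gKi Dx trAA).
rewrite -/(sh _) rmorphM rmorph_nat => ->.
rewrite mulrA mulVf ?pnatr_eq0 // mul1r.
rewrite (ev_normsq_nabla_end evG evJ Gsym dG torsion giK gKi Dx AVE A_sym).
rewrite 2!rmorphD; congr (_ + _ + _).
  rewrite -!uE (rmorphM (sm_ev C Dx)) sm_liftE; last by move=> s; exact: Ck_cst.
  have dotE p (X Y : 'rV[C]_p) M : dot (ev_mx Dx M) (ev_mx Dx X) (ev_mx Dx Y)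
      = sm_ev C Dx ((X *m M *m Y^T) 0 0).
    by rewrite /dot -ev_mxT -!ev_mxM ev_mxE.
  move: HN; rewrite -(NE x Dx) trE; set h := dot _ (mean_curvature _ _ _) _ => HN.
  rewrite (NE x Dx) ANE (AVE x Dx) TE (VE x Dx).
  rewrite -(ev_induced evG evJ Dx) -(evG Dx) -!ev_mxM !dotE !trE -/Nc -/Vc -/(sh _).
  (* The geometric quantities become variables, leaving a polynomial identity to [ring]. *)
  move: ((_ *m Nc^T) 0 0) (\tr (sh Vc)) (\tr (sh Vc *m sh Vc)) => u1 u2 u3.
  move: HN; rewrite -/(sh _); move: (\tr (sh Nc)) (\tr (sh Nc *m sh Vc)) => u4 u5 HN.
  move: ((xi *m P *m (J *m GC *m J^T) *m (xi *m P)^T) 0 0) => u6.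
  move: ((xi *m P *m sh Vc *m (J *m GC *m J^T) *m (xi *m P *m sh Vc)^T) 0 0) => u7.
  move: ((xi *m P *m sh Vc *m (J *m GC *m J^T) *m (xi *m P)^T) 0 0) => u8.
  rewrite !(rmorphD, rmorphN, rmorphXn, rmorphM, rmorph_nat) -HN.
  by congr (_ * _); ring.
rewrite rmorph_sum; apply: eq_bigr => a _.
by rewrite AEE (AVE x Dx) -!ev_mxM !trE rmorphB rmorphM rmorphXn.
Qed.

End simons_in_charts.

(** * The formula for an immersion into a patch of M x R *)

Section local_formula.
Context {R : realType} {m n : nat}.
Variables (c : R) (O : set 'rV[R]_n) (G1 : 'rV[R]_n -> 'M[R]_n).
Hypothesis oO : open O.
Hypothesis sG : smooth_mx O G1.
Hypothesis Gsym : forall z, O z -> (G1 z)^T = G1 z.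
Hypothesis Gpos : forall z v, O z -> v != 0 -> 0 < dot (G1 z) v v.
Hypothesis Gsect : forall z X Y, O z -> row_free (col_mx X Y) -> sectional G1 X Y z = c.
Variables (D : set 'rV[R]_m) (F : 'rV[R]_m -> 'rV[R]_(n + 1)).
Hypothesis oD : open D.
Hypothesis sF : smooth_rV D F.
Hypothesis FO : forall y, D y -> O (lsubmx (F y)).
Hypothesis Ffree : forall y, D y -> row_free (jac F y).
Local Notation G := (line_product_metric G1).
Hypothesis GFpos : forall y w, D y -> w != 0 -> 0 < dot (G (F y)) w w.
Variables (V : 'rV[R]_m -> 'rV[R]_(n + 1)) (r : R).
Hypothesis sV : smooth_rV D V.
Hypothesis V_normal : forall y, D y -> V y *m G (F y) *m (jac F y)^T = 0.
Hypothesis V_parallel : forall y j, D y -> nabla_perp G F j V y = 0.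
Hypothesis V_trace : forall y, D y -> \tr (shape_op G F V y) = r.
Variables (E : 'I_(n + 1 - m) -> 'rV[R]_m -> 'rV[R]_(n + 1)).
Hypothesis sE : forall a, smooth_rV D (E a).
Hypothesis E_normal : forall a y, D y -> E a y *m G (F y) *m (jac F y)^T = 0.
Hypothesis E_orthonormal : forall a b y, D y ->
  dot (G (F y)) (E a y) (E b y) = (a == b)%:R.
Hypothesis mn : (0 < m <= n)%N.

Let C := smooth_model_of oD.
Let B := smooth_model_of oO.
Let F1 y := lsubmx (F y).
Let F2 y := rsubmx (F y).

Let sF1 : smooth_rV D F1.
Proof.
move=> b; rewrite (_ : (fun y => _) = (fun y => F y 0 (lshift 1 b))); first exact: sF.
by apply/funext => y; rewrite mxE.
Qed.

Let sF2 : smooth_rV D F2.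
Proof.
move=> b; rewrite (_ : (fun y => _) = (fun y => F y 0 (rshift n b))); first exact: sF.
by apply/funext => y; rewrite mxE.
Qed.

Let Gunit z : O z -> G1 z \in unitmx.
Proof. by move=> Oz; apply: posdef_unit => v; exact: Gpos. Qed.

Let phi : {rmorphism B -> C} := pullback C oD sF1 FO.
Let J1 : 'M[C]_(m, n) := lift_mx C (jac F1).
Let J2 : 'M[C]_(m, 1) := lift_mx C (jac F2).
Let Gam := christoffel_ring B (christoffel G1).
(** The connection of M pulled back along the first component of the immersion; [om'] extends it by
    the flat connection of the line. *)
Let om := pullback_conn phi J1 Gam.
Let GP := map_mx phi (metric_ring B G1).
Let om' := prod_conn om.
Let G' := prod_metric_mx GP.
Let J : 'M[C]_(m, n + 1) := row_mx J1 J2.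
Let xi : 'rV[C]_(n + 1) := row_mx 0 1%:M.
Let cC : C := sm_lift C (fun=> c).
Let dM := @sm_dM _ _ _ C.

Let chain i b : sm_d C i (phi b) = \sum_p J1 i p * phi (sm_d B p b).
Proof. exact: d_pullback. Qed.

Let dJ1 i l p : sm_d C i (J1 l p) = sm_d C l (J1 i p).
Proof. exact: (d_jac C sF1). Qed.

Let ev_phi p q (A : 'M[B]_(p, q)) y (Dy : D y) :
  ev_mx Dy (map_mx phi A) = ev_mx (FO Dy) A.
Proof. by apply/matrixP => i j; rewrite !mxE; exact: pullbackE. Qed.

Let dG : forall i, map_mx (sm_d C i) GP = om i *m GP + GP *m (om i)^T.
Proof.
move=> i; apply: (pullback_metric chain) => p.
exact: (christoffel_metric B oO sG Gsym Gunit (erefl _)).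
Qed.

Let GPsym : GP^T = GP.
Proof. by rewrite /GP map_trmx (metric_ring_sym B sG Gsym). Qed.

Let torsion1 : forall i j, row j (cov (sm_d C) om i J1) = row i (cov (sm_d C) om j J1).
Proof.
move=> i j; apply: (pullback_torsion phi dJ1) => p q.
exact: (christoffel_ring_sym B oO sG Gsym Gunit (erefl _)).
Qed.

Let torsion2 : forall i j, row j (map_mx (sm_d C i) J2) = row i (map_mx (sm_d C j) J2).
Proof.
by move=> i j; apply/rowP => s; do 2 rewrite [LHS]mxE [RHS]mxE; exact: (d_jac C sF2).
Qed.

Let phi_c : phi (sm_lift B (fun=> c)) = cC.
Proof.
apply: sm_inj => y Dy; rewrite [LHS]pullbackE !sm_liftE // => k; exact: Ck_cst.
Qed.

Let curv1 (W : 'rV[C]_n) i l : W *m curv (sm_d C) om i l =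
  cC *: ((W *m GP *m (row l J1)^T) 0 0 *: row i J1
         - (W *m GP *m (row i J1)^T) 0 0 *: row l J1).
Proof.
rewrite -phi_c; apply: (pullback_curv_space_form dM chain dJ1).
  exact: (metric_ring_sym B sG Gsym).
by move=> p q; exact: (curv_ring_space_form B oO sG Gsym Gpos Gsect).
Qed.

Let dG' : forall i, map_mx (sm_d C i) G' = om' i *m G' + G' *m (om' i)^T.
Proof. exact: (prod_conn_metric dM dG). Qed.

Let G'sym : G'^T = G'.
Proof. exact: (prod_metric_mx_sym GPsym). Qed.

Let torsion : forall i j, row j (cov (sm_d C) om' i J) = row i (cov (sm_d C) om' j J).
Proof. exact: prod_torsion. Qed.

Let xi_parallel : forall i, cov (sm_d C) om' i xi = 0.
Proof. exact: (vertical_parallel dM). Qed.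

Let jacE y : jac F y = row_mx (jac F1 y) (jac F2 y).
Proof.
apply/matrixP => j b; rewrite -(fintype.splitK b); case: (fintype.split b) => l /=.
  rewrite row_mxEl !mxE; apply: (congr1 (fun u => pder j u y)).
  by apply/funext => z; rewrite mxE.
rewrite row_mxEr !mxE; apply: (congr1 (fun u => pder j u y)).
by apply/funext => z; rewrite mxE.
Qed.

Let evJ y (Dy : D y) : ev_mx Dy J = jac F y.
Proof.
by rewrite /ev_mx map_row_mx jacE; congr row_mx; apply: ev_lift_mx; exact: smooth_jac.
Qed.

Let evG y (Dy : D y) : ev_mx Dy G' = G (F y).
Proof.
rewrite /ev_mx map_block_mx !map_mx0 map_mx1 -/(ev_mx Dy GP) ev_phi.
by rewrite (ev_metric B sG).
Qed.

Let evom y (Dy : D y) j q :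
  \sum_p jac F y j p *: christoffel G p q (F y) = row q (ev_mx Dy (om' j)).
Proof.
have uG : G1 (lsubmx (F y)) \in unitmx by exact/Gunit/FO.
have := fun p q => christoffel_line_product p q uG.
have evom1 : ev_mx Dy (om j) = \sum_p jac F1 y j p *: christoffel_mx (christoffel G1) p (F1 y).
  rewrite ev_mx_sum; apply: eq_bigr => p _; rewrite ev_mxZ ev_phi.
  rewrite (ev_christoffel B oO sG Gunit (erefl _)); congr (_ *: _).
  by rewrite -ev_mxE ev_lift_mx //; exact: smooth_jac.
rewrite /ev_mx map_block_mx !map_mx0 -/(ev_mx Dy (om j)) evom1 /christoffel_mx.
move: (christoffel G) (christoffel G1) => K K1 KE.
rewrite big_split_ord /= [X in _ + X]big1 ?addr0; last first.
  by move=> p _; rewrite KE (fintype.unsplitK (inr p : 'I_n + 'I_1)) scaler0.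
rewrite -(fintype.splitK q); case: (fintype.split q) => q' /=; last first.
  rewrite [RHS](_ : _ = 0); last by rewrite /block_mx rowKd row_mx0 row0.
  rewrite big1 // => p _; rewrite KE (fintype.unsplitK (inr q' : 'I_n + 'I_1)).
  by case: (fintype.split _) => *; rewrite scaler0.
rewrite /block_mx rowKu row_row_mx row0.
transitivity (\sum_p row_mx (jac F1 y j p *: K1 p q' (F1 y)) (0 : 'rV[R]_1)).
  apply: eq_bigr => p _; rewrite KE (fintype.unsplitK (inl p : 'I_n + 'I_1)).
  rewrite (fintype.unsplitK (inl q' : 'I_n + 'I_1)) scale_row_mx scaler0 jacE.
  by rewrite row_mxEl.
apply/rowP => s; rewrite summxE -(fintype.splitK s); case: (fintype.split s) => s' /=.
  rewrite row_mxEl [RHS]mxE summxE; apply: eq_bigr => p _.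
  by rewrite row_mxEl !mxE.
by rewrite row_mxEr [RHS]mxE big1 // => p _; rewrite row_mxEr mxE.
Qed.

(** The differential of an immersion is injective, so the induced form is again positive
    definite. *)
Let g_unit y : D y -> induced_metric G F y \in unitmx.
Proof.
move=> Dy; apply: posdef_unit => w w0; rewrite /dot /induced_metric.
have w'0 : w *m jac F y != 0.
  apply: contra w0 => /eqP e; apply/eqP; have := row_free_inj (Ffree Dy).
  by move=> /(_ _ w 0); apply; rewrite /= e mul0mx.
rewrite (_ : _ *m _ = w *m jac F y *m G (F y) *m (w *m jac F y)^T); first exact: GFpos.
by rewrite trmx_mul !mulmxA.
Qed.

Lemma simons_line_product x : D x ->
  let xiF := fun=> row_mx 0 (const_mx 1) : 'rV[R]_(n + 1) in
  let g := induced_metric G F in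
  let AV := shape_op G F V in
  let AE a := shape_op G F (E a) in
  let AN := shape_op G F (fun y => nor G F (xiF y) y) in
  let T := tangential G F (xiF x) x in
  let N := nor G F (xiF x) x in
  let H := mean_curvature G F x in
  let v := V x in
  let AVT := T *m AV x in
  let tdot := dot (g x) in
  let ndot := dot (G (F x)) in
  2^-1 * laplacian g (fun y => \tr (AV y *m AV y)) x
  = normsq_nabla_end g AV x
    + c * ((m%:R - tdot T T) * \tr (AV x *m AV x)
           - 2 * m%:R * tdot AVT AVT
           + 3 * \tr (AV x) * tdot AVT T
           + m%:R * \tr (AN x *m AV x) * ndot v N
           - \tr (AV x) ^+ 2
           - m%:R * \tr (AV x) * ndot H N * ndot v N)
    + \sum_a (\tr (AE a x) * \tr (AV x *m AV x *m AE a x)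
                  - \tr (AV x *m AE a x) ^+ 2).
Proof.
move=> Dx xiF.
have ev_xi y (Dy : D y) : xiF y = ev_mx Dy xi.
  rewrite /ev_mx map_row_mx map_mx0 map_mx1; congr row_mx.
  by apply/rowP => s; rewrite ord1 !mxE.
have [m0 mn'] := andP mn.
have mrk : (m + (n + 1 - m))%N = (n + 1)%N by rewrite subnKC // addn1 ltnW.
have curv W i l := prod_curv J2 curv1 W i l.
exact: (simons_in_chart oD evG evJ evom G'sym dG' torsion g_unit xi_parallel curv
  sV V_normal V_parallel V_trace sE E_normal E_orthonormal m0 mrk ev_xi Dx).
Qed.

End local_formula.

Theorem proposition3p2 (R : realType) (m n : nat) (c : R)
    (M : riemannian R n) (S : manifold R m) (f : S -> product_with_line M)
    (V : forall p, tangent (f p))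
    (U : set S) (E : 'I_(n + 1 - m) -> forall p, tangent (f p))
    (mn : (0 < m <= n)%N)
    (scM : simply_connected R M) (ccM : constant_curvature M c)
    (immf : immersion f)
    (normV : normal_field setT V) (parV : parallel V)
    (trV : constant_trace V)
    (openU : open U) (frameE : orthonormal_normal_frame U E)
    (i : chart S) (a : chart (product_with_line M)) (x : 'rV[R]_m)
    (xD : ldom f i a x) (xU : U (pnt i x)) :
  let G := rmetric a in
  let F := lmap f i a in
  let g := induced_metric G F in
  let AV := shape_op G F (lfield V i a) in
  let AE alpha := shape_op G F (lfield (E alpha) i a) in
  let xi y := vertical (f (pnt i y)) a in
  let AN := shape_op G F (fun y => nor G F (xi y) y) in
  let T := tangential G F (xi x) x in
  let N := nor G F (xi x) x in
  let H := mean_curvature G F x in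
  let v := lfield V i a x in
  let AVT := T *m AV x in
  let tdot := dot (g x) in
  let ndot := dot (G (F x)) in
  2^-1 * laplacian g (fun y => \tr (AV y *m AV y)) x
  = normsq_nabla_end g AV x
    + c * ((m%:R - tdot T T) * \tr (AV x *m AV x)
           - 2 * m%:R * tdot AVT AVT
           + 3 * \tr (AV x) * tdot AVT T
           + m%:R * \tr (AN x *m AV x) * ndot v N
           - \tr (AV x) ^+ 2
           - m%:R * \tr (AV x) * ndot H N * ndot v N)
    + \sum_alpha (\tr (AE alpha x) * \tr (AV x *m AV x *m AE alpha x)
                  - \tr (AV x *m AE alpha x) ^+ 2).
Proof.
(* The ring is built on the part of the chart domain that is mapped into the target chart and over
   which the frame E is defined. *)
have oD : open (ldom f i a `&` pnt i @^-1` U).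
  rewrite openE => y [[ry dy] yU].
  have cp := pnt_continuous ry.
  have cfp : {for y, continuous (f \o pnt i)}.
    by apply: continuous_comp => //; exact: immf.1.
  have rn : nbhs y (rng i) by apply: open_nbhs_nbhs; split=> //; exact: rng_open.
  have dn : nbhs y ((f \o pnt i) @^-1` dom a).
    by apply: cfp; apply: open_nbhs_nbhs; split=> //; exact: dom_open.
  have un : nbhs y (pnt i @^-1` U) by apply: cp; exact: open_nbhs_nbhs.
  by apply: filterS3 rn dn un => z ? ? ?.
set D := ldom f i a `&` pnt i @^-1` U in oD.
have DD y : D y -> ldom f i a y by case.
have FO y : D y -> rng a.1 (lsubmx (lmap f i a y)).
  move=> [[ry dy] _]; have [r1 _] := crd_rng dy.
  exact: r1.
have [sF Ffree] := immf.2 i a.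
have [sV V_normal] := normV i a.
have [r V_trace] := trV.
have sub (u : 'rV[R]_m -> R) : smooth_on (ldom f i a) u -> smooth_on D u.
  by move=> su k; exact: Ck_sub (su k).
have sF' : smooth_rV D (lmap f i a) by move=> b; exact/sub/sF.
have Ffree' y : D y -> row_free (jac (lmap f i a) y) by move=> /DD/Ffree.
have GFpos y w : D y -> w != 0 -> 0 < dot (rmetric a (lmap f i a y)) w w.
  by move=> [[ry dy] _]; exact: rmetric_pos (crd_rng dy).
have sV' : smooth_rV D (lfield V i a).
  by move=> b k; apply: Ck_sub (sV b k) => y [].
have V_normal' y : D y -> lfield V i a y *m rmetric a (lmap f i a y) *m (jac (lmap f i a) y)^T = 0.
  by move=> [yD _]; exact: V_normal.
have V_parallel y j : D y -> nabla_perp (rmetric a) (lmap f i a) j (lfield V i a) y = 0.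
  by move=> /DD yD; exact: parV.
have V_trace' y : D y -> \tr (shape_op (rmetric a) (lmap f i a) (lfield V i a) y) = r.
  by move=> /DD; exact: V_trace.
have E_orthonormal alpha beta y : D y ->
    dot (rmetric a (lmap f i a y)) (lfield (E alpha) i a y) (lfield (E beta) i a y)
    = (alpha == beta)%:R.
  by move=> [[ry dy] yU]; exact: frameE.2.
(* By conversion [rmetric a] is [line_product_metric (rmetric a.1)], and [vertical] has the constant
   coordinates [row_mx 0 (const_mx 1)]. *)
exact: (simons_line_product (@rng_open _ _ M a.1) (@rmetric_smooth _ _ M a.1)
  (@rmetric_sym _ _ M a.1) (@rmetric_pos _ _ M a.1) (fun z X Y => @ccM a.1 z X Y)
  oD sF' FO Ffree' GFpos sV' V_normal' V_parallel V_trace'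
  (fun alpha => (frameE.1 alpha i a).1) (fun alpha => (frameE.1 alpha i a).2)
  E_orthonormal mn (conj xD xU)).
Qed.
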